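(* Let $G$ be a planar subcubic graph with girth $g\geq 8$. Then $\chi^2(G)\leq 6$.
   Context: Graphs are finite and simple. A graph is subcubic if its maximum degree is at most $3$. The girth is the length of a shortest cycle (infinite for a forest). A 2-distance $k$-coloring of $G=(V,E)$ is a map $\phi:V\to\{1,\dots,k\}$ such that no two distinct vertices at distance at most $2$ in $G$ receive the same color. $\chi^2(G)$ is the least $k$ for which $G$ has a 2-distance $k$-coloring. *)

(* Defs.v *)
From mathcomp Require Import all_boot all_order all_algebra.
From mathcomp Require Import all_classical all_reals all_analysis.

Set Implicit Arguments.
Unset Strict Implicit.
Unset Printing Implicit Defensive.

Import Order.TTheory GRing.Theory Num.Theory.
Import numFieldNormedType.Exports.

Local Open Scope ring_scope.
Local Open Scope classical_set_scope.

(* A simple graph is a symmetric irreflexive relation [e] on a [finType]. *)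

Section Graph.

Variables (T : finType) (e : rel T).

Definition edges : {set {set T}} :=
  [set [set p.1; p.2]%SET | p : T * T & e p.1 p.2]%SET.

Definition max_degree : nat := (\max_(x : T) #|[set y | e x y]%SET|)%N.

(* [ucycleb] alone also accepts [::], and [:: x; y] whenever [x] and [y] are
   adjacent. *)
Definition has_cycle (k : nat) : bool :=
  (2 < k)%N && [exists c : k.-tuple T, ucycleb e c].

(* [None] stands for the infinite girth of a forest. *)
Definition girth : option nat :=
  if pselect (exists k, has_cycle k) is left h then Some (ex_minn h) else None.

Definition girth_ge (k : nat) : bool :=
  if girth is Some g then (k <= g)%N else true.

(* Distance at most [k], witnessed by a walk with at most [k] edges. *)
Definition dist_le (k : nat) (x y : T) : bool :=
  [exists n : 'I_k.+1, exists p : n.-tuple T, path e x p && (last x p == y)].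

Definition two_distance_coloring (k : nat) (phi : {ffun T -> 'I_k}) : bool :=
  [forall x, forall y, (x != y) && dist_le 2 x y ==> (phi x != phi y)].

Definition two_distance_colorable (k : nat) : bool :=
  [exists phi : {ffun T -> 'I_k}, two_distance_coloring phi].

Lemma two_distance_colorable_ex : exists k, two_distance_colorable k.
Proof.
exists #|T|; apply/existsP; exists [ffun x => enum_rank x].
apply/forallP => x; apply/forallP => y; apply/implyP => /andP[xy _].
by rewrite !ffunE (inj_eq enum_rank_inj).
Qed.

Definition chi2 : nat := ex_minn two_distance_colorable_ex.

(* A drawing in the plane: vertices are distinct points; the edge [A] is the
   arc [gamma A] over [0, 1], joining the two ends of [A] (in either direction);
   the interior of an arc contains no vertex and no interior point of another
   arc. *)
Definition plane_drawing (R : realType) (pt : T -> R * R)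
    (gamma : {set T} -> R -> R * R) : Prop :=
  [/\ injective pt,
      forall A, A \in edges ->
        [/\ {within `[0, 1], continuous (gamma A)},
            {in `[0, 1] &, injective (gamma A)} &
            [set gamma A 0; gamma A 1] = pt @` [set x | x \in A]],
      forall A x t, A \in edges -> t \in `]0, 1[ -> gamma A t <> pt x &
      forall A B s t, A \in edges -> B \in edges -> A <> B ->
        s \in `]0, 1[ -> t \in `]0, 1[ -> gamma A s <> gamma B t].

Definition planar (R : realType) : Prop :=
  exists (pt : T -> R * R) (gamma : {set T} -> R -> R * R),
    plane_drawing pt gamma.

End Graph.

(* Main.v *)
Require Import Defs.
From mathcomp Require Import all_boot all_order all_algebra.
From mathcomp Require all_fingroup.
From mathcomp Require Import zify ring lra.

(** A minimal non-colourable graph has minimum degree 2, no two adjacent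
    2-vertices and no bridge. A configuration is reducible when every colouring
    of the rest extends to it from the lists of remaining colours; by the
    Alon-Tarsi theorem a nonzero coefficient of the graph polynomial certifies
    this, and only one configuration needs in addition a [K_4] argument on the
    lists.

    Planarity enters only through faces: a drawing yields a minor model in a
    finite grid, where an even subgraph is the boundary of a two-colouring of
    the unit squares and every vertex sees the boundary of a set of squares an
    even number of times; both properties pass to minors, so that no Jordan
    curve theorem is needed. Counting even subgraphs replaces Euler's formula and
    shows that the number [n3] of 3-vertices of a face is less than 6 on average.
    A face with [n3 < 6] is an 8-cycle with three 2-vertices, hence with exactly
    two edges joining 3-vertices; it takes 1/2 from the face behind each of
    them, and then no face has a negative value of [n3 - 6]. *)

Set Implicit Arguments.
Unset Strict Implicit.
Unset Printing Implicit Defensive.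

(** * List colouring *)

(** Girth 8 makes reducibility a local matter: a non-backtracking walk of at most 7 edges never
    returns to its start. So a configuration need only be embedded injectively around each vertex,
    and coincidences, unlisted adjacencies and common neighbours are excluded by exhibiting short
    walks; the few distant pairs left over become separate cases.

    The arcs of a drawing are merely continuous, so several arcs leaving one vertex may overlap once
    they are rounded to a grid. Only pieces of arcs at positive distance stay disjoint: the middle
    thirds of different edges, and the first thirds at different vertices. The first thirds at a
    vertex are therefore contracted to one branch set, which is why minors of the grid appear
    instead of subgraphs.

    A face boundary may consist of several cycles. Each has at least four 3-vertices, so a boundary
    with [n3 < 8] is a single cycle, and larger values of [n3] need no such description.

    Counting gives [|E| < |V| + |F|], one less than Euler's formula would. This suffices: all
    degrees are 2 or 3, so with [n] vertices of degree 3 it reads [n < 2 |F|], and discharging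
    proves [2 |F| <= n]. *)

Lemma leq_all2_sumn_eq (s t : seq nat) :
  all2 leq s t -> sumn t = sumn s -> s = t.
Proof.
elim: s t => [|x s IHs] [|y t] //= /andP[xy st] e.
have st' : sumn s <= sumn t.
  elim: s t st {IHs e} => [|a s IHs] [|b t] //= /andP[ab /IHs]; exact: leq_add.
have xy' : x = y by move: xy st' e; lia.
by rewrite xy' (IHs t) //; move: e; rewrite xy'; lia.
Qed.

Lemma sumn_incr_nth (m : seq nat) i :
  i < size m -> sumn (incr_nth m i) = (sumn m).+1.
Proof.
by elim: m i => [|x m IHm] [|i] //= im; rewrite IHm // addnS.
Qed.

Section ListColouring.
Import Order.TTheory GRing.Theory Num.Theory.
Local Open Scope ring_scope.

Section AlonTarsi.

Variable q : nat.

Let ev (a : 'I_q) : rat := (a : nat)%:R.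

Let ev_inj : injective ev.
Proof.
move=> a b /eqP; rewrite /ev eqr_nat => /eqP ab; exact: val_inj.
Qed.

(* Divided differences: the functional [P |-> \sum_(a in A) w a * P.[a]] is the
   leading coefficient of [P] when [size P <= #|A|]. *)
Lemma leading_weights (A : {set 'I_q}) (d : nat) : #|A| = d.+1 ->
  exists w : 'I_q -> rat, forall k, (k <= d)%N ->
    \sum_(a in A) w a * ev a ^+ k = (k == d)%:R.
Proof.
elim: d A => [|d IHd] A.
  move/eqP/cards1P => [a ->]; exists (fun _ => 1) => k.
  by rewrite leqn0 => /eqP ->; rewrite big_set1 expr0 mulr1.
move=> cA; have [b bA] : exists b, b \in A.
  by apply/card_gt0P; rewrite cA.
have cAb : #|A :\ b| = d.+1 by move: cA; rewrite (cardsD1 b) bA => -[].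
have [w wP] := IHd _ cAb.
(* Newton's recursion: the weights of order [d] are divided by the distance to the new node [b],
   whose own weight makes the zeroth moment vanish. *)
pose u a := if a == b then - \sum_(x in A :\ b) w x / (ev x - ev b)
            else w a / (ev a - ev b).
pose S k := \sum_(a in A) u a * ev a ^+ k.
have S_b k : S k = u b * ev b ^+ k + \sum_(a in A :\ b) w a / (ev a - ev b) * ev a ^+ k.
  rewrite /S (big_setD1 b) //=; congr (_ + _); apply: eq_bigr => a.
  by rewrite !inE /u => /andP[/negbTE ->].
have S0 : S 0%N = 0.
  rewrite S_b /u eqxx expr0 mulr1.
  by under [X in _ + X]eq_bigr do rewrite expr0 mulr1; rewrite addNr.
(* Splitting one factor [a] as [(a - b) + b]: the first summand cancels the denominators and
   restores the weights of order [d]. *)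
have SS k : (k <= d)%N -> S k.+1 = ev b * S k + (k == d)%:R.
  move=> kd; rewrite !S_b -(wP k kd) mulrDr mulr_sumr -addrA -big_split /=.
  congr (_ + _); first by rewrite exprS; ring.
  apply: eq_bigr => a; rewrite !inE => /andP[ab _].
  have : ev a - ev b != 0 by rewrite subr_eq0 (inj_eq ev_inj).
  by move=> ne; rewrite exprS; field.
exists u => -[|k]; first by rewrite -/(S 0%N) S0.
rewrite ltnS -/(S k.+1) => kd.
have S_0 j : (j <= d)%N -> S j = 0.
  elim: j => [|j IHj] jd //; rewrite SS ?IHj ?(ltnW jd) // mulr0 add0r.
  by rewrite (ltn_eqF jd).
by rewrite SS // S_0 // mulr0 add0r eqSS.
Qed.

Variable n : nat.
Variable w : 'I_n -> 'I_q -> rat.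
Variable L : 'I_n -> {set 'I_q}.

Definition coord (c : {ffun 'I_n -> 'I_q}) (i : nat) : rat :=
  if insub i is Some j then ev (c j) else 0.

Lemma coordE c (i : 'I_n) : coord c i = ev (c i).
Proof. by rewrite /coord valK. Qed.

(** The leading-coefficient functionals of all vertices, applied to the monomial [m] times the graph
    polynomial of [E]. *)
Definition functional (E : seq (nat * nat)) (m : seq nat) : rat :=
  \sum_(c | c \in family (fun i => mem (L i)))
     (\prod_i (w i (c i) * ev (c i) ^+ nth 0%N m i))
     * \prod_(p <- E) (coord c p.1 - coord c p.2).

Let incr_monomial m (c : {ffun 'I_n -> 'I_q}) (j : nat) : (j < n)%N ->
  \prod_i (w i (c i) * ev (c i) ^+ nth 0%N (incr_nth m j) i) =
  (\prod_i (w i (c i) * ev (c i) ^+ nth 0%N m i)) * coord c j.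
Proof.
move=> jn; pose j' := Ordinal jn.
rewrite (bigD1 j') //= [in RHS](bigD1 j') //= nth_incr_nth eqxx add1n exprS.
rewrite (_ : coord c j = ev (c j')) -?[j in coord c j]/(val j') ?coordE //.
rewrite [X in _ * X](eq_bigr (fun i => w i (c i) * ev (c i) ^+ nth 0%N m i)).
  by ring.
move=> i ij; rewrite nth_incr_nth (_ : (j == i) = false) //.
by apply/negbTE; apply: contraNN ij => /eqP ji; apply/eqP/val_inj.
Qed.

Let functional_cons p E m : (p.1 < n)%N -> (p.2 < n)%N ->
  functional (p :: E) m =
  functional E (incr_nth m p.1) - functional E (incr_nth m p.2).
Proof.
move=> p1 p2; rewrite /functional -sumrB; apply: eq_bigr => c _.
by rewrite big_cons !incr_monomial //; ring.
Qed.

Variable d : seq nat.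
Hypothesis size_d : size d = n.
Hypothesis wP : forall i k, (k <= nth 0%N d (i : 'I_n))%N ->
  \sum_(a in L i) w i a * ev a ^+ k = (k == nth 0%N d i)%:R.

(** Only moments of order at most [d] are known. Homogeneity compensates: a monomial of the same
    total degree other than [d] has an exponent below that of [d], and this factor vanishes. *)
Let functional_nil m : size m = n -> sumn m = sumn d ->
  functional [::] m = (m == d)%:R.
Proof.
move=> sm md; rewrite /functional.
under eq_bigr do rewrite big_nil mulr1.
rewrite -(bigA_distr_big_dep (fun i => mem (L i))
  (fun i a => w i a * ev a ^+ nth 0%N m i)) /=.
have [-> | ne] := eqVneq m d.
  by rewrite big1 // => i _; rewrite wP ?eqxx.
have [i mi] : exists i : 'I_n, (nth 0 m i < nth 0 d i)%N.
  apply/existsP; apply: contraNT ne; rewrite negb_exists => /forallP dm.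
  apply/eqP/esym/leq_all2_sumn_eq => //.
  rewrite all2E size_d sm eqxx /=; apply/(all_nthP (0, 0)%N) => j.
  rewrite size_zip size_d sm minnn => jn; rewrite nth_zip ?size_d //=.
  by have := dm (Ordinal jn); rewrite -leqNgt.
by rewrite (bigD1 i) //= wP ?(ltnW mi) // (ltn_eqF mi) mul0r.
Qed.

(** The coefficient of [d] in the monomial [m] times the graph polynomial: an edge raises the
    exponent of either of its ends, with opposite signs. *)
Fixpoint signed_count (E : seq (nat * nat)) (m : seq nat) : int :=
  if E is p :: E'
  then signed_count E' (incr_nth m p.1) - signed_count E' (incr_nth m p.2)
  else (m == d)%:R.

Lemma functionalE E m : all (fun p => (p.1 < n) && (p.2 < n))%N E ->
  size m = n -> (sumn m + size E)%N = sumn d ->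
  functional E m = (signed_count E m)%:~R.
Proof.
elim: E m => [|p E IHE] m /=.
  by move=> _ sm; rewrite addn0 => /functional_nil->; rewrite // mulrz_nat.
case/andP => /andP[p1 p2] En sm sE; rewrite functional_cons // rmorphB /=.
have inc j : (j < n)%N -> size (incr_nth m j) = n /\
    (sumn (incr_nth m j) + size E)%N = sumn d.
  by move=> jn; rewrite size_incr_nth sm jn sumn_incr_nth ?sm // addSnnS.
by have [? ?] := inc _ p1; have [? ?] := inc _ p2; rewrite !IHE.
Qed.

End AlonTarsi.

(* The Alon-Tarsi theorem: the value of [functional] is the coefficient of the
   monomial [d] in the graph polynomial. *)
Theorem alon_tarsi (q n : nat) (L : 'I_n -> {set 'I_q}) (E : seq (nat * nat))
    (d : seq nat) :
  size d = n -> size E = sumn d -> all (fun p => (p.1 < n) && (p.2 < n))%N E ->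
  (forall i : 'I_n, nth 0%N d i < #|L i|)%N ->
  signed_count d E (nseq n 0%N) != 0 ->
  exists2 c : 'I_n -> 'I_q, forall i, c i \in L i &
    forall i j : 'I_n, (val i, val j) \in E -> c i != c j.
Proof.
move=> sd sE En dL nz.
(* The interpolation weights belong to lists of exactly [d_i + 1] colours. *)
have sub i : exists2 A : {set 'I_q}, A \subset L i & #|A| = (nth 0%N d i).+1.
  have /card_geqP[s [us ss sL]] := dL i; exists [set:: s].
    by apply/subsetP => x; rewrite inE => /sL.
  by rewrite cardsE (card_uniqP us).
have [A AL cA] := fin_all_exists2 sub.
have [w wP] := fin_all_exists (fun i => leading_weights (cA i)).
have fE := @functionalE q n w A d sd wP E (nseq n 0%N) En.
have := fE (size_nseq _ _); rewrite sumn_nseq mul0n add0n => /(_ sE) {}fE.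
have [c cA' cE] : exists2 c, c \in family (fun i => mem (A i)) &
    \prod_(p <- E) (coord c p.1 - coord c p.2) != 0.
  apply/exists_inP; apply: contraNT nz; rewrite negb_exists_in => /forall_inP cE.
  suff : (signed_count d E (nseq n 0%N))%:~R == 0 :> rat by rewrite intr_eq0.
  rewrite -fE /functional big1 // => c cA'; apply/eqP; rewrite mulf_eq0 orbC.
  by rewrite -[X in X || _]negbK cE.
exists c => [i|i j ij]; first by apply: (subsetP (AL i)); have /familyP := cA'.
apply: contraNneq cE => cij; rewrite (big_rem _ ij) /= !coordE cij.
by rewrite subrr mul0r.
Qed.

(* Evaluation of [signed_count] by dynamic programming over the exponents
   reached so far; exponents that can no longer become [d] are dropped. *)
Fixpoint viable (d m r : seq nat) : bool :=
  if d is x :: d' then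
    if m is y :: m' then
      [&& (y <= x)%N, (x <= y + head 0 r)%N & viable d' m' (behead r)]
    else true
  else true.

Fixpoint insert_term (m : seq nat) (c : int) (st : seq (seq nat * int)) :=
  if st is x :: st' then
    if m == x.1 then (m, c + x.2) :: st' else x :: insert_term m c st'
  else [:: (m, c)].

Definition degrees (E : seq (nat * nat)) : seq nat :=
  foldr (fun p r => incr_nth (incr_nth r p.1) p.2) [::] E.

Definition insert_viable d r m c st :=
  if viable d m r then insert_term m c st else st.

Fixpoint expand d (E : seq (nat * nat)) (st : seq (seq nat * int)) :=
  if E is p :: E' then
    let r := degrees E' in
    expand d E' (foldr (fun x acc =>
      insert_viable d r (incr_nth x.1 p.1) x.2
        (insert_viable d r (incr_nth x.1 p.2) (- x.2) acc)) [::] st)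
  else st.

(** The invariant of [expand]: processing an edge changes the terms but not this sum. *)
Definition total d E (st : seq (seq nat * int)) : int :=
  \sum_(x <- st) x.2 * signed_count d E x.1.

Lemma total_insert d E m c st :
  total d E (insert_term m c st) = c * signed_count d E m + total d E st.
Proof.
elim: st => [|[m' c'] st IHst] /=; first by rewrite /total big_seq1 big_nil addr0.
case: eqVneq => [->|_] /=; rewrite /total !big_cons /=; first by ring.
by rewrite -/(total d E (insert_term m c st)) IHst /total; ring.
Qed.

Lemma signed_count0 d E m i :
  (nth 0 d i < nth 0 m i)%N || (nth 0 m i + nth 0 (degrees E) i < nth 0 d i)%N ->
  signed_count d E m = 0.
Proof.
elim: E m => [|p E IHE] m /=.
  by rewrite nth_nil addn0; case: eqVneq => [->|//]; rewrite ltnn.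
move=> h; rewrite !IHE ?subrr // !nth_incr_nth; move: h;
  rewrite !nth_incr_nth; lia.
Qed.

Lemma viableN d E m : ~~ viable d m (degrees E) -> signed_count d E m = 0.
Proof.
move=> h; suff [i hi] : exists i, (nth 0 d i < nth 0 m i)%N ||
    (nth 0 m i + nth 0 (degrees E) i < nth 0 d i)%N by exact: signed_count0 hi.
move: h; elim: d m (degrees E) => [|x d IHd] [|y m] r //=.
rewrite !negb_and -!ltnNge => /or3P[h|h|/IHd[i hi]].
- by exists 0%N; rewrite /= h.
- by exists 0%N; rewrite /= nth0 h orbT.
- by exists i.+1; rewrite /= -[nth 0%N r i.+1]nth_behead.
Qed.

Lemma total_insert_viable d E m c st :
  total d E (insert_viable d (degrees E) m c st) =
  c * signed_count d E m + total d E st.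
Proof.
rewrite /insert_viable; case: ifPn => [_|/viableN->]; first exact: total_insert.
by rewrite mulr0 add0r.
Qed.

Lemma total_expand d E st : total d [::] (expand d E st) = total d E st.
Proof.
elim: E st => [|p E IHE] st //=; rewrite IHE {IHE}.
elim: st => [|[m c] st IHst] /=; first by rewrite /total !big_nil.
rewrite !total_insert_viable IHst /total big_cons /=; ring.
Qed.

Definition at_check (d : seq nat) (E : seq (nat * nat)) : bool :=
  [&& size E == sumn d,
      all (fun p => (p.1 < size d) && (p.2 < size d))%N E
    & if expand d E [:: (nseq (size d) 0%N, 1)] is [:: (m, c)]
      then (m == d) && (c != 0) else false].

Corollary at_checkP (q n : nat) (L : 'I_n -> {set 'I_q}) E d :
  size d = n -> at_check d E -> (forall i : 'I_n, nth 0%N d i < #|L i|)%N ->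
  exists2 c : 'I_n -> 'I_q, forall i, c i \in L i &
    forall i j : 'I_n, (val i, val j) \in E -> c i != c j.
Proof.
move=> sd /and3P[/eqP sE En h] dL; apply: (alon_tarsi sd sE) => //.
  by rewrite -sd.
have := total_expand d E [:: (nseq (size d) 0%N, 1)].
move: h; case: expand => [|[m c] [|? ?]] // /andP[/eqP-> c0].
rewrite /total !big_seq1 /= eqxx mulr1 mul1r => ec.
by rewrite -sd -ec.
Qed.

End ListColouring.

(** * Reducible configurations *)

Section Square.

Variables (T : finType) (e : rel T).
Hypotheses (e_sym : symmetric e) (e_irr : irreflexive e).

(** Adjacency in the square of the subgraph induced on [A]. Distances are measured inside [A], so
    deleting a vertex can relax the constraint between two of its neighbours. *)
Definition sq (A : {set T}) (x y : T) : bool :=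
  [&& x \in A, y \in A, x != y & e x y || [exists z in A, e x z && e z y]].

Definition colorable (A : {set T}) : Prop :=
  exists phi : T -> 'I_6, forall x y, sq A x y -> phi x != phi y.

Definition critical (A : {set T}) : Prop :=
  ~ colorable A /\ forall B : {set T}, B \proper A -> colorable B.

Lemma sq_sym A : symmetric (sq A).
Proof.
move=> x y; rewrite /sq andbCA eq_sym e_sym; congr [&& _, _, _ & _ || _].
by apply/exists_inP/exists_inP => -[z zA /andP[? ?]]; exists z;
  rewrite // e_sym andbC e_sym; apply/andP.
Qed.

Definition nbrs (A : {set T}) x := [set y in A | e x y].

(** The list of a vertex of [U] consists of the colours left over by its neighbours in the square
    outside [U]; the monomial [d] certifies a choice from these lists. *)
Lemma extend_coloring (A : {set T}) (n : nat) (phi : nat -> T)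
    (psi : T -> 'I_6) (E : seq (nat * nat)) (d : seq nat) :
  let U := [set phi (val i) | i : 'I_n] in
  (forall x y, x \notin U -> y \notin U -> sq A x y -> psi x != psi y) ->
  (forall i j, i < n -> j < n -> phi i = phi j -> i = j) ->
  (forall i j, i < j < n -> sq A (phi i) (phi j) -> (i, j) \in E) ->
  size d = n -> at_check d E ->
  (forall i, i < n -> nth 0 d i <
     #|~: (psi @: [set y | sq A (phi i) y & y \notin U])|) ->
  colorable A.
Proof.
move=> U psiP phiI EP sd chk dL.
have [c cL cE] := at_checkP sd chk (fun i => dL i (ltn_ord i)).
pose chi x := if [pick i : 'I_n | phi i == x] is Some i then c i else psi x.
have chiU i : chi (phi (val i)) = c i.
  rewrite /chi; case: pickP => [j /eqP ji|/(_ i)]; last by rewrite eqxx.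
  have -> : j = i by apply: val_inj; exact: (phiI _ _ (ltn_ord _) (ltn_ord _) ji).
  by [].
have chiN x : x \notin U -> chi x = psi x.
  rewrite /chi; case: pickP => // i /eqP <- /negP[].
  by apply/imsetP; exists i.
have UP x : x \in U -> exists2 i : 'I_n, x = phi i & chi x = c i.
  by case/imsetP => i _ ->; exists i.
have out x y : x \in U -> y \notin U -> sq A x y -> chi x != chi y.
  move=> /UP[i -> ->] yU s; rewrite chiN //.
  have := cL i; rewrite inE; apply: contraNneq => ->.
  by apply: imset_f; rewrite inE s.
exists chi => x y s; have [xU|xU] := boolP (x \in U); last first.
  have [yU|yU] := boolP (y \in U); last by rewrite !chiN //; apply: psiP.
  by rewrite eq_sym out // sq_sym.
have [yU|yU] := boolP (y \in U); last exact: out.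
have [i xi ->] := UP _ xU; have [j yj ->] := UP _ yU.
move: s; rewrite xi yj; case: (ltngtP i j) => ij s.
- by apply: cE; apply: EP; rewrite ?ij //=.
- by rewrite eq_sym; apply: cE; apply: EP; rewrite ?ij //= sq_sym.
- by move: s; rewrite /sq ij eqxx !andbF.
Qed.

(** Deleting [U] can only lose constraints between two outside neighbours of a deleted vertex. When
    there is at most one such neighbour, a colouring of the smaller set respects the square on
    [A]. *)
Lemma critical_delete (A U : {set T}) :
  critical A -> U \subset A -> U != set0 ->
  (forall u x y, u \in U -> x \in nbrs A u -> y \in nbrs A u ->
     x \notin U -> y \notin U -> x = y) ->
  exists psi : T -> 'I_6,
    forall x y, x \notin U -> y \notin U -> sq A x y -> psi x != psi y.
Proof.
move=> [_ min] UA /set0Pn[u uU] one.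
have [|psi psiP] := min (A :\: U).
  rewrite properE subsetDl; apply/subsetPn; exists u; first exact: (subsetP UA).
  by rewrite inE uU.
exists psi => x y xU yU; rewrite /sq => /and4P[xA yA xy h].
apply: psiP; rewrite /sq !inE xU yU xA yA xy /=.
case/orP: h => [-> //|/exists_inP[z zA /andP[xz zy]]].
apply/orP; right; apply/exists_inP; exists z; last by rewrite xz.
rewrite inE zA andbT; apply: contra_neqN xy => zU.
by apply: (one z) => //; rewrite !inE ?xA ?yA // e_sym.
Qed.

Fixpoint reduced (x : T) (p : seq T) : bool :=
  if p is y :: p' then
    (if p' is z :: _ then x != z else true) && reduced y p'
  else true.

Variable g : nat.
Hypothesis no_short_cycle : forall c, ucycle e c -> 2 < size c -> g < size c.

(** A return to [v] would close a cycle of length at most [g]; the absence of backtracking gives it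
    at least three vertices. *)
Lemma reduced_uniq v p :
  path e v p -> reduced v p -> size p <= g -> uniq (v :: p).
Proof.
elim: p v => [|y p IHp] v // vyp ryp sp.
have /andP[vy yp] := vyp; have /andP[bt rp] := ryp.
have up := IHp y yp rp (ltnW sp); rewrite cons_uniq up andbT.
have vp : path e v (y :: p) by rewrite /= vy.
have bt' : forall a z q, y :: p = a :: z :: q -> v != z.
  by move=> a z q [_ pE]; move: bt; rewrite pE.
apply/negP => /splitPr vs; case: vs up vp bt' sp => p1 p2 up vp bt' sp.
have vp1 : v \notin p1.
  by apply/negP => vp1; move: up; rewrite cat_uniq /= negb_or vp1 /= andbF.
have size_p1 : 1 < size p1.
  case: p1 vp {up vp1 sp} bt' => [|a [|b p1]] //=; first by rewrite e_irr.
  by move=> _ /(_ a v _ erefl); rewrite eqxx.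
have := @no_short_cycle (v :: p1); rewrite ltnS size_p1 => /(_ _ isT).
rewrite ltnNge => /(_ _)/negP; case.
  rewrite /ucycle /ucycleb /= vp1; move: up; rewrite cat_uniq => /and3P[-> _ _].
  by rewrite rcons_path; move: vp; rewrite cat_path /= => /and3P[-> -> _].
by move: sp; rewrite size_cat /=; lia.
Qed.

(* A non-backtracking walk with [l] edges from [x] to [v] whose last edge is
   [(u, v)]; the sequence [p] lists it backwards. *)
Definition rwalk (x : T) (l : nat) (u v : T) : Prop :=
  exists p, [/\ path e v (u :: p), reduced v (u :: p), last u p = x
               & size (u :: p) = l].

Lemma rwalk1 x y : e x y -> rwalk x 1 x y.
Proof. by move=> xy; exists [::]; rewrite /= e_sym xy. Qed.

Lemma rwalkS x l u v w : rwalk x l u v -> e v w -> w != u -> rwalk x l.+1 v w.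
Proof.
move=> [p [vp rp xp sp]] vw wu; exists (u :: p); split=> //=.
- by rewrite e_sym vw; exact: vp.
- by rewrite wu; exact: rp.
- by rewrite -sp.
Qed.

Lemma rwalk_neq x l u v : rwalk x l u v -> l <= g -> v != x.
Proof.
move=> [p [vp rp xp <-]] lg; have := reduced_uniq vp rp lg.
by case/andP=> + _; apply: contraNneq => ->; rewrite -xp mem_last.
Qed.

End Square.

(* A pattern lists the neighbours [nb] of its vertices [0, 1, ...] and upper
   bounds [dg] for their degrees; a vertex with fewer than [dg] listed
   neighbours has a slot, i.e. may have one further neighbour outside. *)
Section PatternCheck.

Variables (nb : seq (seq nat)) (dg : seq nat) (ns na : seq (nat * nat)).

Definition nbp i := nth [::] nb i.
Definition slot i : bool := size (nbp i) < nth 0 dg i.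

Definition pwalk_step (W : seq (nat * nat)) :=
  flatten [seq [seq (p.2, k) | k <- nbp p.2 & k != p.1] | p <- W].

(* Last edges of the non-backtracking walks with [l.+1] edges from [i]. *)
Definition pwalk i l := iter l pwalk_step [seq (i, j) | j <- nbp i].

Definition near i L := flatten [seq unzip2 (pwalk i l) | l <- iota 0 L].

(** Closed non-backtracking walks have at least 8 edges. A common outside neighbour adds two edges
    to a walk and an unlisted adjacency adds one; hence the lengths 5 here and 6 and 7 in
    [vertex_check]. Pairs in [ns] are assumed to have no common neighbour, pairs in [na] to be
    non-adjacent. *)
Definition pat_edges : seq (nat * nat) :=
  flatten [seq let nj := nbp j in let fj := near j 5 in
    [seq (i, j) | i <- iota 0 j &
      [|| i \in nj, has [in nj] (nbp i) |
         [&& slot i, slot j, i \notin fj & (i, j) \notin ns]]]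
    | j <- iota 0 (size nb)].

Definition vertex_check i :=
  let n := size nb in let n6 := near i 6 in let n7 := near i 7 in
  [&& uniq (nbp i), all (fun j => (j < n) && (i \in nbp j)) (nbp i),
      nth 0 dg i <= (size (nbp i)).+1,
      all (fun j => (j == i) || (j \in n7)) (iota 0 n)
    & all (fun j => [|| j == i, j \in nbp i, ~~ slot i, ~~ slot j, j \in n6,
                        (i, j) \in na | (j, i) \in na]) (iota 0 n)].

Definition pat_wf : bool := all vertex_check (iota 0 (size nb)).

(** A slot of [i] gives at most three outside vertices within distance 2, namely a neighbour and its
    two further neighbours; a slot of a listed neighbour gives one. More than [d_i] of the six
    colours must remain. *)
Definition pat_check (d : seq nat) : bool :=
  [&& 0 < size nb, size d == size nb,
      all (fun i => nth 0 d i + 3 * slot i +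
        sumn [seq nat_of_bool (slot j) | j <- nbp i] < 6) (iota 0 (size nb))
    & at_check d pat_edges].

End PatternCheck.

(** * Reducibility of certified patterns *)

Section Pattern.

Variables (T : finType) (e : rel T).
Hypotheses (e_sym : symmetric e) (e_irr : irreflexive e).
Hypothesis girth8 : forall c, ucycle e c -> 2 < size c -> 7 < size c.
Hypothesis subcubic : forall x, #|[set y | e x y]| <= 3.

Variables (A : {set T}) (nb : seq (seq nat)) (dg : seq nat).
Variables (ns na : seq (nat * nat)) (phi : nat -> T).

Let n := size nb.
Let U := [set phi (val i) | i : 'I_n].

Hypothesis wf : pat_wf nb dg na.
Hypothesis phiA : forall i, i < n -> phi i \in A.
Hypothesis phi_e : forall i j, i < n -> j \in nbp nb i -> e (phi i) (phi j).
Hypothesis phi_loc : forall i, i < n -> {in nbp nb i &, injective phi}.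
Hypothesis phi_deg : forall i, i < n -> #|nbrs e A (phi i)| <= nth 0 dg i.
Hypothesis no_adj : forall i j, (i, j) \in na -> ~~ e (phi i) (phi j).

Let checkV i : i < n -> vertex_check nb dg na i.
Proof. by move=> ilt; have /allP/(_ i) := wf; rewrite mem_iota; apply. Qed.

Let nbpP i j : i < n -> j \in nbp nb i -> j < n /\ i \in nbp nb j.
Proof. by move=> /checkV/and5P[_ /allP h _ _ _] /h/andP. Qed.

(** Local injectivity of [phi] is what carries non-backtracking walks of the pattern to
    non-backtracking walks of the graph. *)
Let pwalkP i l u v : i < n -> (u, v) \in pwalk nb i l ->
  [/\ u < n, v < n, u \in nbp nb v & rwalk e (phi i) l.+1 (phi u) (phi v)].
Proof.
move=> ilt; elim: l u v => [|l IHl] u v.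
  case/mapP => j ij [-> ->]; have [jlt ji] := nbpP ilt ij.
  by split=> //; apply: rwalk1 => //; exact: phi_e.
rewrite /pwalk iterS => /flatten_mapP[[a b] /IHl[alt blt ab w]] /mapP[k].
rewrite mem_filter /= => /andP[ka bk] [-> ->].
have [klt kb] := nbpP blt bk; split=> //.
apply: (rwalkS e_sym w); first exact: phi_e.
by apply: contra_neq ka => /(phi_loc blt bk ab).
Qed.

Let nearP i L v : i < n -> v \in near nb i L ->
  exists l u, [/\ l <= L, u < n, u \in nbp nb v & rwalk e (phi i) l (phi u) (phi v)].
Proof.
move=> ilt /flatten_mapP[l]; rewrite mem_iota add0n => /andP[_ lL].
case/mapP => -[u w] /pwalkP[] // ult wlt uw rw /= ->.
by exists l.+1, u.
Qed.

Lemma pattern_inj i j : i < n -> j < n -> phi i = phi j -> i = j.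
Proof.
move=> ilt jlt ij; have /and5P[_ _ _ /allP/(_ j) + _] := checkV ilt.
rewrite mem_iota jlt => /(_ isT)/orP[/eqP-> //|/nearP[] // l [u [l7 _ _ w]]].
by have := rwalk_neq e_irr girth8 w l7; rewrite ij eqxx.
Qed.

Let Z i := [set y in nbrs e A (phi i) | y \notin [seq phi j | j <- nbp nb i]].

Let cardZ i : i < n -> #|Z i| <= slot nb dg i.
Proof.
move=> ilt; have /and5P[ui _ dgi _ _] := checkV ilt.
pose I := [set x in [seq phi j | j <- nbp nb i]].
have cI : #|I| = size (nbp nb i).
  by rewrite cardsE (card_uniqP _) ?size_map // map_inj_in_uniq //; exact: phi_loc.
have IN : I \subset nbrs e A (phi i).
  apply/subsetP => y; rewrite !inE => /mapP[j ij ->].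
  by have [jlt _] := nbpP ilt ij; rewrite phiA ?phi_e.
have -> : Z i = nbrs e A (phi i) :\: I by apply/setP => y; rewrite !inE andbC.
rewrite cardsD (setIidPr IN) cI leq_subLR.
apply: leq_trans (phi_deg ilt) _; rewrite /slot; case: ltnP; lia.
Qed.

Let inU x : x \in U -> exists2 i, i < n & x = phi i.
Proof. by case/imsetP => i _ ->; exists i. Qed.

Let UI i : i < n -> phi i \in U.
Proof. by move=> ilt; apply/imsetP; exists (Ordinal ilt). Qed.

Let slotZ i y : i < n -> y \in Z i -> slot nb dg i.
Proof.
move=> ilt yZ; have := cardZ ilt; case: slot => //.
by rewrite leqn0 cards_eq0 => /eqP Z0; rewrite Z0 inE in yZ.
Qed.

Let ZU i y : i < n -> y \in Z i -> y \notin U.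
Proof.
move=> ilt yZ; apply/negP => /inU[k klt yk]; subst y.
have ki : k \notin nbp nb i.
  by move: yZ; rewrite !inE => /andP[_]; apply: contraNN => /(map_f phi).
have ik : e (phi k) (phi i).
  by move: yZ; rewrite !inE e_sym => /andP[/andP[_ ->]].
have iZ : phi i \in Z k.
  rewrite !inE phiA // ik /=.
  apply: contraNN ki => /mapP[j kj ij]; have [jlt jk] := nbpP klt kj.
  by rewrite (pattern_inj ilt jlt ij).
have [Si Sk] := (slotZ ilt yZ, slotZ klt iZ).
have /and5P[_ _ _ _ /allP/(_ k)] := checkV ilt.
rewrite mem_iota klt (negbTE ki) Si Sk => /(_ isT) /=.
have -> : (k == i) = false by apply/negbTE; apply: contraTneq ik => ->; rewrite e_irr.
have ki' : e (phi i) (phi k) by rewrite e_sym.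
rewrite /= => /or3P[/nearP wk|/no_adj|/no_adj]; last 2 first.
- by rewrite ki'.
- by rewrite ik.
have [l [u [l6 ult uk w]]] := wk ilt.
(* The closing edge from [k] to [i] must not retrace the last edge of the walk; it does not, since
   [i] is no listed neighbour of [k]. *)
have ui : phi i != phi u.
  apply: contraTneq iZ => iu; rewrite !inE negb_and negbK; apply/orP; right.
  by rewrite iu map_f.
have w' := rwalkS e_sym w ik ui.
by have := rwalk_neq e_irr girth8 w' (l6 : l.+1 <= 7); rewrite eqxx.
Qed.

Lemma pattern_adj k l : k < n -> l < n -> e (phi k) (phi l) -> l \in nbp nb k.
Proof.
move=> klt llt kl; apply/negPn/negP => nkl.
suff /(ZU klt) : phi l \in Z k by rewrite UI.
rewrite !inE phiA // kl /=; apply: contraNN nkl => /mapP[m km lm].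
by rewrite (pattern_inj llt (nbpP klt km).1 lm).
Qed.

Hypothesis no_share : forall i j z, (i, j) \in ns -> z \in A ->
  e (phi i) z -> ~~ e (phi j) z.

Lemma pattern_edges i j : i < j < n -> sq e A (phi i) (phi j) -> (i, j) \in pat_edges nb dg ns.
Proof.
move=> /andP[ij jlt]; have ilt := ltn_trans ij jlt.
rewrite /sq => /and4P[iA jA nij h]; apply/flatten_mapP; exists j.
  by rewrite mem_iota.
apply: map_f; rewrite mem_filter mem_iota ij !andbT /=.
case/orP: h => [ij'|/exists_inP[z zA /andP[iz zj]]].
  by rewrite pattern_adj // e_sym.
have jz : e (phi j) z by rewrite e_sym.
have [zU|zU] := boolP (z \in U).
  have [k klt zk] := inU zU; subst z; apply/orP; right; apply/orP; left.
  by apply/hasP; exists k; rewrite ?inE; apply: pattern_adj.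
have inZ k : k < n -> e (phi k) z -> z \in Z k.
  move=> klt kz; rewrite !inE zA kz; apply: contraNN zU => /mapP[m km ->].
  by apply: UI; have [] := nbpP klt km.
have [iZ jZ] := (inZ _ ilt iz, inZ _ jlt jz).
rewrite (slotZ ilt iZ) (slotZ jlt jZ) /=; apply/orP; right; apply/orP; right.
apply/andP; split; last first.
  by apply/negP => /no_share/(_ zA iz); rewrite jz.
apply/negP => /nearP[] // l [u [l5 ult uk w]].
have zu : z != phi u by apply: contraNneq zU => ->; exact: UI.
have w1 := rwalkS e_sym w iz zu; have w2 := rwalkS e_sym w1 zj _.
have nji : phi j != phi i by rewrite eq_sym.
by have := rwalk_neq e_irr girth8 (w2 nji) (l5 : l.+2 <= 7); rewrite eqxx.
Qed.

Let outside i := [set y | sq e A (phi i) y & y \notin U].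

Lemma pattern_card_outside i : i < n ->
  #|outside i| <= 3 * slot nb dg i + sumn [seq nat_of_bool (slot nb dg j) | j <- nbp nb i].
Proof.
move=> ilt.
pose X := \bigcup_(z in Z i) (nbrs e A z :\ phi i).
pose Y := \bigcup_(j <- nbp nb i) Z j.
(* An outside vertex within distance 2 is the neighbour in the slot of [i], a neighbour of that one,
   or the neighbour in the slot of a listed neighbour. *)
have sub : outside i \subset (Z i :|: X) :|: Y.
  apply/subsetP => y; rewrite inE => /andP[/and4P[iA yA niy h] yU].
  case/orP: h => [iy|/exists_inP[z zA /andP[iz zy]]].
    rewrite 2!inE; apply/orP; left; apply/orP; left; rewrite !inE yA iy.
    by apply: contraNN yU => /mapP[m km ->]; apply: UI; have [] := nbpP ilt km.
  have [zU|zU] := boolP (z \in [seq phi j | j <- nbp nb i]); last first.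
    rewrite 2!inE; apply/orP; left; apply/orP; right; apply/bigcupP; exists z.
      by rewrite !inE zA iz.
    by rewrite !inE yA zy eq_sym niy.
  case/mapP: zU => j ij zj; have [jlt ji] := nbpP ilt ij.
  rewrite inE; apply/orP; right; rewrite /Y (big_rem j) //= inE; apply/orP; left.
  rewrite !inE yA -zj zy /=.
  by apply: contraNN yU => /mapP[m km ->]; apply: UI; have [] := nbpP jlt km.
apply: leq_trans (subset_leq_card sub) _.
have cX : #|X| <= 2 * #|Z i|.
  rewrite mulnC -sum_nat_const; apply: leq_trans (_ : \sum_(z in Z i) #|nbrs e A z :\ phi i| <= _).
    rewrite /X; elim/big_rec2: _ => [|z m V _ h]; first by rewrite cards0.
    by apply: leq_trans (leq_card_setU _ _) _; rewrite leq_add2l.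
  apply: leq_sum => z; rewrite !inE => /andP[/andP[zA iz] _].
  have iN : phi i \in nbrs e A z by rewrite inE phiA // e_sym.
  have : #|nbrs e A z| <= 3.
    apply: leq_trans (subcubic z); apply: subset_leq_card.
    by apply/subsetP => y; rewrite !inE => /andP[].
  by rewrite (cardsD1 (phi i)) iN.
have cY : #|Y| <= sumn [seq nat_of_bool (slot nb dg j) | j <- nbp nb i].
  rewrite sumnE big_map /Y.
  have : all (fun j => j < n) (nbp nb i) by apply/allP => j /(nbpP ilt)[].
  elim: (nbp nb i) => [|j s IHs] /=; first by rewrite !big_nil cards0.
  case/andP => jlt /IHs h; rewrite !big_cons; apply: leq_trans (leq_card_setU _ _) _.
  by apply: leq_add => //; exact: cardZ.
apply: leq_trans (leq_card_setU _ _) (leq_add _ cY).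
apply: leq_trans (leq_card_setU _ _) _.
apply: leq_trans (leq_add (leqnn _) cX) _.
by rewrite -mulSn leq_mul2l cardZ.
Qed.

Theorem pattern_reducible d : pat_check nb dg ns d -> ~ critical e A.
Proof.
move=> /and4P[n0 /eqP sd /allP dP chk] crit.
have UA : U \subset A by apply/subsetP => x /inU[i ilt ->]; exact: phiA.
have U0 : U != set0 by apply/set0Pn; exists (phi 0); exact: UI.
have [] := critical_delete e_sym crit UA U0.
  move=> u x y /inU[i ilt ->] xN yN xU yU.
  have inZ z : z \in nbrs e A (phi i) -> z \notin U -> z \in Z i.
    move=> zN zU; rewrite inE zN; apply: contraNN zU => /mapP[m km ->].
    by apply: UI; have [] := nbpP ilt km.
  have : #|Z i| <= 1 by apply: leq_trans (cardZ ilt) _; case: slot.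
  by move/card_le1_eqP; apply; exact: inZ.
move=> psi psiP; case: crit => ncol _; apply: ncol.
apply: (extend_coloring e_sym psiP pattern_inj pattern_edges sd chk) => i ilt.
have := dP i; rewrite mem_iota => /(_ ilt) di.
rewrite cardsCs setCK card_ord ltn_subRL addnC.
apply: leq_ltn_trans di; rewrite -addnA leq_add2l.
exact: leq_trans (leq_imset_card psi (outside i)) (pattern_card_outside ilt).
Qed.

End Pattern.

(* A configuration: [twos] marks the vertices of degree 2, [cycles] and [paths]
   list vertex sequences embedded injectively, as are the [apart] sequences. *)
Record config := Config {
  twos : seq bool;
  cycles : seq (seq nat);
  paths : seq (seq nat);
  apart : seq (seq nat) }.

(** * Configurations and their certificates *)

Section ConfigCheck.

Variable C : config.

Definition csize := size (twos C).
Definition cdeg := [seq 3 - nat_of_bool b | b <- twos C].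

Definition cpairs : seq (nat * nat) :=
  flatten [seq zip c (rot 1 c) | c <- cycles C] ++
  flatten [seq zip p (behead p) | p <- paths C].

Definition cnbrs : seq (seq nat) :=
  [seq undup [seq p.2 | p <- cpairs ++ [seq (p.2, p.1) | p <- cpairs] & p.1 == i]
  | i <- iota 0 csize].

(** Two neighbours of the same vertex must occur together in some list that is embedded injectively;
    injectivity on all vertices then comes from the girth. *)
Definition cinj : bool :=
  let L := cycles C ++ paths C ++ apart C in
  all (fun s => all (fun j => all (fun k =>
    (j == k) || has (fun l => (j \in l) && (k \in l)) L) s) s) cnbrs.

(** All vertices may be declared distinct here: this case arises when the base configuration is
    known to be embedded injectively and the common neighbour of [a] and [b] is a new vertex. *)
Definition add_vertex a b : config :=
  Config (rcons (twos C) false) (cycles C) ([:: a; csize; b] :: paths C)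
    (iota 0 csize.+1 :: apart C).

Definition add_edge a b : config :=
  Config (twos C) (cycles C) ([:: a; b] :: paths C) (iota 0 csize :: apart C).

Definition base_check na ns d :=
  [&& cinj, pat_wf cnbrs cdeg na & pat_check cnbrs cdeg ns d].

Definition in_range : bool :=
  all (all (fun i => i < csize)) (cycles C ++ paths C ++ apart C).

End ConfigCheck.

(** The base certificate assumes the pairs of [na] non-adjacent and those of [ns] without common
    neighbour. A failing assumption produces a larger configuration with its own monomial; the
    non-adjacencies come first and remain available when a common neighbour is added. *)
Definition config_check (C : config) (na ns : seq ((nat * nat) * seq nat)) d :=
  let n := csize C in
  let A := unzip1 na in
  [&& in_range C, base_check C A (unzip1 ns) d,
    all (fun p => [&& p.1.1 < n, p.1.2 < n, p.1.1 != p.1.2 &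
       base_check (add_edge C p.1.1 p.1.2) [::] [::] p.2]) na
  & all (fun p => [&& p.1.1 < n, p.1.2 < n, p.1.1 != p.1.2,
       ~~ has [in nbp (cnbrs C) p.1.1] (nbp (cnbrs C) p.1.2) &
       base_check (add_vertex C p.1.1 p.1.2) A [::] p.2]) ns].

Section Config.

Variables (T : finType) (e : rel T).
Hypotheses (e_sym : symmetric e) (e_irr : irreflexive e).
Hypothesis girth8 : forall c, ucycle e c -> 2 < size c -> 7 < size c.
Hypothesis subcubic : forall x, #|[set y | e x y]| <= 3.
Variable A : {set T}.

Definition upath (s : seq T) := sorted e s && uniq s.

Definition embeds (C : config) (phi : nat -> T) : bool :=
  [&& all (fun i => (phi i \in A) &&
        (nth false (twos C) i ==> (#|nbrs e A (phi i)| <= 2))) (iota 0 (csize C)),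
      all (fun c => ucycleb e (map phi c)) (cycles C),
      all (fun p => upath (map phi p)) (paths C)
    & all (fun l => uniq (map phi l)) (apart C)].

Section Base.
Variables (C : config) (phi : nat -> T).
Hypotheses (emb : embeds C phi) (inj : cinj C).

Lemma embeds_in i : i < csize C -> phi i \in A.
Proof.
by move=> ilt; have /and4P[/allP/(_ i) + _ _ _] := emb; rewrite mem_iota => /(_ ilt)/andP[].
Qed.

Lemma embeds_deg i : i < csize C -> #|nbrs e A (phi i)| <= nth 0 (cdeg C) i.
Proof.
move=> ilt; have /and4P[/allP/(_ i) + _ _ _] := emb; rewrite mem_iota => /(_ ilt)/andP[_].
rewrite (nth_map false) //; case: nth => //= _.
by apply: leq_trans (subcubic (phi i)); apply/subset_leq_card/subsetP => y; rewrite !inE => /andP[].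
Qed.

Let uniq_lists l : l \in cycles C ++ paths C ++ apart C -> uniq (map phi l).
Proof.
have /and4P[_ /allP cC /allP pC /allP aC] := emb.
rewrite !mem_cat => /or3P[/cC/andP[] //|/pC/andP[] //|/aC//].
Qed.

Lemma embeds_loc i : i < csize C -> {in nbp (cnbrs C) i &, injective phi}.
Proof.
move=> ilt j k ji ki jk; have /allP/(_ (nbp (cnbrs C) i)) := inj.
rewrite mem_nth ?size_map ?size_iota // => /(_ isT)/allP/(_ _ ji)/allP/(_ _ ki).
case/orP => [/eqP//|/hasP[l lL /andP[jl kl]]].
have ul := uniq_lists lL.
have lsz x : x \in l -> nth (phi j) (map phi l) (index x l) = phi x.
  by move=> xl; rewrite (nth_map x) ?index_mem // nth_index.
have := nth_uniq (phi j) _ _ ul; rewrite size_map => /(_ (index j l) (index k l)).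
rewrite !index_mem jl kl !lsz // jk eqxx => /(_ isT isT)/esym/eqP ijk.
by rewrite -(nth_index 0 jl) ijk nth_index.
Qed.

Let zip_path x p a b :
  path e (phi x) (map phi p) -> (a, b) \in zip (x :: p) p -> e (phi a) (phi b).
Proof.
elim: p x => //= y p IHp x /andP[xy yp]; rewrite inE => /orP[/eqP[-> ->] //|].
exact: IHp.
Qed.

Lemma embeds_edge i j : i < csize C -> j \in nbp (cnbrs C) i -> e (phi i) (phi j).
Proof.
move=> ilt; rewrite /nbp (nth_map 0) ?size_iota // nth_iota // add0n mem_undup.
have P a b : (a, b) \in cpairs C -> e (phi a) (phi b).
  have /and4P[_ /allP cC /allP pC _] := emb.
  rewrite mem_cat => /orP[] /flatten_mapP[l].
    move=> /cC/andP[+ _]; case: l => // x l; rewrite /= rot1_cons.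
    rewrite -(map_rcons phi) => cl.
    have -> : zip (x :: l) (rcons l x) = zip (x :: rcons l x) (rcons l x).
      by elim: (l) {1 3}x => //= y l' IHl z; rewrite IHl.
    exact: (zip_path cl).
  move=> /pC/andP[+ _]; case: l => // x l; rewrite /= => pl.
  exact: zip_path.
case/mapP => -[a b]; rewrite mem_filter /= mem_cat => /andP[/eqP-> h] ->.
case/orP: h => [/P//|/mapP[[c d] /P h [-> ->]]]; by rewrite e_sym.
Qed.

End Base.

Lemma base_reducible C phi na ns d : embeds C phi -> base_check C na ns d ->
  (forall p, p \in na -> ~~ e (phi p.1) (phi p.2)) ->
  (forall p z, p \in ns -> z \in A -> e (phi p.1) z -> ~~ e (phi p.2) z) ->
  ~ critical e A.
Proof.
move=> emb /and3P[ci wf chk] hna hns.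
have sz : size (cnbrs C) = csize C by rewrite size_map size_iota.
apply: (@pattern_reducible _ e e_sym e_irr girth8 subcubic A (cnbrs C) (cdeg C) ns na phi);
  rewrite ?sz //.
- exact: embeds_in emb.
- exact: embeds_edge emb.
- exact: embeds_loc emb ci.
- exact: embeds_deg emb.
- by move=> i j /hna.
- by move=> i j z /hns h zA; exact: h.
- exact: chk.
Qed.

Lemma config_reducible C na ns d phi :
  config_check C na ns d -> embeds C phi -> ~ critical e A.
Proof.
move=> /and4P[rng base /allP naP /allP nsP] emb crit.
have /and3P[ci wf chk] := base.
have sz : size (cnbrs C) = csize C by rewrite size_map size_iota.
have inj i j : i < csize C -> j < csize C -> phi i = phi j -> i = j.
  rewrite -sz; apply: (@pattern_inj _ e e_sym e_irr girth8 (cnbrs C) (cdeg C) (unzip1 na) phi);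
    rewrite ?sz //; [exact: embeds_edge emb | exact: embeds_loc emb ci].
have uiota : uniq (map phi (iota 0 (csize C))).
  by rewrite map_inj_in_uniq ?iota_uniq // => i j; rewrite !mem_iota; exact: inj.
have /and4P[vC cC pC aC] := emb.
have nadj p : p \in unzip1 na -> ~~ e (phi p.1) (phi p.2).
  case/mapP => q /naP/and4P[q1 q2 q12 qc] ->; apply/negP => eq12.
  apply: (base_reducible (phi := phi) _ qc) => //.
  apply/and4P; split=> //=.
  - rewrite pC andbT /upath /= eq12 inE andbT andbT.
    by apply: contraNneq q12 => /inj->.
  - by rewrite uiota.
have nshare p z : p \in unzip1 ns -> z \in A -> e (phi p.1) z -> ~~ e (phi p.2) z.
  case/mapP => q /nsP/and5P[q1 q2 q12 qn qc] -> zA e1; apply/negP => e2.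
  (* A common neighbour inside the configuration would be listed for both vertices by [pattern_adj],
     which the check rules out. *)
  have zN i : i < csize C -> phi i <> z.
    move=> ilt iz; case/negP: qn; apply/hasP.
    have adj k : k < csize C -> e (phi k) z -> i \in nbp (cnbrs C) k.
      rewrite -sz => klt; rewrite -iz.
      apply: (@pattern_adj _ e e_sym e_irr girth8 A (cnbrs C) (cdeg C) (unzip1 na) phi);
        rewrite ?sz // -?sz //; rewrite ?sz.
      + exact: embeds_in emb.
      + exact: embeds_edge emb.
      + exact: embeds_loc emb ci.
      + exact: embeds_deg emb.
      + by move=> a b /nadj.
    by exists i; rewrite ?inE adj.
  pose phi' i := if i == csize C then z else phi i.
  have phiE i : i < csize C -> phi' i = phi i.
    by rewrite /phi' ltn_neqAle => /andP[/negbTE->].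
  have mapE l : l \in cycles C ++ paths C ++ apart C -> map phi' l = map phi l.
    move=> lL; apply/eq_in_map => i il; apply: phiE.
    by have /allP/(_ _ lL)/allP := rng; apply.
  have phin : phi' (csize C) = z by rewrite /phi' eqxx.
  apply: (base_reducible (phi := phi') _ qc) => //; last first.
    move=> p' /mapP[r rna ->].
    have /and4P[r1 r2 _ _] := naP _ rna.
    by rewrite !phiE //; apply: nadj; exact: map_f.
  have uN : uniq (map phi' (iota 0 (csize C).+1)).
    rewrite -addn1 iotaD map_cat add0n /= cats1 rcons_uniq phin.
    have -> : map phi' (iota 0 (csize C)) = map phi (iota 0 (csize C)).
      by apply/eq_in_map => i; rewrite mem_iota => /phiE.
    rewrite uiota andbT; apply/mapP => -[i]; rewrite mem_iota => /zN zi /esym//.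
  have szE : csize (add_vertex C q.1.1 q.1.2) = csize C + 1.
    by rewrite /csize size_rcons addn1.
  apply/and4P; split; first rewrite szE iotaD all_cat; rewrite /=.
  - rewrite add0n phin zA.
    rewrite nth_rcons -/(csize C) ltnn eqxx !andbT /=; apply/allP => i ilt.
    have := allP vC _ ilt; move: ilt; rewrite mem_iota => /= ilt.
    by rewrite phiE // nth_rcons ilt.
  - by apply/allP => c cC'; rewrite mapE ?(allP cC) // mem_cat cC'.
  - apply/andP; split.
      rewrite /upath /= phin !phiE // e1 e_sym e2 /= !inE !andbT.
      apply/andP; split; last by apply/eqP => /esym/zN; apply.
      by rewrite negb_or; apply/andP; split; [apply/eqP/zN|apply: contraNneq q12 => /inj->].
    by apply/allP => c cC'; rewrite mapE ?(allP pC) // !mem_cat cC' orbT.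
  - have uN' := uN; rewrite /= in uN'; rewrite uN' /=.
    by apply/allP => c cC'; rewrite mapE ?(allP aC) // !mem_cat cC' !orbT.
exact: (base_reducible emb base nadj nshare).
Qed.

End Config.

(** * Catalogue of reducible configurations *)

Definition flags (s : seq nat) : seq bool := map (leq 1) s.

(** Three 2-vertices cut an 8-cycle into runs of 3-vertices of lengths 1, 1, 3 ([F1]) or 1, 2, 2
    ([F2]). Both are read so that the edge from the last entry to the first joins 3-vertices; [F1]
    starts in the middle of its long run. *)
Definition F1 := flags [:: 0;0;1;0;1;0;1;0].
Definition F2 := flags [:: 0;1;0;0;1;0;1;0].

Definition cycle_config (f : seq bool) := Config f [:: iota 0 (size f)] [::] [::].

Definition pendant_config (f : seq bool) i :=
  Config (rcons f true) [:: iota 0 (size f)] [:: [:: i; size f]]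
    [:: iota 0 (size f).+1].

(* A 5-face [0..7] and a further face sharing the edge [7, 0] with it. *)
Definition adjacent_config (f g : seq bool) :=
  let n := size (f ++ g) in
  Config (f ++ g) [:: iota 0 8; rcons (0 :: iota 8 (size g)) 7] [::]
    [:: [:: 1; 8]; [:: 6; n.-1]].

(* Two 5-faces sharing the path [0, 1, 2]. *)
Definition double_config (f g : seq bool) :=
  Config (f ++ g) [:: iota 0 8; rcons (2 :: iota 8 5) 0 ++ [:: 1]] [::]
    [:: [:: 3; 8]; [:: 7; 12]].

(* The 5-faces [F1] and [F2] read from an end of an edge between 3-vertices along
   the other edge, when this one leads to a 2-vertex. *)
Definition D1 := flags [:: 0;1;0;1;0;1;0;0].
Definition D2a := flags [:: 0;1;0;0;1;0;1;0].
Definition D2b := flags [:: 0;1;0;1;0;0;1;0].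

(* The last argument of [config_check] lists the exponents of a monomial with
   nonzero coefficient, found by computer search; a further one is given for
   each way two distant vertices may be adjacent or share a neighbour. *)
Lemma C1_check : config_check (cycle_config (flags [:: 0;1;0;1;0;1;0;1])) [::] [::]
  [:: 0;3;1;3;1;3;2;3].
Proof. by vm_compute. Qed.

Lemma C2_check : config_check (cycle_config (flags [:: 0;1;0;1;0;1;0;1;0])) [::] [::]
  [:: 0;3;2;3;2;2;2;3;1].
Proof. by vm_compute. Qed.

(** Vertex 2 has three neighbours of degree 2, and behind one of them follow a 3-vertex and another
    2-vertex. *)
Lemma T1_check : config_check (Config (flags [:: 1;1;0;1;0;1]) [::]
   [:: [:: 0;2;3;4;5]; [:: 1;2]] [:: [:: 0;1;3]]) [::] [::] [:: 1;0;3;4;1;1].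
Proof. by vm_compute. Qed.

Lemma P1_check : config_check (pendant_config F1 7) [::] [::] [:: 0;1;3;2;3;2;3;3;2].
Proof. by vm_compute. Qed.
Lemma P2_check : config_check (pendant_config F2 0) [::] [::] [:: 3;4;1;1;3;2;3;2;0].
Proof. by vm_compute. Qed.
Lemma P3_check : config_check (pendant_config F2 7) [::] [::] [:: 2;3;0;1;3;2;4;3;1].
Proof. by vm_compute. Qed.

Lemma FF1_check : config_check (double_config D1 (drop 3 D2a)) [::] [::]
  [:: 2;5;4;3;2;3;0;1;2;3;1;3;2].
Proof. by vm_compute. Qed.
Lemma FF2_check : config_check (double_config D2a (drop 3 D2a)) [::] [::]
  [:: 3;5;2;2;3;0;3;2;2;3;2;3;2].
Proof. by vm_compute. Qed.
Lemma FF3_check : config_check (double_config D2a (drop 3 D2b)) [::] [::]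
  [:: 3;5;4;0;3;1;3;2;4;1;1;3;2].
Proof. by vm_compute. Qed.
Lemma FF4_check : config_check (double_config D2b (drop 3 D2b)) [::] [::]
  [:: 3;5;4;4;1;1;3;2;2;1;1;3;2].
Proof. by vm_compute. Qed.

Lemma FG11_check : config_check (adjacent_config F1 (flags [:: 0;1;0;1;0;0])) [::]
  [:: ((3,10), [:: 3;1;4;4;4;1;4;4;2;4;3;4;1;1;0])] [:: 3;2;3;2;3;2;4;4;2;3;2;3;1;1].
Proof. by vm_compute. Qed.
Lemma FG12_check : config_check (adjacent_config F1 (flags [:: 0;1;0;0;1;0]))
  [:: ((3,11), [:: 3;2;3;5;4;2;4;0;1;2;2;4;4;2])]
  [:: ((3,10), [:: 3;2;4;3;4;2;4;4;2;4;3;1;3;1;0])] [:: 3;2;3;2;3;2;4;4;2;3;1;1;3;2].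
Proof. by vm_compute. Qed.
Lemma FG13_check : config_check (adjacent_config F1 (flags [:: 0;0;1;0;1;0]))
  [:: ((3,11), [:: 3;0;2;5;4;2;4;4;1;1;4;3;3;2])] [::]
  [:: 3;2;3;2;3;2;4;4;0;1;3;2;3;2].
Proof. by vm_compute. Qed.
Lemma FG14_check : config_check (adjacent_config F1 (flags [:: 0;1;0;1;0;1;0]))
  [:: ((3,12), [:: 0;2;4;5;4;1;4;3;2;3;2;4;2;2;2])] [::]
  [:: 3;2;3;0;3;2;4;4;2;3;2;3;2;3;2].
Proof. by vm_compute. Qed.
Lemma FG21_check : config_check (adjacent_config F2 (flags [:: 0;1;0;1;0;0])) [::]
  [:: ((3,12), [:: 4;4;0;3;4;0;4;4;2;3;2;4;3;2;2])] [:: 4;4;1;1;3;2;4;4;2;3;2;3;1;1].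
Proof. by vm_compute. Qed.
Lemma FG22_check : config_check (adjacent_config F2 (flags [:: 0;1;0;0;1;0]))
  [:: ((3,11), [:: 4;4;2;1;3;0;4;4;2;3;2;4;3;2])]
  [:: ((3,11), [:: 4;4;2;3;4;2;4;4;0;2;1;3;4;1;2]);
      ((2,11), [:: 4;5;0;1;3;2;4;4;2;3;2;3;4;2;2])] [:: 4;4;1;1;3;2;4;4;2;3;1;1;3;2].
Proof. by vm_compute. Qed.
Lemma FG23_check : config_check (adjacent_config F2 (flags [:: 0;0;1;0;1;0]))
  [:: ((3,11), [:: 4;4;1;2;1;1;4;4;1;1;4;5;4;2])] [::]
  [:: 4;4;1;1;3;2;4;4;1;1;3;2;3;2].
Proof. by vm_compute. Qed.
Lemma FG24_check : config_check (adjacent_config F2 (flags [:: 0;1;0;1;0;1;0]))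
  [:: ((3,12), [:: 4;4;0;3;4;2;4;4;1;3;0;4;5;1;1])] [::]
  [:: 4;4;1;1;3;2;4;4;2;3;2;3;2;2;2].
Proof. by vm_compute. Qed.

(** An alternating path with 2-vertices at both ends; the extra case closes it to an alternating
    8-cycle. *)
Lemma T5_check : config_check (Config (flags [:: 1;0;1;0;1;0;1]) [::]
   [:: iota 0 7] [::]) [::] [:: ((0,6), [:: 3;1;3;1;3;2;3;0])] [:: 1;1;2;2;3;1;1].
Proof. by vm_compute. Qed.

(** * The configuration that needs a [K_4] in the square *)

Definition C6 := pendant_config F1 0.
Definition E6 := [:: (0,1); (0,2); (1,2); (1,3); (2,3); (2,4); (3,4); (3,5); (4,5); (0,6);
  (4,6); (5,6); (0,7); (1,7); (5,7); (6,7); (0,8); (1,8); (7,8)].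

(** Vertex 1 is coloured separately and the other eight are renumbered. The three monomials of
    [C6_check] serve the cases in which 0, 7 or 8 has one colour more than guaranteed. *)
Definition skip1 i := i + (0 < i).
Definition E6' := [seq p <- [seq (i, j) | i <- iota 0 8, j <- iota 0 8] |
  (skip1 p.1, skip1 p.2) \in E6].

Lemma C6_wf : [&& cinj C6, pat_wf (cnbrs C6) (cdeg C6) [::] &
  pat_edges (cnbrs C6) (cdeg C6) [::] == E6].
Proof. by vm_compute. Qed.

Lemma C6_check : [&& at_check [:: 2;2;0;3;2;3;1;1] E6', at_check [:: 1;2;0;3;2;3;2;1] E6'
   & at_check [:: 1;2;0;3;2;3;1;2] E6'].
Proof. by vm_compute. Qed.

Lemma C6_slots : all (fun i => 3 * slot (cnbrs C6) (cdeg C6) i +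
    sumn [seq nat_of_bool (slot (cnbrs C6) (cdeg C6) j) | j <- nbp (cnbrs C6) i] <=
  nth 0 [:: 3;3;2;3;2;3;2;3;3] i) (iota 0 9).
Proof. by vm_compute. Qed.

Section C6.

Variables (T : finType) (e : rel T).
Hypotheses (e_sym : symmetric e) (e_irr : irreflexive e).
Hypothesis girth8 : forall c, ucycle e c -> 2 < size c -> 7 < size c.
Hypothesis subcubic : forall x, #|[set y | e x y]| <= 3.
Variables (A : {set T}) (phi : nat -> T).
Hypothesis emb : embeds e A C6 phi.

Let U := [set phi (val i) | i : 'I_9].
Let out i := [set y | sq e A (phi i) y & y \notin U].

Let inj i j : i < 9 -> j < 9 -> phi i = phi j -> i = j.
Proof.
have /and3P[ci wf _] := C6_wf.
by apply: (pattern_inj e_sym e_irr girth8 wf); [exact: embeds_edge emb|exact: embeds_loc emb ci].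
Qed.

Let neq i j : i < 9 -> j < 9 -> i != j -> phi i != phi j.
Proof. by move=> ilt jlt; apply: contraNneq => /inj->. Qed.

Let phiA i : i < 9 -> phi i \in A. Proof. by move=> ?; apply: embeds_in emb _ _. Qed.

Let edge i j : i < 9 -> j \in nbp (cnbrs C6) i -> e (phi i) (phi j).
Proof. exact: embeds_edge emb _ _. Qed.

Let edgesP i j : i < j < 9 -> sq e A (phi i) (phi j) -> (i, j) \in E6.
Proof.
have /and3P[ci wf /eqP<-] := C6_wf.
apply: (pattern_edges e_sym e_irr girth8 wf) => //.
- exact: embeds_loc emb ci.
- exact: embeds_deg emb.
Qed.

Let card_out i : i < 9 -> #|out i| <= nth 0 [:: 3;3;2;3;2;3;2;3;3] i.
Proof.
have /and3P[ci wf _] := C6_wf => ilt.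
have := @pattern_card_outside _ e e_sym subcubic A (cnbrs C6) (cdeg C6) [::] phi wf phiA
  edge (embeds_loc emb ci) (embeds_deg subcubic emb) i ilt.
move=> h; apply: leq_trans h _; have /allP/(_ i) := C6_slots.
by rewrite mem_iota; apply.
Qed.

Let UI i : i < 9 -> phi i \in U.
Proof. by move=> ilt; apply/imsetP; exists (Ordinal ilt). Qed.

Let nb4 y : y \in A -> e (phi 4) y -> y \in U.
Proof.
move=> yA y4; apply: contraT => yU.
have := @embeds_deg _ e subcubic A C6 phi emb 4 isT; rewrite leqNgt => /negP[].
rewrite (cardsD1 (phi 3)) (cardsD1 (phi 5)) (cardsD1 y) !inE !phiA ?yA ?y4 //=.
rewrite (neq (i := 5) (j := 3)) // !edge //= !andbT.
by do 2 (case: eqP => [yE|_]; first by rewrite yE UI in yU).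
Qed.

(* A colouring of the graph without one 2-vertex gives four colours to the clique
   [0, 1, 7, 8], so that the lists of these vertices are not all the same three
   colours, and vertex 1 can be coloured without affecting one of the others. *)
Lemma C6_reducible : ~ critical e A.
Proof.
move=> [ncol min].
have [|psi psiP] := min (A :\ phi 4).
  by rewrite properE subsetDl; apply/subsetPn; exists (phi 4); rewrite ?phiA // !inE eqxx.
(* Removing vertex 4 relaxes only constraints between its own neighbours, and these lie in [U]. *)
have psiU x y : x != phi 4 -> y != phi 4 -> (x \notin U) || ~~ e (phi 4) x || (y \notin U) ->
    sq e A x y -> psi x != psi y.
  move=> x4 y4 xyU /and4P[xA yA xy h]; apply: psiP.
  rewrite /sq !inE x4 y4 xA yA xy /=; case/orP: h => [-> //|/exists_inP[z zA /andP[xz zy]]].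
  apply/orP; right; apply/exists_inP; exists z; last by rewrite xz.
  rewrite !inE zA andbT; apply: contraTneq xyU => z4; subst z; rewrite e_sym in xz.
  by rewrite xz !nb4.
have n4 x : x \notin U -> x != phi 4 by apply: contraNneq => ->; exact: UI.
pose L i := ~: (psi @: out i).
have cL i : i < 9 -> nth 0 [:: 3;3;4;3;4;3;4;3;3] i <= #|L i|.
  move=> ilt; rewrite cardsCs setCK card_ord.
  have := leq_trans (leq_imset_card psi (out i)) (card_out ilt).
  have /allP/(_ i) : all (fun i => nth 0 [:: 3;3;4;3;4;3;4;3;3] i +
      nth 0 [:: 3;3;2;3;2;3;2;3;3] i <= 6) (iota 0 9) by vm_compute.
  have arith a b l : a + b <= 6 -> l <= b -> a <= 6 - l by lia.
  by rewrite mem_iota => /(_ ilt) ab h; exact: arith ab h.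
pose K := [:: 0; 1; 7; 8].
have KL k : k \in K -> psi (phi k) \in L k.
  move=> kK; have klt : k < 9 by move: kK; rewrite !inE => /or4P[] /eqP->.
  have k4 : k != 4 by move: kK; rewrite !inE => /or4P[] /eqP->.
  rewrite inE; apply/negP => /imsetP[y]; rewrite inE => /andP[s yU] /eqP.
  by apply/negP; apply: (psiU _ _ _ _ _ s); [exact: neq | exact: n4 | rewrite yU orbT].
have Kneq i j : i \in K -> j \in K -> i != j -> psi (phi i) != psi (phi j).
  move=> iK jK ij; have lt k : k \in K -> k < 9 by rewrite !inE => /or4P[] /eqP->.
  have k4 k : k \in K -> k != 4 by rewrite !inE => /or4P[] /eqP->.
  have k4' k : k \in K -> phi k != phi 4.
    by move=> kK; apply: neq => //; [exact: lt | exact: k4].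
  apply: psiP; rewrite /sq !inE !k4' // !phiA ?lt // (neq (lt _ iK) (lt _ jK) ij) /=.
  have adj k : k \in K -> k != 0 -> e (phi 0) (phi k).
    by rewrite !inE => /or4P[] /eqP-> // _; apply: edge.
  have [i0|i0] := eqVneq i 0; first by rewrite i0 adj // -i0 eq_sym.
  have [j0|j0] := eqVneq j 0; first by rewrite j0 e_sym adj.
  apply/orP; right; apply/exists_inP; exists (phi 0); last by rewrite e_sym !adj.
  by rewrite !inE phiA // neq.
have [y yY [al alL ally]] : exists2 y, y \in [:: 0; 7; 8] &
    exists2 al, al \in L 1 & al \notin L y \/ 3 < #|L y|.
  have [/hasP[y yY /subsetPn[al al1 aly]]|/hasPn sub] :=
      boolP (has (fun y => ~~ (L 1 \subset L y)) [:: 0; 7; 8]).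
    by exists y => //; exists al => //; left.
  have /card_gt0P[al alL] : 0 < #|L 1| by apply: leq_trans (cL 1 isT).
  have [/hasP[y yY y3]|/hasPn le3] := boolP (has (fun y => 3 < #|L y|) [:: 0; 7; 8]).
    by exists y => //; exists al => //; right.
  have LE y : y \in [:: 0; 7; 8] -> L y = L 1.
    move=> yY; apply/esym/eqP; rewrite eqEcard; have := sub y yY; rewrite negbK => -> /=.
    by have := le3 y yY; rewrite -leqNgt => /leq_trans; apply; exact: (cL 1 isT).
  have := le3 0 isT; rewrite -leqNgt leqNgt => /negP[].
  have uK : uniq [seq psi (phi k) | k <- K].
    rewrite map_inj_in_uniq //; move=> k l kK lK; apply: contra_eq; exact: Kneq.
  apply: leq_trans (_ : #|[seq psi (phi k) | k <- K]| <= _); first by rewrite (card_uniqP uK).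
  apply/subset_leq_card/subsetP => _ /mapP[k kK ->].
  have := KL k kK; move: kK; rewrite inE (LE 0) // => /orP[/eqP->|]; first by rewrite (LE 0).
  by rewrite inE => /orP[/eqP-> //|kY]; rewrite LE // inE kY orbT.
pose psi' x := if x == phi 1 then al else psi x.
pose phi' i := phi (skip1 i).
pose U' := [set phi' (val i) | i : 'I_8].
have skip_lt i : i < 8 -> skip1 i < 9 by case: i => [|i] //; rewrite /skip1 addn1.
have UE x : x \notin U' -> x = phi 1 \/ x \notin U.
  move=> xU'; have [/imsetP[[i ilt] _ xi]|] := boolP (x \in U); last by right.
  have [i1|i1] := eqVneq i 1; first by left; rewrite xi /= i1.
  case/negP: xU'; apply/imsetP; rewrite xi /=.
  case: i ilt i1 {xi} => [|[|i]] ilt i1 //; first by exists ord0.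
  by exists (Ordinal (ilt : i.+1 < 8)); rewrite // /phi' /skip1 /= addn1.
have [d [sd chk dP]] : exists d, [/\ size d = 8, at_check d E6' & forall i, i < 8 ->
    nth 0 d i < #|~: (psi' @: [set y | sq e A (phi' i) y & y \notin U'])|].
  (* A guaranteed list size after vertex 1 has received [al]: a vertex adjacent to it in the square
     loses at most one colour. The vertex [y] is better off by one, as it lacks [al] or had a fourth
     colour. *)
  pose f i := nth 0 [:: 3;3;4;3;4;3;4;3;3] (skip1 i)
     - (((skip1 i, 1) \in E6) || ((1, skip1 i) \in E6)).
  have main i : i < 8 -> (f i + (skip1 i == y)) <=
      #|~: (psi' @: [set y | sq e A (phi' i) y & y \notin U'])|.
    move=> ilt; have jlt := skip_lt i ilt; set j := skip1 i in jlt *.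
    have j1 : j != 1 by rewrite /j; case: (i) => [|k] //; rewrite /skip1 addn1.
    pose s1 := ((j, 1) \in E6) || ((1, j) \in E6).
    have subL : L j :\: (if s1 then [set al] else set0) \subset
        ~: (psi' @: [set y | sq e A (phi' i) y & y \notin U']).
      apply/subsetP => b; rewrite !inE => /andP[bs bL].
      apply/negP => /imsetP[z]; rewrite inE => /andP[sz /UE[z1|zU]] bz.
        move: bs; rewrite bz /psi' z1 eqxx.
        suff -> : s1 by rewrite inE eqxx.
        rewrite /s1; move: sz; rewrite /phi' -/j z1 => sz; apply/orP.
        case: (ltngtP j 1) j1 => // jj _; [left|right]; apply: edgesP; rewrite ?jj //.
        by rewrite sq_sym.
      case/negP: bL; rewrite bz /psi' ifN ?imset_f ?inE ?sz //.
      by apply: contraNneq zU => ->; exact: UI.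
    apply: leq_trans (subset_leq_card subL); rewrite /f -/j -/s1.
    have [jy|_] := eqVneq j y; last first.
      rewrite addn0; have := cL j jlt; case: (s1) => /=; last by rewrite setD0 subn0.
      rewrite (cardsD1 al (L j)); case: (al \in L j) => /= h; rewrite leq_subLR //.
      by rewrite (leq_trans h) // leqW.
    have yL : 3 <= #|L y| by have := yY; rewrite !inE => /or3P[] /eqP->; [exact: (cL 0)|exact: (cL 7)|exact: (cL 8)].
    have fy : nth 0 [:: 3;3;4;3;4;3;4;3;3] j - s1 = 2.
      by move: yY; rewrite /s1 jy !inE => /or3P[] /eqP->.
    rewrite fy jy /=; have := cardsD1 al (L y); case: (s1); last by rewrite setD0.
    case: ally => [/negbTE->|l3]; rewrite /= ?add0n => E; first by rewrite -E.
    by move: l3; rewrite E; case: (al \in L y) => // /ltnW.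
  have sel d : size d = 8 -> at_check d E6' -> (forall i, i < 8 ->
      nth 0 d i < f i + (skip1 i == y)) -> exists d, [/\ size d = 8, at_check d E6'
      & forall i, i < 8 -> nth 0 d i <
        #|~: (psi' @: [set y | sq e A (phi' i) y & y \notin U'])|].
    move=> sd chk h; exists d; split=> // i ilt.
    exact: leq_trans (h i ilt) (main i ilt).
  have /and3P[ch0 ch7 ch8] := C6_check.
  have brute (P : nat -> bool) : all P (iota 0 8) -> forall i, i < 8 -> P i.
    by move=> /allP h i ilt; apply: h; rewrite mem_iota.
  move: yY sel; rewrite !inE => /or3P[] /eqP-> sel.
  - by apply: (sel _ _ ch0); [reflexivity | apply: brute; vm_compute].
  - by apply: (sel _ _ ch7); [reflexivity | apply: brute; vm_compute].
  - by apply: (sel _ _ ch8); [reflexivity | apply: brute; vm_compute].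
case: ncol; apply: (extend_coloring e_sym _ _ _ sd chk dP).
- have al1 v : v \notin U -> sq e A (phi 1) v -> al != psi v.
    move=> vU s; apply: contraTneq alL => ->; rewrite inE negbK.
    by apply: imset_f; rewrite inE s.
  have ne1 v : v \notin U -> (v == phi 1) = false.
    by move=> vU; apply/negbTE; apply: contraNneq vU => ->; exact: UI.
  rewrite /psi'; move=> u v /UE[->|uU] /UE[->|vU] s; rewrite ?eqxx ?ne1 //.
  + by move: s; rewrite /sq eqxx !andbF.
  + exact: al1.
  + by rewrite eq_sym al1 // sq_sym.
  + by apply: psiU; rewrite ?n4 ?uU.
- move=> i j ilt jlt /inj; rewrite !skip_lt // => /(_ isT isT).
  by rewrite /skip1; case: (i) (j) => [|?] [|?] //=; lia.
- move=> i j /andP[ij jlt] s; rewrite mem_filter; apply/andP; split; last first.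
    by apply/allpairsP; exists (i, j); split=> //; rewrite mem_iota ?jlt //= (ltn_trans ij).
  apply: edgesP s; rewrite skip_lt // andbT /skip1.
  by move: ij; case: (i) (j) => [|?] [|?] //=; lia.
Qed.
End C6.

(** * Critical graphs *)

Section Critical.
Import all_fingroup.

Variables (T : finType) (e : rel T).
Hypotheses (e_sym : symmetric e) (e_irr : irreflexive e).
Hypothesis girth8 : forall c, ucycle e c -> 2 < size c -> 7 < size c.
Hypothesis subcubic : forall x, #|[set y | e x y]| <= 3.
Variable A : {set T}.
Hypothesis crit : critical e A.

(** With at most one neighbour, at most three vertices lie within distance 2, so three colours
    remain. *)
Lemma critical_deg_ge2 x : x \in A -> 1 < #|nbrs e A x|.
Proof.
move=> xA; rewrite ltnNge; apply/negP => x1.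
apply: (@pattern_reducible _ e e_sym e_irr girth8 subcubic A [:: [::]] [:: 1] [::] [::]
  (fun _ => x) _ _ _ _ _ _ _ [:: 0]) => //; first by move=> [|i] j.
- by case.
by case.
Qed.

Lemma critical_two_two x y : x \in A -> y \in A -> e x y ->
  #|nbrs e A x| <= 2 -> 2 < #|nbrs e A y|.
Proof.
move=> xA yA xy x2; rewrite ltnNge; apply/negP => y2.
apply: (@config_reducible _ e e_sym e_irr girth8 subcubic A
  (Config [:: true; true] [::] [:: [:: 0; 1]] [::]) [::] [::] [:: 1; 0]
  (nth x [:: x; y]) _ _ crit) => //.
rewrite /embeds /= xA yA x2 y2 /upath /= xy !inE !andbT.
by apply: contraTneq xy => ->; rewrite e_irr.
Qed.

(* Both sides of a bridge are coloured separately, and the colours of one side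
   are then permuted. *)
Lemma critical_bridgeless (S : {set T}) x y : S \subset A ->
  x \in S -> y \in A -> y \notin S -> e x y ->
  exists u v, [/\ u \in S, v \in A :\: S, e u v & (u, v) != (x, y)].
Proof.
move=> SA xS yA yS xy.
have [/exists_inP[u uS /exists_inP[v vS /andP[uv n]]]|h] :=
  boolP [exists u in S, exists v in A :\: S, e u v && ((u, v) != (x, y))].
  by exists u, v.
exfalso.
have only u v : u \in S -> v \in A -> v \notin S -> e u v -> u = x /\ v = y.
  move=> uS vA vS uv; suff /eqP[-> ->] : (u, v) == (x, y) by []; apply: contraNT h => n.
  apply/exists_inP; exists u => //; apply/exists_inP; exists v; rewrite ?uv //.
  by rewrite inE vS.
have xA := subsetP SA x xS.
case: crit => ncol min; apply: ncol.
have [|f fP] := min S; first by rewrite properE SA; apply/subsetPn; exists y.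
have [|g gP] := min (A :\: S).
  by rewrite properE subsetDl; apply/subsetPn; exists x; rewrite // inE xS.
(* Across the bridge, the pairs within distance 2 are [x] with [y] or a neighbour of [y], and [y]
   with a neighbour of [x]. As the bridge takes one of three edges, each of [M] and [N] has at most
   three colours. *)
pose M := f @: (x |: (nbrs e S x)); pose N := g @: (y |: (nbrs e (A :\: S) y)).
have small (B : {set T}) (k : T -> 'I_6) z z' : z' \notin B -> e z z' ->
    exists c, c \notin k @: (z |: nbrs e B z).
  move=> z'B zz'; apply/existsP; rewrite -negb_forall; apply/negP => /forallP all.
  have : #|k @: (z |: nbrs e B z)| <= 3.
    apply: leq_trans (leq_imset_card _ _) _; rewrite cardsU1.
    apply: leq_trans (_ : 1 + #|[set t | e z t] :\ z'| <= _).
      apply: leq_add; first exact: leq_b1.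
      apply/subset_leq_card/subsetP => t; rewrite !inE => /andP[tB ->]; rewrite andbT.
      by apply: contraNneq z'B => <-.
    have := subcubic z; rewrite (cardsD1 z') inE zz'; lia.
  by rewrite (eq_card (B := 'I_6)) ?card_ord // => c; rewrite all.
have [c cM] := small S f x y yS xy.
have [c' cN] : exists c, c \notin N.
  by apply: (small _ g y x); rewrite 1?e_sym // inE xS.
have cf : c != f x by apply: contraNneq cM => ->; rewrite imset_f // setU11.
have cg : c' != g y by apply: contraNneq cN => ->; rewrite imset_f // setU11.
(* [s] gives [y] the colour [c], absent around [x], and only the colour [c'], absent around [y], is
   sent to [f x]. *)
pose s := (tperm (g y) c * tperm (tperm (g y) c c') (f x))%g.
have cs : c != tperm (g y) c c'.
  by rewrite -{1}(tpermL (g y) c) (inj_eq perm_inj) eq_sym.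
have sy : s (g y) = c by rewrite permM tpermL tpermD // eq_sym // cf.
have sc : s c' = f x by rewrite permM tpermL.
have fM u : u \in S -> u = x \/ e x u -> f u \in M.
  by move=> uS xu; rewrite imset_f // !inE uS; case: xu => [->|->]; rewrite ?eqxx ?orbT.
have gN u : u \in A :\: S -> u = y \/ e y u -> g u \in N.
  move=> uS yu; rewrite imset_f // in_setU1 inE uS.
  by case: yu => [->|->]; rewrite ?eqxx ?orbT.
pose k u := if u \in S then f u else s (g u).
have cross u v : u \in S -> v \in A -> v \notin S -> sq e A u v -> f u != s (g v).
  move=> uS vA vS /and4P[uA _ uv]; have vAS : v \in A :\: S by rewrite inE vS.
  move=> h'; have [[-> vy]|[-> ux]] : (u = x /\ (v = y \/ e y v)) \/ (v = y /\ e x u).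
  - case/orP: h' => [uv'|/exists_inP[z zA /andP[uz zv]]].
      by have [-> ->] := only u v uS vA vS uv'; left; split=> //; left.
    have [zS|zS] := boolP (z \in S).
      have [zx ->] := only z v zS vA vS zv; right; split=> //.
      by rewrite -zx e_sym.
    have [-> zy] := only u z uS zA zS uz; left; split=> //; right.
    by rewrite -zy.
  - rewrite -sc (inj_eq perm_inj); apply: contraNneq cN => ->; exact: gN.
  - by rewrite sy; apply: contraNneq cM => <-; apply: fM => //; right.
exists k => u v uv; rewrite /k.
have /and4P[uA vA nuv h'] := uv.
have [uS|uS] := boolP (u \in S); have [vS|vS] := boolP (v \in S).
- apply: fP; rewrite /sq uS vS nuv /=; case/orP: h' => [-> //|].
  move=> /exists_inP[z zA /andP[uz zv]]; apply/orP; right.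
  apply/exists_inP; exists z; rewrite ?uz ?zv //; apply: contraNT nuv => zS.
  have [-> _] := only u z uS zA zS uz.
  by rewrite e_sym in zv; have [-> _] := only v z vS zA zS zv.
- exact: cross.
- by rewrite eq_sym; apply: cross; rewrite // sq_sym.
- rewrite (inj_eq perm_inj); apply: gP; rewrite /sq !inE uS vS uA vA nuv /=.
  case/orP: h' => [-> //|].
  move=> /exists_inP[z zA /andP[uz zv]]; apply/orP; right.
  apply/exists_inP; exists z; rewrite ?uz ?zv //; rewrite inE zA andbT.
  apply: contraNN nuv => zS.
  have [_ ->] := only z v zS vA vS zv.
  by rewrite e_sym in uz; have [_ ->] := only z u zS uA uS uz.
Qed.

End Critical.

(** * Cycles and even subgraphs *)

Lemma next_neq_prev (T : eqType) (c : seq T) x :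
  uniq c -> 2 < size c -> x \in c -> next c x != prev c x.
Proof.
move=> uc sc xc; have [k s rE] := rot_to xc.
rewrite -(next_rot k uc) -(prev_rot k uc) rE.
have : uniq (x :: s) by rewrite -rE rot_uniq.
have : 2 < size (x :: s) by rewrite -rE size_rot.
case: s {rE} => [|y s] // + us; rewrite ltnS => ss.
have -> : next [:: x, y & s] x = y by rewrite /= eqxx.
have -> : prev [:: x, y & s] x = last y s.
  rewrite /prev /= (negbTE (_ : x != y)); last first.
    by move: us; rewrite /= inE negb_or => /andP[/andP[]].
  elim: s y {ss} us => [|z s IHs] y //= us; first by rewrite eqxx.
  have zx : x != z by move: us; rewrite /= !inE !negb_or => /andP[/and3P[]].
  rewrite (negbTE zx); apply: IHs; move: us; rewrite /= => /and3P[+ _ ->].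
  by rewrite !inE !negb_or => /and3P[_ -> ->].
case: s ss us => [|z s] // _ /and3P[_ + _]; apply: contraNneq => ->.
by rewrite /= mem_last.
Qed.

Lemma even_symmetric (T : finType) (r : rel T) : symmetric r -> irreflexive r ->
  ~~ odd #|[set p : T * T | r p.1 p.2]|.
Proof.
move=> r_sym r_irr; pose L := [set p : T * T | r p.1 p.2 & enum_rank p.1 < enum_rank p.2].
pose sw (p : T * T) := (p.2, p.1).
have swI : injective sw by move=> [a b] [c d] [-> ->].
suff -> : [set p : T * T | r p.1 p.2] = L :|: sw @: L.
  rewrite cardsU disjoint_setI0 ?cards0 ?subn0 ?card_imset // ?addnn ?odd_double //.
  rewrite -setI_eq0; apply/eqP/setP => -[a b]; rewrite !inE /=.
  apply/negP => /andP[/andP[_ lt] /imsetP[[c d]]]; rewrite inE /= => /andP[_ lt'] [ac bd].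
  by move: lt; rewrite ac bd ltnNge ltnW.
apply/setP => -[a b]; rewrite !inE /=; apply/idP/orP => [ab|[/andP[]//|/imsetP[[c d]]]].
  case: (ltngtP (enum_rank a) (enum_rank b)) => h; first by left; rewrite ab.
    by right; apply/imsetP; exists (b, a); rewrite // inE /= r_sym ab.
  by move: ab; rewrite (enum_rank_inj (val_inj h)) r_irr.
by rewrite inE /= => /andP[cd _] [-> ->]; rewrite r_sym.
Qed.

Definition nand (a b : bool) := ~~ (a && b).

Lemma count_cycle_nand f : cycle nand f -> (count id f).*2 <= size f.
Proof.
have P s : forall a, path nand a s -> (count id s).*2 + a <= size s + last a s.
  elim: s => [|b s IHs] a //= /andP[ab /IHs]; move: ab.
  by case: a b => [] [] //= _; lia.
by case: f => //= a s /P; rewrite last_rcons size_rcons -cats1 count_cat /=; lia.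
Qed.

(** Degree patterns along a face of given length are classified by evaluating a predicate on all bit
    sequences. *)
Fixpoint bits n : seq (seq bool) :=
  if n is n'.+1 then map (cons false) (bits n') ++ map (cons true) (bits n') else [:: [::]].

Lemma bitsP (P : pred (seq bool)) n s : all P (bits n) -> size s = n -> P s.
Proof.
move=> /allP h sn; apply: h; rewrite -{}sn; elim: s => //= b s IHs.
by rewrite mem_cat; case: b; rewrite map_f ?orbT.
Qed.

Lemma rev_ucycle (T : eqType) (r : rel T) c : symmetric r -> ucycle r c -> ucycle r (rev c).
Proof.
move=> r_sym /andP[cc uc]; rewrite /ucycle /ucycleb rev_uniq uc andbT rev_cycle.
by rewrite (eq_cycle (e' := r)) // => x y; rewrite r_sym.
Qed.

(** * Relations with all degrees 0 or 2 *)

Section TwoRegular.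

Variables (T : finType) (B : rel T).
Hypotheses (B_sym : symmetric B) (B_irr : irreflexive B).
Hypothesis B_deg : forall x, #|[set y | B x y]| \in [:: 0; 2].

Lemma two_regular_nbrs x y z t : B x y -> B x z -> B x t -> y != z -> t = y \/ t = z.
Proof.
move=> xy xz xt yz; have [->|ty] := eqVneq t y; first by left.
have [->|tz] := eqVneq t z; first by right.
have := B_deg x.
rewrite (cardsD1 y) (cardsD1 z) (cardsD1 t) !inE xy xz xt ty tz (eq_sym z) yz /=.
by rewrite !add1n.
Qed.

Lemma two_regular_other x y : B x y -> exists2 z, B x z & z != y.
Proof.
move=> xy; have := B_deg x; rewrite (cardsD1 y) inE xy.
case: (set_0Vmem ([set z | B x z] :\ y)) => [->|[z]]; first by rewrite cards0 !inE.
by rewrite !inE => /andP[zy xz] _; exists z.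
Qed.

(** In a longest path ending with the edge from [y] to [x], the second neighbour of the first vertex
    lies on the path; it is [x], because inner vertices have both their neighbours on the path
    already. *)
Lemma two_regular_cycle x y : B x y ->
  exists p, ucycle B (x :: y :: p) /\ 0 < size p.
Proof.
move=> xy.
pose P n := [exists q : n.-tuple T,
  let s := q ++ [:: y; x] in sorted B s && uniq s].
have P0 : exists n, P n.
  exists 0; apply/existsP; exists [tuple]; rewrite /= B_sym xy inE !andbT.
  by apply: contraTneq xy => ->; rewrite B_irr.
have Pb n : P n -> n <= #|T|.
  case/existsP => q /andP[_ u]; have := max_card [in q ++ [:: y; x]].
  by rewrite (card_uniqP u) size_cat size_tuple; lia.
case: (ex_maxnP P0 Pb) => n /existsP[q /= /andP[]].
have [u [b [r [sE rx]]]] : exists u b r, q ++ [:: y; x] = u :: b :: r /\ last b r = x.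
  case: (tval q) => [|u [|b q']]; first by exists y, x, [::].
    by exists u, y, [:: x].
  by exists u, b, (q' ++ [:: y; x]); rewrite last_cat.
rewrite sE => bs us nmax; have /= /andP[ub br] := bs.
have [z uz zb] := two_regular_other ub.
have zs : z \in u :: b :: r.
  apply: contraT => zs; have := nmax n.+1; rewrite ltnn => -> //.
  apply/existsP; exists [tuple of z :: q]; rewrite /= sE zs us andbT /= B_sym uz ub.
  by rewrite br.
have zr : z \in r.
  move: zs; rewrite !inE (negbTE zb) /= => /orP[/eqP zu|//].
  by move: uz; rewrite zu B_irr.
have zx : z = x.
  case/splitPr: zr rx br us {bs sE zs} => r1 [|w r2]; rewrite last_cat //=.
  rewrite cat_path /= => _ /and4P[_ lz zw _] us.
  have lw : last b r1 != w.
    have : uniq ((b :: r1) ++ z :: w :: r2) by case/andP: us.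
    rewrite cat_uniq => /and3P[_ /hasPn/(_ w) + _].
    rewrite inE in_cons eqxx orbT => /(_ isT); apply: contraNneq => <-; exact: mem_last.
  rewrite B_sym in lz; rewrite B_sym in uz.
  move: us; rewrite /= !inE mem_cat !inE !negb_or.
  case: (two_regular_nbrs lz zw uz lw) => ->; last by rewrite eqxx !andbF.
  case/lastP: r1 {lz lw} => [|r1 t]; first by rewrite eqxx.
  by rewrite last_rcons mem_rcons inE eqxx !andbF.
exists (rev q); split.
  rewrite /ucycle /ucycleb -[_ :: _ :: _](revK) !rev_cons revK rev_uniq rev_cycle.
  rewrite -!cats1 -catA sE us andbT.
  rewrite (eq_cycle (e' := B)); last by move=> a c; rewrite B_sym.
  rewrite /= rcons_path rx ub br /=; rewrite -zx B_sym uz //.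
rewrite size_rev; case: (tval q) sE => // -[uE bE rE]; subst u b r.
by rewrite in_nil in zr.
Qed.

Lemma two_regular_closed c u v : ucycle B c -> 2 < size c -> u \in c -> B u v -> v \in c.
Proof.
move=> /andP[cc uc] sc ucin uv.
have n1 := next_cycle cc ucin; have n2 := prev_cycle cc ucin; rewrite B_sym in n2.
by have [->|->] := two_regular_nbrs n1 n2 uv (next_neq_prev uc sc ucin);
  rewrite ?mem_next ?mem_prev.
Qed.

End TwoRegular.

Lemma odd_sum (I : finType) (f : I -> nat) :
  odd (\sum_i f i) = odd #|[set i | odd (f i)]|.
Proof.
rewrite (eq_bigr (fun i => odd (f i) + (f i)./2.*2)); last first.
  by move=> i _; rewrite odd_double_half.
rewrite big_split /= oddD (_ : odd (\sum_i (f i)./2.*2) = false) ?addbF; last first.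
  by elim/big_rec: _ => // i x _; rewrite oddD odd_double => ->.
congr odd; rewrite -sum1dep_card [RHS]big_mkcond; apply: eq_bigr => i _.
by case: odd.
Qed.

Lemma odd_card_addb (I : finType) (a b : pred I) :
  odd #|[set i | a i (+) b i]| = odd #|[set i | a i]| (+) odd #|[set i | b i]|.
Proof.
have E (p : pred I) : odd #|[set i | p i]| = odd (\sum_i p i).
  by rewrite odd_sum; congr (odd #|pred_of_set _|); apply/setP => i; rewrite !inE oddb.
rewrite !E -oddD -big_split /=.
rewrite (odd_sum (fun i => a i + b i)) odd_sum; congr (odd #|pred_of_set _|).
by apply/setP => i; rewrite !inE oddD !oddb.
Qed.

Lemma card_darts (T : finType) (g : rel T) :
  #|[set p : T * T | g p.1 p.2]| = \sum_x #|[set y | g x y]|.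
Proof.
rewrite -sum1dep_card -(pair_big_dep xpredT (fun x y => g x y) (fun _ _ => 1)) /=.
by apply: eq_bigr => x _; rewrite -sum1dep_card.
Qed.

(** * An Euler inequality by counting edge sets *)

Section Euler.

Variables (T F : finType) (g : rel T) (fl : T -> T -> F).
Hypotheses (g_sym : symmetric g) (g_irr : irreflexive g).
Hypothesis potential : forall c : rel T, symmetric c -> subrel c g ->
  (forall x, ~~ odd #|[set y | c x y]|) ->
  exists h : F -> bool, forall x y, g x y -> c x y = h (fl x y) (+) h (fl y x).

Let V := [set x | 0 < #|[set y | g x y]|].
Let N := [set fl p.1 p.2 | p : T * T & g p.1 p.2].

Let lt (p : T * T) := enum_rank p.1 < enum_rank p.2.
Let X := [set p : T * T | g p.1 p.2 && lt p].
Let rl (S : {set T * T}) x y := ((x, y) \in S) || ((y, x) \in S).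
Let par S := [set x | odd #|[set y | rl S x y]|].

Let rl_sym S : symmetric (rl S). Proof. by move=> x y; rewrite /rl orbC. Qed.

Let rlX (S : {set T * T}) x y : S \subset X -> rl S x y -> g x y.
Proof.
by move=> /subsetP SX /orP[] /SX; rewrite inE => /andP[] //= + _; rewrite g_sym.
Qed.

Let rlE (S : {set T * T}) p : S \subset X -> p \in X -> rl S p.1 p.2 = (p \in S).
Proof.
case: p => x y SX; rewrite inE /rl => /andP[_ xy] /=.
case: ((x, y) \in S) => //=; apply/negbTE/negP => /(subsetP SX).
by rewrite inE => /andP[_ yx]; move: xy yx; rewrite /lt /=; lia.
Qed.

Let cardX : #|[set p : T * T | g p.1 p.2]| = #|X|.*2.
Proof.
pose sw (p : T * T) := (p.2, p.1).
have swI : injective sw by move=> [a b] [c d] [-> ->].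
have -> : [set p : T * T | g p.1 p.2] = X :|: sw @: X.
  apply/setP => -[a b]; rewrite !inE /=; apply/idP/orP => [ab|[/andP[]//|/imsetP[[c d]]]].
    case: (ltngtP (enum_rank a) (enum_rank b)) => h; first by left; rewrite ab.
      by right; apply/imsetP; exists (b, a); rewrite // inE /= g_sym ab.
    by move: ab; rewrite (enum_rank_inj (val_inj h)) g_irr.
  by rewrite inE /= => /andP[cd _] [-> ->]; rewrite g_sym.
rewrite cardsU disjoint_setI0 ?cards0 ?subn0 ?card_imset // ?addnn //.
rewrite -setI_eq0; apply/eqP/setP => -[a b]; rewrite !inE /=.
apply/negP => /andP[/andP[_ ab] /imsetP[[c d]]]; rewrite inE /lt /= => /andP[_ cd] [ac bd].
by move: ab; rewrite /lt /= ac bd; lia.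
Qed.

Let par_even (S : {set T * T})  : S \subset X -> ~~ odd #|par S|.
Proof.
move=> SX; rewrite -odd_sum -card_darts; apply: even_symmetric; first exact: rl_sym.
by move=> x; apply/negbTE/negP => /(rlX SX); rewrite g_irr.
Qed.

Let par_V (S : {set T * T})  : S \subset X -> par S \subset V.
Proof.
move=> SX; apply/subsetP => x; rewrite !inE.
case: (set_0Vmem [set y | rl S x y]) => [->|[y]]; first by rewrite cards0.
by rewrite inE => /(rlX SX) xy _; apply/card_gt0P; exists y; rewrite inE.
Qed.

(* Two edge sets with the same odd vertices differ by an even subgraph, which is
   determined by a set of faces. *)
Let fiber (S0 : {set T * T})  : S0 \subset X ->
  #|[set S in powerset X | par S == par S0]| <= 2 ^ #|N|.
Proof.
move=> S0X; rewrite -card_powerset.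
pose Phi (H : {set F}) := [set p in X | (p \in S0) (+) (fl p.1 p.2 \in H) (+) (fl p.2 p.1 \in H)].
apply: leq_trans (leq_imset_card Phi _).
apply/subset_leq_card/subsetP => S; rewrite !inE => /andP[SX /eqP parS].
have [| |x|h hP] := potential (c := fun x y => rl S x y (+) rl S0 x y).
- by move=> x y; rewrite !(rl_sym _ x).
- by move=> x y; case E: (rl S x y); [rewrite (rlX SX E)|move=> /= /(rlX S0X)].
- rewrite odd_card_addb; move/setP/(_ x): parS; rewrite !inE => ->.
  by rewrite addbb.
apply/imsetP; exists [set f in N | h f]; first by rewrite inE; apply/subsetP => f; rewrite inE => /andP[].
apply/setP => p; rewrite inE; have [pX|pX] := boolP (p \in X); last first.
  by apply/negbTE; apply: contraNN pX => /(subsetP SX).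
have gp : g p.1 p.2 by move: pX; rewrite inE => /andP[].
have in1 : fl p.1 p.2 \in N by apply/imsetP; exists p; rewrite ?inE.
have in2 : fl p.2 p.1 \in N by apply/imsetP; exists (p.2, p.1); rewrite ?inE //= g_sym.
have := hP _ _ gp; rewrite !inE in1 in2 !rlE //= -addbA => <-.
by rewrite addbC addbK.
Qed.

(** Each of the [2 ^ |X|] edge sets has an even set of odd vertices, one of at most [2 ^ (|V| - 1)],
    and at most [2 ^ |N|] edge sets share it. A set of faces and its complement bound the same
    subgraph, hence the loss of one against Euler's formula. *)
Lemma euler_count : V != set0 ->
  #|[set p : T * T | g p.1 p.2]| + 2 <= 2 * (#|N| + #|V|).
Proof.
move=> /set0Pn[a0 a0V].
have : 2 ^ #|X| <= 2 ^ (#|V|.-1) * 2 ^ #|N|.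
  rewrite -(card_powerset X) -sum1_card (partition_big_imset par) /=.
  apply: leq_trans (_ : \sum_(d in par @: powerset X) 2 ^ #|N| <= _).
    apply: leq_sum => d /imsetP[S0]; rewrite inE => S0X ->.
    by rewrite sum1dep_card; exact: fiber.
  rewrite sum_nat_const leq_mul2r; apply/orP; right.
  have -> : #|V|.-1 = #|V :\ a0| by rewrite [in LHS](cardsD1 a0) a0V.
  rewrite -card_powerset -(card_in_imset (f := fun d : {set T} => d :\ a0)).
    apply/subset_leq_card/subsetP => _ /imsetP[_ /imsetP[S SX ->] ->].
    by rewrite inE setSD //; apply: par_V; rewrite inE in SX.
  move=> _ _ /imsetP[S SX ->] /imsetP[S' SX' ->] eqD; rewrite !inE in SX SX'.
  have odd0 (Q : {set T * T}) : Q \subset X -> (a0 \in par Q) = odd #|par Q :\ a0|.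
    by move=> /par_even; rewrite (cardsD1 a0) oddD oddb; case: (a0 \in _); case: odd.
  apply/setP => x; have [->|xa] := eqVneq x a0; first by rewrite !odd0 // eqD.
  by move/setP/(_ x): eqD; rewrite !in_setD1 xa.
rewrite -expnD leq_exp2l // cardX.
by rewrite (cardsD1 a0 V) a0V /=; lia.
Qed.

End Euler.

(** * Discharging *)

Lemma use_imply (a b : bool) (Q : Prop) : a ==> b -> a -> (b -> Q) -> Q.
Proof. by move=> /implyP ab /ab h; apply. Qed.

Section Face.

Variables (T : finType) (e : rel T).
Hypotheses (e_sym : symmetric e) (e_irr : irreflexive e).
Hypothesis girth8 : forall c, ucycle e c -> 2 < size c -> 7 < size c.
Hypothesis subcubic : forall x, #|[set y | e x y]| <= 3.
Variable A : {set T}.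
Hypothesis crit : critical e A.

Let g x y := [&& x \in A, y \in A & e x y].

Variables (F : finType) (fl : T -> T -> F).
Hypothesis face_even : forall f x,
  ~~ odd #|[set y | g x y && ((fl x y == f) (+) (fl y x == f))]|.
Hypothesis potential : forall c : rel T, symmetric c -> subrel c g ->
  (forall x, ~~ odd #|[set y | c x y]|) ->
  exists h : F -> bool, forall x y, g x y -> c x y = h (fl x y) (+) h (fl y x).

Let g_sym : symmetric g. Proof. by move=> x y; rewrite /g andbCA e_sym. Qed.
Let g_irr : irreflexive g. Proof. by move=> x; rewrite /g e_irr !andbF. Qed.
Let ge x y : g x y -> e x y. Proof. by case/and3P. Qed.
Let gA x y : g x y -> x \in A. Proof. by case/and3P. Qed.

Let sub_cycle (r r' : rel T) c : subrel r r' -> ucycle r c -> ucycle r' c.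
Proof. by move=> rr /andP[cc uc]; rewrite /ucycle /ucycleb uc (sub_cycle rr cc). Qed.

(** If both sides of [xy] were the same face, the potential would exclude [xy] from every even
    subgraph, so from every cycle. It would be a bridge, which a critical graph does not have. *)
Lemma bridgeless x y : g x y -> fl x y != fl y x.
Proof.
move=> xy; apply/negP => /eqP flE.
pose r u v := [&& g u v, (u, v) != (x, y) & (u, v) != (y, x)].
have xnr : ~~ connect r x y.
  apply/negP => /connectP[p0 rp0 yp0]; case/shortenP: rp0 yp0 => p rp up _ yp {p0}.
  case: p rp up yp => [|a [|b p]] rp up yp.
  - by move: xy; rewrite yp g_irr.
  - by rewrite /= in yp; subst a; move: rp; rewrite /r /= eqxx /= !andbF.
  pose c := [:: x, a, b & p].
  have rg : subrel r g by move=> u v /and3P[].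
  have cc : cycle g c.
    rewrite /c /cycle rcons_path -yp g_sym xy andbT.
    exact: sub_path rg _ _ rp.
  pose k u v := [&& u \in c, v \in c & (v == next c u) || (v == prev c u)].
  have kadj u : u \in c -> [set v | k u v] = [set next c u; prev c u].
    move=> uc; apply/setP => v; rewrite in_set in_set2 /k uc andTb; apply: andb_idl.
    by case/orP => /eqP->; rewrite ?mem_next ?mem_prev.
  have k_sym : symmetric k.
    move=> u v; rewrite /k andbCA; case: (boolP (v \in c)) => //= _; case: (boolP (u \in c)) => //= _.
    rewrite orbC -(can2_eq (prev_next up) (next_prev up)) -(can2_eq (next_prev up) (prev_next up)).
    by rewrite !(eq_sym u) orbC.
  have [|u|h /(_ x y xy)] := potential k_sym.
  - move=> u v /and3P[uc vc /orP[/eqP->|/eqP->]]; first exact: next_cycle cc uc.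
    by rewrite g_sym; exact: prev_cycle cc uc.
  - have [uc|uc] := boolP (u \in c).
      by rewrite kadj // cards2 next_neq_prev.
    suff -> : [set v | k u v] = set0 by rewrite cards0.
    by apply/setP => v; rewrite in_set in_set0 /k (negbTE uc).
  have yc : y \in c by rewrite yp mem_last.
  have nyx : next c y = x.
    by rewrite next_nth yc yp index_last //; apply: nth_default.
  rewrite flE addbb /k mem_head yc -{2}nyx prev_next // eqxx orbT.
  by [].
have xA := gA xy; have yA : y \in A by move: xy; rewrite g_sym => /gA.
pose S := [set u in A | connect r x u].
have [|||||u [v [uS vS uv nxy]]] := critical_bridgeless e_sym subcubic crit
  (S := S) (x := x) (y := y).
- by apply/subsetP => u; rewrite inE => /andP[].
- by rewrite inE xA connect0.
- exact: yA.
- by rewrite inE negb_and xnr orbT.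
- exact: ge.
move: uS vS; rewrite !inE => /andP[uA xu] /andP[+ vA]; rewrite vA /= => /negP[].
apply: (connect_trans xu); apply: connect1; rewrite /r /g uA vA uv nxy /=.
by apply: contraNneq xnr => -[<- _].
Qed.

Let deg x := #|[set y | g x y]|.
Let two x := deg x == 2.
Let three x := deg x == 3.

Lemma degE x : x \in A -> deg x = #|nbrs e A x|.
Proof. by move=> xA; apply: eq_card => y; rewrite !inE /g xA. Qed.

Lemma deg23 x : x \in A -> two x = ~~ three x.
Proof.
move=> xA; rewrite /two /three degE //.
have := critical_deg_ge2 e_sym e_irr girth8 subcubic crit xA.
have : #|nbrs e A x| <= #|[set y | e x y]|.
  by apply/subset_leq_card/subsetP => y; rewrite !inE => /andP[].
have := subcubic x; lia.
Qed.

Lemma two_two x y : g x y -> two x -> three y.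
Proof.
move=> /and3P[xA yA xy]; rewrite -[three y]negbK -deg23 // /two !degE // => /eqP x2.
have := critical_two_two e_sym e_irr girth8 subcubic crit xA yA xy; rewrite x2 => /(_ isT).
lia.
Qed.

Definition face_rel f x y := g x y && ((fl x y == f) || (fl y x == f)).
Let B := face_rel.

Let B_sym f : symmetric (B f). Proof. by move=> x y; rewrite /B /face_rel g_sym orbC. Qed.
Let Bg f x y : B f x y -> g x y. Proof. by case/andP. Qed.
Let B_irr f : irreflexive (B f). Proof. by move=> x; rewrite /B /face_rel g_irr. Qed.

Lemma face_deg_even f x : ~~ odd #|[set y | B f x y]|.
Proof.
suff -> : [set y | B f x y] = [set y | g x y && ((fl x y == f) (+) (fl y x == f))] by [].
apply/setP => y; rewrite !inE /B /face_rel; case xy: (g x y) => //=.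
have := bridgeless xy.
by case: (eqVneq (fl x y) f) => [->|_]; case: (eqVneq (fl y x) f) => [E|_].
Qed.

(** Hence a face boundary is a disjoint union of cycles. *)
Lemma face_deg f x : #|[set y | B f x y]| \in [:: 0; 2].
Proof.
have : #|[set y | B f x y]| <= 3.
  apply: leq_trans (subcubic x); apply/subset_leq_card/subsetP => y.
  by rewrite !inE => /Bg/ge.
by have := face_deg_even f x; case: #|_| => [|[|[|[|n]]]].
Qed.

Definition other f x y := if fl x y == f then fl y x else fl x y.

Lemma otherP f x y : B f x y -> B (other f x y) x y /\ other f x y != f.
Proof.
move=> /andP[xy]; have := bridgeless xy; rewrite /B /face_rel xy /other /=.
case: (eqVneq (fl x y) f) => [->|n _ _]; first by rewrite eq_sym => -> _; rewrite eqxx orbT.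
by rewrite eqxx.
Qed.

Lemma other_uniq f h x y : B f x y -> B h x y -> h != f -> h = other f x y.
Proof.
rewrite /B /face_rel /other => /andP[_ +] /andP[_ +].
case: (eqVneq (fl x y) f) => [->|_] /=; case: (eqVneq (fl y x) f) => [->|_] //=.
- by move=> _ /orP[/eqP-> //|/eqP->]; rewrite ?eqxx.
- by rewrite eq_sym => _ /orP[/eqP->|/eqP-> //]; rewrite eqxx.
- by move=> _ /orP[/eqP->|/eqP->]; rewrite ?eqxx.
Qed.

(* A third edge at [x] would be the only one at [x] on one of its faces. *)
Lemma face_third f h x y z : f != h -> three x -> B f x y -> B h x y ->
  B f x z -> B h x z -> y = z.
Proof.
move=> fh x3 fy hy fz hz; apply/eqP/negPn/negP => yz.
move: x3; rewrite /three /deg (cardsD1 y) (cardsD1 z) !inE (Bg fy) (Bg fz) (eq_sym z) yz /=.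
rewrite !add1n !eqSS => /cards1P[w wE].
have wxy k : (k \in [set w]) = [&& k != z, k != y & g x k] by rewrite -wE !inE.
have := wxy w; rewrite inE eqxx => /esym/and3P[wz wy gw].
pose k := fl x w.
have kw : B k x w by rewrite /B /face_rel gw eqxx.
have dk := face_deg k x.
have two_nbr j : B j x y -> B j x z -> B j x w -> False.
  move=> jy jz jw; have := @two_regular_nbrs _ (B j) (face_deg j) x y z w jy jz jw yz.
  by case=> E; [move: wy|move: wz]; rewrite E eqxx.
have kf : k != f by apply/eqP => kf; apply: (two_nbr f) => //; rewrite -kf.
have kh : k != h by apply/eqP => kh; apply: (two_nbr h) => //; rewrite -kh.
have [v kv vw] := two_regular_other (face_deg k) kw.
have no u : B f x u -> B h x u -> ~ B k x u.
  move=> fu hu ku; have := other_uniq fu ku kf; rewrite -(other_uniq fu hu) 1?eq_sym //.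
  exact/eqP.
have vz : v != z by apply/eqP => E; apply: (no z) => //; rewrite -E.
have vy : v != y by apply/eqP => E; apply: (no y) => //; rewrite -E.
by have := wxy v; rewrite inE (negbTE vw) vz vy (Bg kv).
Qed.

Definition face_verts f := [set x | [exists y, B f x y]].
Definition n3 f := #|[set x in face_verts f | three x]|.

Lemma face_vertsA f x : x \in face_verts f -> x \in A.
Proof. by rewrite inE => /existsP[y /Bg/gA]. Qed.

Let Bcycle_e f c : ucycle (B f) c -> ucycle e c.
Proof. by apply: sub_cycle => u v /Bg/ge. Qed.

Lemma face_cycle f x y : B f x y -> exists p, ucycle (B f) (x :: y :: p) /\ 5 < size p.
Proof.
move=> xy; have [p [cp sp]] := two_regular_cycle (@B_sym f) (@B_irr f) (face_deg f) xy.
by exists p; split=> //; exact: (girth8 (Bcycle_e cp)).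
Qed.

Lemma cycle_face_verts f c : ucycle (B f) c -> {subset c <= face_verts f}.
Proof.
by move=> /andP[cc _] x xc; rewrite inE; apply/existsP; exists (next c x); exact: next_cycle.
Qed.

Lemma cycle_flags f c : ucycle (B f) c -> cycle nand (map two c).
Proof.
move=> /andP[+ _]; have nb u v : B f u v -> nand (two u) (two v).
  move=> /Bg uv; rewrite /nand; case u2: (two u) => //=.
  by rewrite deg23 ?negbK ?(two_two uv) // (gA (y := u)) // g_sym.
case: c => //= x p; rewrite -map_rcons path_map; exact: sub_path.
Qed.

Lemma count_three c : {subset c <= A} -> count three c = size c - count id (map two c).
Proof.
move=> cA; rewrite count_map -(count_predC two c) addKn.
by apply: eq_in_count => x /cA xA; rewrite /= deg23 ?negbK.
Qed.

Lemma cycle_three f c : ucycle (B f) c -> size c <= (count three c).*2.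
Proof.
move=> cc; rewrite count_three; last by move=> x /(cycle_face_verts cc)/face_vertsA.
set k := count _ _; have : k.*2 <= size c.
  by rewrite -(size_map two c); exact: count_cycle_nand (cycle_flags cc).
by clearbody k; lia.
Qed.

Let count_set f c : ucycle (B f) c -> count three c = #|[set x in c | three x]|.
Proof.
move=> /andP[_ uc]; rewrite -size_filter -(card_uniqP (filter_uniq three uc)).
by apply: eq_card => x; rewrite !inE mem_filter andbC.
Qed.

(** Every boundary cycle has length at least 8 and no two consecutive 2-vertices, hence four
    3-vertices; a second, disjoint cycle would raise [n3 f] to 8. *)
Lemma face_whole f c : ucycle (B f) c -> 7 < size c -> n3 f < 8 ->
  c =i face_verts f /\ n3 f = count three c.
Proof.
move=> cc sc lt8; have cV := cycle_face_verts cc.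
suff cE : c =i face_verts f.
  by split=> //; rewrite (count_set cc); apply: eq_card => x; rewrite !inE cE inE.
move=> x; apply/idP/idP => [/cV //|xV]; apply: contraLR lt8 => xc; rewrite -leqNgt.
move: (xV); rewrite inE => /existsP[y /face_cycle[p [cp sp]]].
have sc2 : 2 < size c by exact: leq_trans sc.
have disj : [disjoint c & x :: y :: p].
  rewrite disjoint_has; apply/hasPn => u uc; apply: contraNN xc => up.
  have /andP[pcyc pu] := cp.
  have [k s sE] := rot_to up.
  have : path (B f) u s.
    have : cycle (B f) (u :: s) by rewrite -sE rot_cycle.
    by rewrite /= rcons_path => /andP[].
  have : x \in u :: s by rewrite -sE mem_rot mem_head.
  elim: s u uc {up sE} => [|v s IHs] u uc; first by rewrite inE => /eqP->.
  rewrite inE => /orP[/eqP-> //|xs] /= /andP[uv pv].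
  apply: (IHs v) => //.
  exact: (two_regular_closed (@B_sym f) (face_deg f) cc sc2 uc uv).
have ge4 d : ucycle (B f) d -> 7 < size d -> 4 <= #|[set x0 in d | three x0]|.
  by move=> cd sd; rewrite -(count_set cd) -leq_double (leq_trans sd (cycle_three cd)).
apply: leq_trans (leq_add (ge4 c cc sc) (ge4 _ cp sp)) _.
rewrite -cardsUI (_ : _ :&: _ = set0) ?cards0 ?addn0; last first.
  apply/setP => u; rewrite !in_set; apply/negbTE/negP => /andP[/andP[uc _] /andP[up _]].
  by move: (disjointFr disj uc); rewrite up.
apply/subset_leq_card/subsetP => u; rewrite !in_set => /orP[] /andP[ui ->]; rewrite andbT.
  by have := cV u ui; rewrite in_set.
by have := cycle_face_verts cp ui; rewrite in_set.
Qed.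

Lemma n3_ge4 f x : x \in face_verts f -> 4 <= n3 f.
Proof.
rewrite inE => /existsP[y /face_cycle[p [cp sp]]].
have [lt8|] := ltnP (n3 f) 8; last by apply: leq_trans.
have [_ ->] := face_whole cp sp lt8.
by have := cycle_three cp; rewrite [size (x :: _)]/=; lia.
Qed.

Lemma config_absent C na ns d s x0 : config_check C na ns d ->
  {subset s <= A} -> map two s = twos C ->
  all (fun c => ucycleb e (map (nth x0 s) c)) (cycles C) ->
  all (fun p => upath e (map (nth x0 s) p)) (paths C) ->
  all (fun l => uniq (map (nth x0 s) l)) (apart C) -> False.
Proof.
move=> chk sA sf cC pC aC.
have sz : size s = csize C by rewrite /csize -sf size_map.
apply: (config_reducible e_sym e_irr girth8 subcubic chk (A := A) (phi := nth x0 s)) crit.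
apply/and4P; split=> //; apply/allP => i; rewrite mem_iota /= -sz => ilt.
have iA : nth x0 s i \in A by apply/sA/mem_nth.
rewrite iA -sf (nth_map x0) //=; apply/implyP => /eqP; rewrite degE // => -> //.
Qed.

Lemma cycle_config_absent f c na ns d : ucycle (B f) c ->
  config_check (cycle_config (map two c)) na ns d -> False.
Proof.
move=> cc chk; case: c cc chk => [|x c] // cc chk.
apply: (config_absent (s := x :: c) (x0 := x) chk) => //.
  by move=> u /(cycle_face_verts cc)/face_vertsA.
change (cycles _) with [:: iota 0 (size (map two (x :: c)))].
by rewrite all_seq1 size_map map_nth_iota0 // take_size; exact: Bcycle_e cc.
Qed.

Lemma face_flags f c : ucycle (B f) c -> 7 < size c -> n3 f < 8 ->
  [/\ cycle nand (map two c), size c = n3 f + count id (map two c) & size c <= (n3 f).*2].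
Proof.
move=> cc sc lt8; have [_ ->] := face_whole cc sc lt8.
split; [exact: cycle_flags cc| |exact: cycle_three cc].
rewrite count_three ?subnK //; last by move=> x /(cycle_face_verts cc)/face_vertsA.
by rewrite -[leqRHS](size_map two); exact: count_size.
Qed.

Lemma rot_config_absent f c k na ns d : ucycle (B f) c ->
  config_check (cycle_config (rot k (map two c))) na ns d -> False.
Proof.
by move=> cc; rewrite -map_rot; apply: (@cycle_config_absent f); rewrite /ucycle /ucycleb rot_cycle rot_uniq.
Qed.

(** Four 3-vertices admit at most four 2-vertices between them, so the girth forces the alternating
    8-cycle, which [C1_check] excludes. *)
Lemma n3_neq4 f c : ucycle (B f) c -> 7 < size c -> n3 f != 4.
Proof.
move=> cc sc; apply/eqP => n4; have [|nd sz le] := face_flags cc sc; first by rewrite n4.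
have s8 : size c = 8 by lia.
pose P t := (cycle nand t && (count id t == 4)) ==>
  has (fun k => rot k t == flags [:: 0;1;0;1;0;1;0;1]) (iota 0 8).
have chk : P (map two c) by apply: (@bitsP P 8); [vm_compute|rewrite size_map].
apply: (use_imply chk); first by rewrite nd; lia.
move=> /hasP[k _ /eqP kE]; apply: (rot_config_absent (k := k) cc); rewrite kE; exact: C1_check.
Qed.

(** Length 9 leaves one cyclic pattern, that of [C2_check]; length 10 leaves the alternating one,
    which contains the path of [T5_check]. *)
Lemma n3_five_size f c : ucycle (B f) c -> 7 < size c -> n3 f = 5 -> size c = 8.
Proof.
move=> cc sc n5; have [|nd sz le] := face_flags cc sc; first by rewrite n5.
have [//|s9|s10] : [\/ size c = 8, size c = 9 | size c = 10].
  by have : size c \in [:: 8; 9; 10] by [rewrite !inE; lia]; rewrite !inE => /or3P[] /eqP;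
    [constructor 1|constructor 2|constructor 3].
- pose P t := (cycle nand t && (count id t == 4)) ==>
    has (fun k => rot k t == flags [:: 0;1;0;1;0;1;0;1;0]) (iota 0 9).
  have chk : P (map two c) by apply: (@bitsP P 9); [vm_compute|rewrite size_map].
  apply: (use_imply chk); first by rewrite nd; lia.
  move=> /hasP[k _ /eqP kE]; exfalso.
  by apply: (rot_config_absent (k := k) cc); rewrite kE; exact: C2_check.
- pose P t := (cycle nand t && (count id t == 5)) ==>
    has (fun k => take 7 (rot k t) == flags [:: 1;0;1;0;1;0;1]) (iota 0 10).
  have chk : P (map two c) by apply: (@bitsP P 10); [vm_compute|rewrite size_map].
  apply: (use_imply chk); first by rewrite nd; lia.
  move=> /hasP[k _ /eqP kE]; exfalso.
  have : ucycle (B f) (rot k c) by rewrite /ucycle /ucycleb rot_cycle rot_uniq.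
  have : size (rot k c) = 10 by rewrite size_rot.
  move: kE; rewrite -map_rot; case: (rot k c) => // x r kE sr cr.
  have sub : subseq (take 7 (x :: r)) (x :: r) by rewrite -{2}(cat_take_drop 7 (x :: r)) prefix_subseq.
  apply: (config_absent (s := take 7 (x :: r)) (x0 := x) T5_check) => //.
  + by move=> u /(mem_subseq sub)/(cycle_face_verts cr)/face_vertsA.
  + by rewrite map_take.
  change (paths _) with [:: iota 0 7].
  rewrite all_seq1 map_nth_iota0; last first.
    by rewrite size_take sr.
  rewrite take_oversize ?size_take ?sr // /upath (subseq_uniq sub) ?andbT; last by case/andP: cr.
  have : path e x r.
    by case/andP: (Bcycle_e cr) => + _; rewrite /= rcons_path => /andP[].
  by rewrite -{1}(cat_take_drop 6 r) cat_path => /andP[].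
Qed.

(** The catalogue contains each 5-face in one direction of traversal. The given edge is made the
    closing edge of the cycle, and the cycle is reversed if its flags require it. *)
Lemma five_orient f x y : n3 f = 5 -> B f x y -> three x -> three y ->
  exists w' w m, [/\ (w', w) = (x, y) \/ (w', w) = (y, x), size m = 6,
    ucycle (B f) (w' :: rcons m w), w' :: rcons m w =i face_verts f &
    map two (w' :: rcons m w) \in [:: F1; F2]].
Proof.
move=> n5 xy x3 y3; have [p [cp sp]] := face_cycle xy.
have sc : 7 < size (x :: y :: p) by exact: sp.
have [|nd sz _] := face_flags cp sc; first by rewrite n5.
have [|whole _] := face_whole cp sc; first by rewrite n5.
have s8 := n3_five_size cp sc n5; have s6 : size p = 6 by case: s8.
have xA := gA (Bg xy); have yA : y \in A by apply: (gA (y := x)); rewrite g_sym (Bg xy).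
have x2 : two x = false by rewrite deg23 // x3.
have y2 : two y = false by rewrite deg23 // y3.
pose P t := (cycle nand [:: false, false & t] && (count id t == 3)) ==>
  (false :: rcons t false \in [:: F1; F2]) || (false :: rcons (rev t) false \in [:: F1; F2]).
have chk : P (map two p) by apply: (@bitsP P 6); [vm_compute|rewrite size_map].
apply: (use_imply chk).
  move: nd sz; rewrite s8 n5 /= x2 y2 => nd' sz'; apply/andP; split; first exact: nd'.
  by rewrite -(eqn_add2l 5) -sz'.
case/orP => flE.
  exists y, x, p; split=> //; first by right.
  - by rewrite -rcons_cons -rot1_cons /ucycle /ucycleb rot_cycle rot_uniq.
  - by move=> u; rewrite -whole -rcons_cons -rot1_cons mem_rot.
  - by rewrite /= map_rcons x2 y2.
have cr := rev_ucycle (@B_sym f) cp.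
have rE : rotr 1 (rev [:: x, y & p]) = x :: rcons (rev p) y by rewrite !rev_cons rotr1_rcons.
exists x, y, (rev p); split=> //; first by left.
- by rewrite size_rev.
- by rewrite -rE /ucycle /ucycleb rotr_cycle rotr_uniq.
- by move=> u; rewrite -whole -rE mem_rotr mem_rev.
- by rewrite /= map_rcons map_rev x2 y2.
Qed.

(** Two shapes of the 5-face and two ends of the edge give four certificates; the middle of the long
    run of [F1] is the case of [C6_reducible]. *)
Lemma five_pendant f x y z : n3 f = 5 -> B f x y -> three x -> three y ->
  g x z -> ~~ B f x z -> three z.
Proof.
move=> n5 xy x3 y3 xz nxz; have zA : z \in A by apply: (gA (y := x)); rewrite g_sym.
rewrite -[three z]negbK -deg23 //; apply/negP => z2.
have [w' [w [m [wE s6 cc whole fE]]]] := five_orient n5 xy x3 y3.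
(* A 2-vertex on the face has both its edges on the boundary, so the edge to [x] would be one of
   them. *)
have zc : z \notin w' :: rcons m w.
  rewrite whole; apply/negP; rewrite inE => /existsP[u zu].
  have := two_regular_other (face_deg f) zu => -[v zv vu].
  case/negP: nxz; rewrite B_sym.
  suff : x \in [:: u; v] by rewrite !inE => /orP[] /eqP->.
  apply: contraTT z2; rewrite !inE negb_or => /andP[xu xv].
  rewrite /two /deg (cardsD1 u) (cardsD1 v) (cardsD1 x) !inE (Bg zu) (Bg zv) vu xu xv.
  by rewrite (g_sym z) xz.
have sA : {subset rcons (w' :: rcons m w) z <= A}.
  move=> u; rewrite mem_rcons inE => /orP[/eqP-> //|].
  by rewrite whole => /face_vertsA.
have xx : x = w' \/ x = w by case: wE => -[-> ->]; [left|right].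
have ue := Bcycle_e cc.
have xzn : x != z by apply: contraTneq xz => ->; rewrite g_irr.
have exz := ge xz.
case: m s6 cc whole fE zc sA ue => [|a1 [|a2 [|a3 [|a4 [|a5 [|a6 [|]]]]]]] //= _ cc whole fE zc sA ue.
have up : uniq [:: w'; a1; a2; a3; a4; a5; a6; w; z].
  rewrite -[X in uniq X]/(rcons [:: w'; a1; a2; a3; a4; a5; a6; w] z) rcons_uniq.
  by case/andP: ue => _ ->; rewrite andbT.
have kill C na ns d : config_check C na ns d ->
  cycles C = [:: iota 0 8] -> apart C = [:: iota 0 9] ->
  twos C = map two [:: w'; a1; a2; a3; a4; a5; a6; w; z] ->
  all (fun p => upath e (map (nth x [:: w'; a1; a2; a3; a4; a5; a6; w; z]) p)) (paths C) ->
  False.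
  move=> chk cyE apE twE pE.
  have := config_absent (x0 := x) chk sA; rewrite twE cyE apE => /(_ erefl) H.
  by apply: H pE _ => //; rewrite all_seq1; [exact: ue|exact: up].
have fz : map two [:: w'; a1; a2; a3; a4; a5; a6; w; z] =
    rcons (map two [:: w'; a1; a2; a3; a4; a5; a6; w]) true by rewrite -z2.
have pz : upath e [:: x; z] by rewrite /upath /= exz inE xzn.
move: fE; rewrite !inE => /orP[] /eqP fE; case: xx => xE.
- apply: (C6_reducible e_sym e_irr girth8 subcubic (A := A)
    (phi := nth x [:: w'; a1; a2; a3; a4; a5; a6; w; z])) crit.
  have eqT : map two [:: w'; a1; a2; a3; a4; a5; a6; w; z] = twos C6.
    by rewrite fz [map _ _]fE.
  apply/and4P; split.
  + apply/allP => i; rewrite mem_iota => /= ilt.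
    have iA : nth x [:: w'; a1; a2; a3; a4; a5; a6; w; z] i \in A by apply/sA/mem_nth.
    rewrite iA andTb; apply/implyP; change (nth false (twos C6) i -> #|nbrs e A
      (nth x [:: w'; a1; a2; a3; a4; a5; a6; w; z] i)| <= 2).
    by rewrite -eqT (nth_map x) // => /eqP; rewrite degE // => ->.
  + by rewrite /= andbT; exact: ue.
  + by rewrite /= -xE pz.
  + by rewrite /= andbT; exact: up.
- by apply: (kill _ _ _ _ P1_check) => //; [rewrite fz [map _ _]fE|rewrite /= -xE pz].
- by apply: (kill _ _ _ _ P2_check) => //; [rewrite fz [map _ _]fE|rewrite /= -xE pz].
- by apply: (kill _ _ _ _ P3_check) => //; [rewrite fz [map _ _]fE|rewrite /= -xE pz].
Qed.

(** The continuation of [h] at [x] is not on [f], as the two faces would otherwise share two edges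
    at a 3-vertex; so [five_pendant] applies to it. *)
Lemma five_across f h x y z : n3 f = 5 -> f != h -> B f x y -> three x -> three y ->
  B h x y -> B h x z -> three z.
Proof.
move=> n5 fh fxy x3 y3 hxy hxz; have [<- //|yz] := eqVneq y z.
apply: (five_pendant n5 fxy x3 y3 (Bg hxz)); apply/negP => fxz.
by move: yz; rewrite (face_third fh x3 fxy hxy fxz hxz) eqxx.
Qed.

(** By [five_across], [h] has four consecutive 3-vertices, and the remaining four vertices of its
    8-cycle cannot contain three pairwise non-adjacent 2-vertices. *)
Lemma five_five f h x y : n3 f = 5 -> n3 h = 5 -> f != h -> B f x y -> B h x y ->
  three x -> three y -> False.
Proof.
move=> f5 h5 fh fxy hxy x3 y3; have [p [cp sp]] := face_cycle hxy.
have [|nd sz _] := face_flags cp sp; first by rewrite h5.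
have s8 := n3_five_size cp sp h5; have s6 : size p = 6 by case: s8.
have tw u v : B h u v -> three u -> two u = false.
  by move=> uv u3; rewrite deg23 ?u3 // (gA (Bg uv)).
have hyx : B h y x by rewrite B_sym.
have fyx : B f y x by rewrite B_sym.
case: p s6 cp nd sz {sp s8} => [|a1 [|a2 [|a3 [|a4 [|a5 [|a6 [|]]]]]]] // _ cp nd sz.
have /andP[+ _] := cp; rewrite /= => /and5P[_ ya _ _ /and5P[_ _ _ zx _]].
have xz : B h x a6 by rewrite B_sym.
have ta : two a1 = false.
  by apply: (tw _ y); [rewrite B_sym|apply: five_across (f5) fh fyx y3 x3 hyx ya].
have tz : two a6 = false.
  by apply: (tw _ x zx); apply: five_across (f5) fh fxy x3 y3 hxy xz.
move: nd sz; rewrite h5 /= (tw _ _ hxy x3) (tw _ _ hyx y3) ta tz /nand /=.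
by case: (two a2) (two a3) (two a4) (two a5) => [] [] [] [].
Qed.

Lemma adjacent_embeds (w w' : T) m p F0 G0 : size m = 6 -> size p \in [:: 6; 7] ->
  size G0 = size p -> ucycle e (w' :: rcons m w) -> ucycle e (w' :: rcons p w) ->
  head w m != head w p -> last w m != last w p ->
  let s := (w' :: rcons m w) ++ p in let C := adjacent_config F0 G0 in
  size F0 = 8 ->
  all (fun c => ucycleb e (map (nth w s) c)) (cycles C) /\
  all (fun l => uniq (map (nth w s) l)) (apart C).
Proof.
move=> s6 + sG cm cp hn ln s C sF; rewrite /C /adjacent_config /= size_cat sF sG.
rewrite /s {s C}; case: m s6 cm hn ln => [|a1 [|a2 [|a3 [|a4 [|a5 [|a6 [|]]]]]]] // _.
case: p cp {sG} => [|b1 [|b2 [|b3 [|b4 [|b5 [|b6 [|b7 [|]]]]]]]] // cp cm hn ln _;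
  split; rewrite /= ?andbT ?inE //.
- by apply/andP; split; [exact: cm|exact: cp].
- by rewrite hn.
- by apply/andP; split; [exact: cm|exact: cp].
- by rewrite hn.
Qed.

Lemma five_six f h x y : n3 f = 5 -> n3 h = 6 -> f != h -> B f x y -> B h x y ->
  three x -> three y -> False.
Proof.
move=> f5 h6 fh fxy hxy x3 y3.
have [w' [w [m [wE s6 cc whole fE]]]] := five_orient f5 fxy x3 y3.
have [hw w3 w3'] : [/\ B h w w', three w & three w'].
  by case: wE => -[-> ->]; split; rewrite // B_sym.
have fw : B f w w' by case: wE => -[-> ->]; rewrite // B_sym.
have hw' : B h w' w by rewrite B_sym.
have fw' : B f w' w by rewrite B_sym.
have [p [cp sp]] := face_cycle hw.
have [|nd sz le] := face_flags cp sp; first by rewrite h6.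
have tw u v : B h u v -> three u -> two u = false.
  by move=> uv u3; rewrite deg23 ?u3 // (gA (Bg uv)).
have pA : {subset p <= A}.
  by move=> u up; apply: face_vertsA (cycle_face_verts cp _); rewrite !inE up !orbT.
have mA : {subset w' :: rcons m w <= A} by move=> u; rewrite whole => /face_vertsA.
have hfirst a q : p = a :: q -> B h w' a.
  by move=> pE; have /andP[+ _] := cp; rewrite pE /= => /and3P[].
have hlast a q : p = rcons q a -> B h w a.
  move=> pE; have /andP[+ _] := cp; rewrite pE /= => /andP[_].
  by rewrite rcons_path last_rcons B_sym => /andP[].
have ffirst a q : m = a :: q -> B f w' a.
  by move=> pE; have /andP[+ _] := cc; rewrite pE /= => /andP[].
have flast a q : m = rcons q a -> B f w a.
  move=> pE; have /andP[+ _] := cc; rewrite pE /= rcons_path rcons_path last_rcons B_sym.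
  by case/andP => /andP[].
have wm u : u \in m -> u != w /\ u != w'.
  have /andP[_] := cc; rewrite /= rcons_uniq mem_rcons inE negb_or => /and3P[/andP[_ w'm] wm _] um.
  by split; apply: contraTneq um => ->.
(* By [five_across] the path [p] starts and ends with 3-vertices. Its 2-vertices lie singly in the
   three gaps between its four 3-vertices, and its length requires at least two of them: four
   patterns. *)
pose P t := [&& cycle nand (false :: false :: t), (count id t).+4 == size t,
    5 < size t, ~~ head true t & ~~ last true t] ==>
  (t \in [:: flags [:: 0;1;0;1;0;0]; flags [:: 0;1;0;0;1;0]; flags [:: 0;0;1;0;1;0];
    flags [:: 0;1;0;1;0;1;0]]).
have spl : size p <= 10 by move: le; rewrite h6.
have chk : P (map two p).
  have ball k : k <= 10 -> all P (bits k).
    move=> kl; have : all (fun k => all P (bits k)) (iota 0 11) by vm_compute.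
    by move/allP; apply; rewrite mem_iota.
  by apply: (bitsP (ball _ spl)); rewrite size_map.
have head3 : ~~ head true (map two p).
  case: (p) sp hfirst => //= a q _ /(_ a q erefl) wa.
  by rewrite (tw _ w') // 1?B_sym //; apply: five_across (f5) fh fw' w3' w3 hw' wa.
have last3 : ~~ last true (map two p).
  case: (lastP p) sp hlast => // q a _ /(_ a q erefl) wa.
  rewrite map_rcons last_rcons (tw _ w) // 1?B_sym //.
  by apply: five_across (f5) fh fw w3 w3' hw wa.
have w2 : two w = false by apply: (tw _ _ hw).
have w2' : two w' = false by apply: (tw _ _ hw').
apply: (use_imply chk).
  move: nd sz; rewrite h6 /= w2 w2' => nd' sz'; apply/and5P; split=> //.
    by rewrite size_map eqn_leq; move: sz'; rewrite !add0n => -[->]; rewrite leqnn.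
  by rewrite size_map.
have ucc := Bcycle_e cc; have ucp : ucycle e (w' :: rcons p w).
  by have := Bcycle_e cp; rewrite -rcons_cons -rot1_cons /ucycle /ucycleb rot_cycle rot_uniq.
have first_neq a q b r : m = a :: q -> p = b :: r -> a != b.
  move=> mE pE; apply/eqP => ab; subst b.
  have := face_third fh w3' fw' hw' (ffirst _ _ mE) (hfirst _ _ pE) => wa.
  by have [] := wm a; [rewrite mE mem_head|rewrite wa eqxx].
have last_neq a q b r : m = rcons q a -> p = rcons r b -> a != b.
  move=> mE pE; apply/eqP => ab; subst b.
  have := face_third fh w3 fw hw (flast _ _ mE) (hlast _ _ pE) => wa.
  by case: (wm a); rewrite ?mE ?mem_rcons ?mem_head // wa eqxx.
have sA : {subset (w' :: rcons m w) ++ p <= A}.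
  by move=> u; rewrite mem_cat => /orP[/mA|/pA].
have kill F0 G0 na ns d : config_check (adjacent_config F0 G0) na ns d ->
    map two (w' :: rcons m w) = F0 -> map two p = G0 -> size p \in [:: 6; 7] -> False.
  move=> ck f0E g0E sp67; subst F0 G0.
  have eqt : map two ((w' :: rcons m w) ++ p) =
    twos (adjacent_config (map two (w' :: rcons m w)) (map two p)) by rewrite map_cat.
  have [] := adjacent_embeds (F0 := map two (w' :: rcons m w)) s6 sp67 (size_map two p) ucc ucp.
  - case: (m) s6 first_neq => // a q _ /(_ a q); case: (p) sp => // b r _ /(_ b r).
    by move=> H; exact: H.
  - case: (lastP m) s6 last_neq => // q a _ /(_ a q); case: (lastP p) sp => // r b _ /(_ b r).
    by rewrite !last_rcons => H; exact: H.
  - by rewrite size_map /= size_rcons s6.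
  by move=> c1 c2; exact: (config_absent ck sA eqt c1 isT c2).
move: fE; rewrite !inE => /orP[] /eqP fE /or4P[] /eqP gE;
  have s67 : size p \in [:: 6; 7] by rewrite -(size_map two) gE.
- exact: (kill _ _ _ _ _ FG11_check).
- exact: (kill _ _ _ _ _ FG12_check).
- exact: (kill _ _ _ _ _ FG13_check).
- exact: (kill _ _ _ _ _ FG14_check).
- exact: (kill _ _ _ _ _ FG21_check).
- exact: (kill _ _ _ _ _ FG22_check).
- exact: (kill _ _ _ _ _ FG23_check).
- exact: (kill _ _ _ _ _ FG24_check).
Qed.

Lemma five_double f x y u : n3 f = 5 -> B f x y -> B f x u -> y != u ->
  three x -> three y -> two u ->
  exists m, [/\ size m = 5, ucycle (B f) (x :: u :: rcons m y) &
    map two (x :: u :: rcons m y) \in [:: D1; D2a; D2b]].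
Proof.
move=> n5 xy xu yu x3 y3 u2; have [p [cp sp]] := face_cycle xu.
have [|nd sz _] := face_flags cp sp; first by rewrite n5.
have s8 := n3_five_size cp sp n5.
case/lastP: p cp sp nd sz s8 => // m z cp sp nd sz s8.
have zy : z = y.
  have /andP[+ /andP[_ uu]] := cp; rewrite /= rcons_path last_rcons => /and3P[_ _ zx].
  have xz : B f x z by rewrite B_sym.
  have [//|zu] := two_regular_nbrs (face_deg f) xy xu xz yu.
  by move: uu; rewrite zu /= mem_rcons mem_head.
subst z; have s5 : size m = 5 by move: s8; rewrite /= size_rcons => -[].
exists m; split=> //.
have x2 : two x = false by rewrite deg23 ?x3 ?(gA (Bg xy)).
have y2 : two y = false by rewrite deg23 ?y3 // (gA (y := x)) // g_sym (Bg xy).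
pose P t := (cycle nand [:: false, true & rcons t false] && (count id t == 2)) ==>
  ([:: false, true & rcons t false] \in [:: D1; D2a; D2b]).
have chk : P (map two m) by apply: (@bitsP P 5); [vm_compute|rewrite size_map].
move: nd sz; rewrite s8 n5 /= map_rcons x2 u2 y2 => nd sz.
apply: (use_imply chk) => //; apply/andP; split; first exact: nd.
by move: sz; rewrite -cats1 count_cat /= !addn0; case: (count _ _) => [|[|[|]]].
Qed.

Lemma double_embeds (x u a y y' : T) m1 m2 F0 G0 : size m1 = 4 -> size m2 = 4 ->
  ucycle e [:: x, u, a & rcons m1 y] -> ucycle e (rot 2 [:: x, u, a & rcons m2 y']) ->
  y != y' -> head x m1 != head x m2 ->
  let s := [:: x, u, a & rcons m1 y] ++ rcons m2 y' in let C := double_config F0 G0 in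
  all (fun c => ucycleb e (map (nth x s) c)) (cycles C) /\
  all (fun l => uniq (map (nth x s) l)) (apart C).
Proof.
case: m1 => [|b1 [|b2 [|b3 [|b4 [|]]]]] //; case: m2 => [|d1 [|d2 [|d3 [|d4 [|]]]]] //.
move=> _ _ u1 u2 yy' hd; split; rewrite /= ?andbT.
  by apply/andP; split; [exact: u1|exact: u2].
by rewrite !inE hd.
Qed.

Section Double.
Variables (f h : F) (x u a y y' : T) (m1 m2 : seq T).
Let c1 := [:: x, u, a & rcons m1 y].
Let c2 := [:: x, u, a & rcons m2 y'].
Hypotheses (cc1 : ucycle (B f) c1) (cc2 : ucycle (B h) c2).
Hypotheses (s1 : size m1 = 4) (s2 : size m2 = 4) (yy' : y != y').
Hypothesis hd : head x m1 != head x m2.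

Let c1A : {subset c1 <= A}.
Proof. by move=> v vc; apply: face_vertsA (cycle_face_verts cc1 vc). Qed.
Let c2A : {subset c2 <= A}.
Proof. by move=> v vc; apply: face_vertsA (cycle_face_verts cc2 vc). Qed.

Lemma double_absent F1 F2 na ns d : config_check (double_config F1 (drop 3 F2)) na ns d ->
  map two c1 = F1 -> map two c2 = F2 -> False.
Proof.
move=> ck f1E f2E; subst F1 F2.
have sA : {subset c1 ++ rcons m2 y' <= A}.
  move=> v; rewrite mem_cat => /orP[/c1A //|vm]; apply: c2A.
  by rewrite !inE vm !orbT.
have eqt : map two (c1 ++ rcons m2 y') =
    twos (double_config (map two c1) (drop 3 (map two c2))) by rewrite map_cat /= drop0.
have u1 := Bcycle_e cc1; have u2 : ucycle e (rot 2 c2).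
  by have := Bcycle_e cc2; rewrite /ucycle /ucycleb rot_cycle rot_uniq.
have [h1 h2] := double_embeds (map two c1) (drop 3 (map two c2)) s1 s2 u1 u2 yy' hd.
exact: (config_absent ck sA eqt h1 isT h2).
Qed.

(** In [D1] the vertex [a] has a 2-vertex on either side; a third one on the other face completes
    the configuration of [T1_check]. *)
Lemma T1_absent : map two c1 = D1 -> two (head x m2) -> False.
Proof.
move=> f1E t2; have e1 := Bcycle_e cc1; have e2 := Bcycle_e cc2; move: (c1A) (c2A).
move: f1E e1 e2; rewrite /c1 /c2; case: m1 s1 hd => [|b1 [|b2 [|b3 [|b4 [|]]]]] // _.
case: m2 s2 t2 => [|d1 [|d2 [|d3 [|d4 [|]]]]] // _ /= t2 n1 [_ u2 a2 t1 t12 t3 _ _].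
case/andP => [/= /and5P[_ ua ab1 b12 /andP[b23 _]] up1].
case/andP => [/= /and5P[_ _ ad1 _ _] up2] sA1 sA2.
move: up1 up2; rewrite !inE !negb_or -!andbA => up1 up2.
apply: (config_absent (s := [:: u; d1; a; b1; b2; b3]) (x0 := x) T1_check) => //=.
- move=> v; rewrite !inE => /or4P[/eqP->|/eqP->|/eqP->|/or3P[] /eqP->];
  by [apply: sA2; rewrite !inE eqxx ?orbT|apply: sA1; rewrite !inE eqxx ?orbT].
- by rewrite u2 t2 a2 t1 t12 t3.
- rewrite /upath /= ua ab1 b12 b23 !inE (e_sym d1) ad1 !andbT /= !negb_or.
  move: up1 up2; do ! (case/andP => ?); move=> ?; do ! (case/andP => ?); move=> ?.
  by apply/andP; split; repeat (apply/andP; split => //); rewrite // eq_sym.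
- have ud : u != d1.
    by apply: contraTneq up2 => ->; rewrite eqxx /= !andbF.
  by rewrite !inE !negb_or ud (eq_sym d1) n1 !andbT; move: up1; do ! case/andP => _ //.
Qed.

End Double.

(** For distinct [y] and [y'], the third edge [xu] at [x] lies on both 5-faces. If [u] is a
    3-vertex, [five_five] applies. Otherwise both faces pass through [u] to the same vertex [a], and
    nine combinations of shapes remain. *)
Lemma special_matching f h k x y y' : n3 f = 5 -> n3 h = 5 -> f != k -> h != k ->
  B k x y -> B f x y -> B k x y' -> B h x y' -> three x -> three y -> three y' -> y = y'.
Proof.
move=> f5 h5 fk hk kxy fxy kxy' hxy' x3 y3 y3'; apply/eqP/negPn/negP => yy'.
have fh : f != h.
  apply: contraNneq yy' => E; subst h.
  by rewrite (face_third fk x3 fxy kxy hxy' kxy').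
have [u fu uy] := two_regular_other (face_deg f) fxy.
have [u' hu uy'] := two_regular_other (face_deg h) hxy'.
have uny' : u != y'.
  apply: contraNneq yy' => E; subst u.
  by rewrite (face_third fk x3 fxy kxy fu kxy').
have u'ny : u' != y.
  apply: contraNneq yy' => E; subst u'.
  by rewrite (face_third hk x3 hu kxy hxy' kxy').
have uu' : u' = u.
  apply/eqP/negPn/negP => n; move: x3.
  rewrite /three /deg (cardsD1 y) (cardsD1 y') (cardsD1 u) (cardsD1 u') !inE.
  by rewrite (Bg fxy) (Bg kxy') (Bg fu) (Bg hu) n uy' u'ny uny' uy (eq_sym y') yy'.
subst u'.
have uA : u \in A by apply: (gA (y := x)); rewrite g_sym (Bg fu).
have u2 : two u.
  rewrite deg23 //; apply/negP => u3; exact: five_five f5 h5 fh fu hu x3 u3.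
have yu : y != u by rewrite eq_sym.
have y'u : y' != u by rewrite eq_sym.
have [m1 [s1 cc1 f1]] := five_double f5 fxy fu yu x3 y3 u2.
have [m2 [s2 cc2 f2]] := five_double h5 hxy' hu y'u x3 y3' u2.
case: m1 s1 cc1 f1 => // a m1 [s1] cc1 f1; case: m2 s2 cc2 f2 => // a' m2 [s2] cc2 f2.
have fua : B f u a by move: cc1; rewrite /ucycle /ucycleb /= => /andP[/and3P[]].
have hua' : B h u a' by move: cc2; rewrite /ucycle /ucycleb /= => /andP[/and3P[]].
have ax : a != x.
  have /andP[_] := cc1; rewrite /= !inE !negb_or -!andbA => /and3P[_ + _].
  by rewrite eq_sym.
have ax' : a' != x.
  have /andP[_] := cc2; rewrite /= !inE !negb_or -!andbA => /and3P[_ + _].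
  by rewrite eq_sym.
have aa : a' = a.
  apply/eqP/negPn/negP => n; move: u2.
  rewrite /two /deg (cardsD1 x) (cardsD1 a) (cardsD1 a') !inE.
  by rewrite (Bg fua) (Bg hua') g_sym (Bg fu) n ax ax'.
subst a'.
have hd : head x m1 != head x m2.
  case: m1 s1 cc1 {f1} => // b m1 _ cc1; case: m2 s2 cc2 {f2} => // b' m2 _ cc2 /=.
  apply/negP => /eqP E; subst b'.
  have fab : B f a b by move: cc1; rewrite /ucycle /ucycleb /= => /andP[/and4P[]].
  have hab : B h a b by move: cc2; rewrite /ucycle /ucycleb /= => /andP[/and4P[]].
  have a3 : three a.
    by apply: (two_two (x := u)) u2; exact: Bg fua.
  have fau : B f a u by rewrite B_sym.
  have hau : B h a u by rewrite B_sym.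
  have ub := face_third fh a3 fau hau fab hab.
  by have /andP[_] := cc1; rewrite /= ub !inE eqxx !orbT !andbF.
have y'y : y' != y by rewrite eq_sym.
have hd' : head x m2 != head x m1 by rewrite eq_sym.
have tw3 m z D : size m = 4 -> map two [:: x, u, a & rcons m z] = D ->
  two (head x m) = nth false D 3.
  by case: m => // b m _ <-.
move: f1 f2; rewrite !inE => /or3P[] /eqP f1 /or3P[] /eqP f2.
- by apply: (T1_absent cc1 cc2 s1 s2 hd f1); rewrite (tw3 _ _ _ s2 f2).
- exact: (double_absent cc1 cc2 s1 s2 yy' hd FF1_check f1 f2).
- by apply: (T1_absent cc1 cc2 s1 s2 hd f1); rewrite (tw3 _ _ _ s2 f2).
- exact: (double_absent cc2 cc1 s2 s1 y'y hd' FF1_check f2 f1).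
- exact: (double_absent cc1 cc2 s1 s2 yy' hd FF2_check f1 f2).
- exact: (double_absent cc1 cc2 s1 s2 yy' hd FF3_check f1 f2).
- by apply: (T1_absent cc2 cc1 s2 s1 hd' f2); rewrite (tw3 _ _ _ s1 f1).
- exact: (double_absent cc2 cc1 s2 s1 y'y hd' FF3_check f2 f1).
- exact: (double_absent cc1 cc2 s1 s2 yy' hd FF4_check f1 f2).
Qed.

(* [special k] is a relation on darts: an edge giving charge from [k] to a 5-face
   is counted twice. *)
Definition special k x y :=
  [&& B k x y, three x, three y & [exists f, [&& f != k, n3 f == 5 & B f x y]]].
Let s2 k := #|[set p : T * T | special k p.1 p.2]|.

Lemma special_sym k : symmetric (special k).
Proof.
move=> x y; rewrite /special B_sym; congr (_ && _); rewrite andbCA; do 2 congr (_ && _).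
by apply: eq_existsb => f; rewrite B_sym.
Qed.

Lemma special_inj k x y y' : special k x y -> special k x y' -> y = y'.
Proof.
move=> /and4P[kxy x3 y3 /existsP[f /and3P[fk /eqP f5 fxy]]].
move=> /and4P[kxy' _ y3' /existsP[h /and3P[hk /eqP h5 hxy']]].
exact: (special_matching f5 h5 fk hk kxy fxy kxy' hxy').
Qed.

Let ends k := [set x | [exists y, special k x y]].

(** Special edges form a matching, so their darts are counted by their tails. *)
Lemma card_ends k : #|ends k| = s2 k.
Proof.
rewrite /s2 -(card_in_imset (f := fst) (D := mem [set p : T * T | special k p.1 p.2])); last first.
  by move=> [x y] [x' y']; rewrite !inE /= => xy xy' E; subst x'; rewrite (special_inj xy xy').
apply: eq_card => x; rewrite inE; apply/existsP/imsetP => [[y xy]|[[x' y]]].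
  by exists (x, y); rewrite ?inE.
by rewrite inE /= => xy ->; exists y.
Qed.

Lemma ends_three k x : x \in ends k -> x \in [set x in face_verts k | three x].
Proof.
by rewrite !inE => /existsP[y /and4P[xy -> _ _]]; rewrite andbT; apply/existsP; exists y.
Qed.

Lemma ends_across k x z : x \in ends k -> B k x z -> three z.
Proof.
rewrite inE => /existsP[y /and4P[kxy x3 y3 /existsP[f /and3P[fk /eqP f5 fxy]]]].
exact: five_across f5 fk fxy x3 y3 kxy.
Qed.

(** A boundary with seven 3-vertices and length at least 8 contains a 2-vertex. By [five_across] its
    two neighbours are not ends of special edges, which leaves at most five ends; their number is
    even. *)
Lemma seven_special k x : x \in face_verts k -> n3 k = 7 -> s2 k <= 4.
Proof.
move=> + n7; rewrite inE => /existsP[y /face_cycle[p [cp sp]]].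
have s2_even : ~~ odd (s2 k).
  apply: even_symmetric; first exact: special_sym.
  by move=> z; rewrite /special B_irr.
rewrite leqNgt; apply/negP => gt4.
have gt5 : 5 < s2 k by move: s2_even gt4; case: (s2 k) => [|[|[|[|[|[|n]]]]]].
have [|nd sz _] := face_flags cp sp; first by rewrite n7.
have /hasP[v vc v2] : has two (x :: y :: p).
  have : 7 < size [:: x, y & p] by exact: sp.
  by rewrite sz n7 -[X in X < _]addn0 ltn_add2l count_map has_count.
have : v \in face_verts k by exact: cycle_face_verts cp _ vc.
rewrite inE => /existsP[z1 vz1]; have [z2 vz2 z21] := two_regular_other (face_deg k) vz1.
have v3 : three v = false.
  by apply/negbTE; rewrite -deg23 // (gA (Bg vz1)).
have out z : B k v z -> z \in [set z in face_verts k | three z] :\: ends k.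
  move=> vz; rewrite in_setD inE (two_two (Bg vz) v2) andbT; apply/andP; split.
    apply/negP => ze; have zv : B k z v by rewrite B_sym.
    by have := ends_across ze zv; rewrite v3.
  by rewrite inE; apply/existsP; exists v; rewrite B_sym.
have : 1 < #|[set z in face_verts k | three z] :\: ends k|.
  by rewrite (cardsD1 z1) (cardsD1 z2) !in_setD1 z21 !out.
rewrite cardsD (setIidPr _) ?card_ends; last by apply/subsetP => z; exact: ends_three.
rewrite -/(n3 k) n7; lia.
Qed.

(** The charge [n3 - 6] multiplied by 4. The 1/2 carried by an edge becomes one unit per dart, and a
    5-face receives 4 units over two edges. From [n3 = 8] on, the matching bound [s2 k <= n3 k] is
    enough. *)
Lemma face_charge k x : x \in face_verts k -> 24 + s2 k <= 4 * n3 k + 4 * (n3 k == 5).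
Proof.
move=> xk; have ge4 := n3_ge4 xk.
have ne4 : n3 k != 4.
  by move: xk; rewrite inE => /existsP[y /face_cycle[p [cp sp]]]; exact: n3_neq4 cp sp.
have none : (forall y z, ~ special k y z) -> s2 k = 0.
  move=> no; apply/eqP; rewrite cards_eq0; apply/eqP/setP => -[y z]; rewrite !inE.
  by apply/negP => /no.
have [n5|n5] := eqVneq (n3 k) 5.
  rewrite none ?n5 // => y z /and4P[kyz y3 z3 /existsP[f /and3P[fk /eqP f5 fyz]]].
  exact: five_five f5 n5 fk fyz kyz y3 z3.
have [n6|n6] := eqVneq (n3 k) 6.
  rewrite none ?n6 // => y z /and4P[kyz y3 z3 /existsP[f /and3P[fk /eqP f5 fyz]]].
  exact: five_six f5 n6 fk fyz kyz y3 z3.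
have [n7|n7] := eqVneq (n3 k) 7.
  by have := seven_special xk n7; rewrite n7; lia.
have : s2 k <= n3 k.
  by rewrite -card_ends; apply/subset_leq_card/subsetP => z; exact: ends_three.
lia.
Qed.

(** Ten boundary darts start at the five 3-vertices and at most six of them end at the three
    2-vertices; the other four are the two edges between 3-vertices. *)
Lemma five_special f : n3 f = 5 ->
  4 <= #|[set p : T * T | [&& B f p.1 p.2, three p.1 & three p.2]]|.
Proof.
move=> n5.
have [x xV] : exists x, x \in face_verts f.
  have /card_gt0P[x] : 0 < n3 f by rewrite n5.
  by rewrite inE => /andP[xV _]; exists x.
move: (xV); rewrite inE => /existsP[y /face_cycle[p [cp sp]]].
have [|whole _] := face_whole cp sp; first by rewrite n5.
have s8 := n3_five_size cp sp n5.
have V8 : #|face_verts f| = 8.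
  by rewrite -(eq_card whole) (card_uniqP _) //; case/andP: cp.
have dart (P : pred T) : #|[set p : T * T | B f p.1 p.2 && P p.1]| =
    2 * #|[set x in face_verts f | P x]|.
  rewrite (card_darts (fun x y => B f x y && P x)) mulnC -sum_nat_const [RHS]big_mkcond /=.
  apply: eq_bigr => z _; rewrite in_set; case: (P z); last first.
    by rewrite andbF; apply/eqP; rewrite cards_eq0; apply/eqP/setP => w; rewrite !inE andbF.
  rewrite andbT; under eq_finset do rewrite andbT.
  have [|zV] := boolP (z \in face_verts f).
    rewrite inE => /existsP[w zw]; have := face_deg f z.
    by rewrite (cardsD1 w) inE zw !inE /= => /eqP.
  apply/eqP; rewrite cards_eq0; apply/eqP/setP => w; rewrite !inE.
  by apply: contraNF zV => zw; rewrite inE; apply/existsP; exists w.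
have three5 := dart three; rewrite -/(n3 f) n5 in three5.
have two3 : #|[set x in face_verts f | two x]| = 3.
  have := cardsID [set x | three x] (face_verts f).
  rewrite V8 (_ : face_verts f :&: _ = [set x in face_verts f | three x]); last first.
    by apply/setP => z; rewrite !inE.
  rewrite (_ : face_verts f :\: _ = [set x in face_verts f | two x]); last first.
    apply/setP => z; rewrite in_setD [in RHS]in_set in_set andbC.
    by case: (boolP (z \in face_verts f)) => // /face_vertsA zA; rewrite deg23.
  by rewrite -/(n3 f) n5; lia.
have := dart two; rewrite two3 => two6.
set G := [set p : T * T | _].
pose sw (p : T * T) := (p.2, p.1).
have : [set p : T * T | B f p.1 p.2 && three p.1] \subset
    G :|: sw @: [set p : T * T | B f p.1 p.2 && two p.1].
  apply/subsetP => -[a b]; rewrite !inE /= => /andP[ab ->]; rewrite ab /=.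
  have [//|b3] := boolP (three b).
  apply/imsetP; exists (b, a) => //; rewrite inE /= B_sym ab deg23 //.
  by apply: (gA (y := a)); rewrite g_sym (Bg ab).
move/subset_leq_card; rewrite three5 => /leq_trans/(_ (leq_card_setU _ _)).
have := leq_imset_card sw [set p : T * T | B f p.1 p.2 && two p.1]; rewrite two6; lia.
Qed.

Let N := [set fl p.1 p.2 | p : T * T & g p.1 p.2].

Lemma faceN f x y : B f x y -> f \in N.
Proof.
move=> /andP[xy /orP[/eqP<-|/eqP<-]]; apply/imsetP; first by exists (x, y); rewrite ?inE.
by exists (y, x); rewrite ?inE //= g_sym.
Qed.

(** Double counting: each face at [x] takes two of the three edges, and an edge lies on at most two
    faces. *)
Lemma faces_at x : three x -> #|[set f | x \in face_verts f]| <= 3.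
Proof.
move=> x3; rewrite -(leq_pmul2l (isT : 0 < 2)) mulnC -sum_nat_const.
apply: leq_trans (_ : \sum_(f | x \in face_verts f) #|[set y | B f x y]| <= _).
  rewrite (eq_bigl (fun f => x \in face_verts f)); last by move=> f; rewrite inE.
  apply: leq_sum => f; rewrite inE => /existsP[y xy].
  have : 0 < #|[set y | B f x y]| by apply/card_gt0P; exists y; rewrite inE.
  by have := face_deg f x; rewrite !in_cons in_nil orbF => /orP[] /eqP->.
apply: leq_trans (_ : \sum_f #|[set y | B f x y]| <= _).
  by rewrite [leqRHS](bigID (fun f => x \in face_verts f)) leq_addr.
under eq_bigr => f _ do rewrite -sum1dep_card big_mkcond.
rewrite exchange_big /=.
apply: leq_trans (_ : \sum_(y | g x y) 2 <= _); last first.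
  by rewrite sum_nat_const mulnC -cardsE -/(deg x) (eqP x3).
rewrite [leqRHS]big_mkcond; apply: leq_sum => y _; rewrite -big_mkcond sum1dep_card.
case: ifP => xy; last first.
  by rewrite leqn0 cards_eq0; apply/eqP/setP => f; rewrite !inE /B /face_rel xy.
apply: leq_trans (_ : #|[set fl x y; fl y x]| <= _); last by rewrite cards2; case: eqP.
apply/subset_leq_card/subsetP => f; rewrite !inE => /andP[_].
by rewrite eq_sym (eq_sym f (fl y x)).
Qed.

Lemma discharge : False.
Proof.
pose V := [set x | 0 < #|[set y | g x y]|].
pose n := #|[set x | three x]|.
have VA x : (x \in V) = (x \in A).
  rewrite inE; apply/card_gt0P/idP => [[y]|xA]; first by rewrite inE => /gA.
  have := critical_deg_ge2 e_sym e_irr girth8 subcubic crit xA; rewrite -degE //.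
  by move/ltnW/card_gt0P.
have V0 : V != set0.
  apply/eqP => V0; case: crit => ncol _; apply: ncol; exists (fun _ => ord0) => x y.
  by rewrite /sq -VA V0 inE.
have := euler_count g_sym g_irr potential V0; rewrite -/V -/N card_darts.
have -> : \sum_x #|[set y | g x y]| = 2 * #|V| + n.
  have sb (P : {set T}) : \sum_x (x \in P) = #|P|.
    by rewrite -sum1_card [RHS]big_mkcond; apply: eq_bigr => x _; case: (x \in P).
  rewrite /n -(sb V) -(sb [set x | three x]) big_distrr -big_split; apply: eq_bigr => x _; rewrite VA inE -/(deg x).
  have [xA|xA] := boolP (x \in A).
    by have := deg23 xA; rewrite /two /three; case: eqP => [->|_ /esym/negbFE/eqP->].
  have d0 : deg x = 0.
    by apply/eqP; rewrite cards_eq0; apply/eqP/setP => y; rewrite !inE /g (negbTE xA).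
  by rewrite /three d0.
(* As all degrees are 2 or 3, the Euler inequality now reads [n + 2 <= 2 * #|N|]. *)
suff : 24 * #|N| <= 12 * n by lia.
pose five := [set f | n3 f == 5].
have n3V f : 0 < n3 f -> exists x, x \in face_verts f.
  by move=> /card_gt0P[x]; rewrite inE => /andP[xV _]; exists x.
have sN : \sum_(f in N) s2 f >= 4 * #|five|.
  apply: leq_trans (_ : \sum_f s2 f <= _); last first.
    rewrite (bigID (mem N)) /= [X in _ + X]big1 ?addn0 // => f fN.
    apply/eqP; rewrite cards_eq0; apply/eqP/setP => p; rewrite !inE.
    by apply: contraNF fN => /and4P[/faceN].
  apply: leq_trans (_ : \sum_(f in five) #|[set p : T * T |
      [&& B f p.1 p.2, three p.1 & three p.2]]| <= _).
    rewrite mulnC -sum_nat_const; apply: leq_sum => f; rewrite inE => /eqP.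
    exact: five_special.
  under eq_bigr => f _ do rewrite -sum1dep_card big_mkcond.
  rewrite exchange_big /= /s2.
  under [leqRHS]eq_bigr => f _ do rewrite -sum1dep_card big_mkcond.
  rewrite [leqRHS]exchange_big /=; apply: leq_sum => -[x y] _.
  rewrite -!big_mkcond -big_mkcondr /= !sum1dep_card.
  (* For a fixed dart, a 5-face on one side is paid by the face on the other side, and this
     correspondence is injective. *)
  rewrite -(card_in_imset (f := fun f => other f x y)); last first.
    move=> f h; rewrite !inE => /andP[_ /and3P[fxy _ _]] /andP[_ /and3P[hxy _ _]] E.
    apply/eqP/negPn/negP => fh.
    have [_] := otherP hxy; rewrite -E -(other_uniq fxy hxy) ?eqxx // eq_sym //.
  apply/subset_leq_card/subsetP => _ /imsetP[f + ->].
  rewrite !inE => /andP[f5 /and3P[fxy x3 y3]].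
  have [oxy oth] := otherP fxy; rewrite /special oxy x3 y3 /=.
  by apply/existsP; exists f; rewrite eq_sym oth f5.
have sn3 : \sum_(f in N) n3 f <= 3 * n.
  apply: leq_trans (_ : \sum_f n3 f <= _).
    by rewrite [leqRHS](bigID (mem N)) leq_addr.
  rewrite /n3; under eq_bigr => f _ do rewrite -sum1dep_card big_mkcond.
  rewrite exchange_big /= mulnC -sum_nat_const [leqRHS]big_mkcond /=.
  apply: leq_sum => x _; rewrite inE; case: ifP => x3; last first.
    by rewrite big1 // => f _; rewrite andbF.
  under eq_bigr => f _ do rewrite andbT.
  by rewrite -big_mkcond sum1dep_card faces_at.
have sum5 : \sum_(f in N) (n3 f == 5) <= #|five|.
  rewrite -sum1_card [leqRHS](eq_bigl (fun f => n3 f == 5)); last by move=> f; rewrite inE.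
  rewrite [leqRHS]big_mkcond; apply: leq_trans (_ : \sum_f (n3 f == 5) <= _).
    by rewrite [leqRHS](bigID (mem N)) leq_addr.
  by apply: leq_sum => f _; case: eqP.
have : \sum_(f in N) (24 + s2 f) <= \sum_(f in N) (4 * n3 f + 4 * (n3 f == 5)).
  apply: leq_sum => f /imsetP[[x y]]; rewrite inE /= => xy fE.
  apply: (face_charge (x := x)); rewrite inE; apply/existsP; exists y.
  by rewrite /B /face_rel xy fE eqxx.
have distr (k : F -> nat) : \sum_(f in N) 4 * k f = 4 * \sum_(f in N) k f by rewrite big_distrr.
rewrite big_split [leqRHS]big_split sum_nat_const !distr => h.
have arith m a b c d : m * 24 + a <= 4 * b + 4 * c -> 4 * d <= a -> b <= 3 * n -> c <= d ->
  24 * m <= 12 * n by clear; lia.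
exact: arith h sN sn3 sum5.
Qed.

End Face.

(** * Faces of minors of the grid *)

(** [fl x y] and [fl y x] stand for the two faces along the edge [xy], without a convention for left
    and right. The two conditions are exactly what the discharging argument receives from the
    plane. *)
Definition has_faces (T : finType) (g : rel T) :=
  exists (F : finType) (fl : T -> T -> F),
    (forall f x, ~~ odd #|[set y | g x y && ((fl x y == f) (+) (fl y x == f))]|) /\
    (forall c : rel T, symmetric c -> subrel c g ->
      (forall x, ~~ odd #|[set y | c x y]|) ->
      exists h : F -> bool, forall x y, g x y -> c x y = h (fl x y) (+) h (fl y x)).

Section Grid.

Variable m : nat.
Let P := ('I_m.+1 * 'I_m.+1)%type.

Definition upward (p q : P) := (q.1 == p.1) && (q.2 == p.2.+1 :> nat).
Definition rightward (p q : P) := (q.1 == p.1.+1 :> nat) && (q.2 == p.2).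
Definition adj p q := [|| upward p q, upward q p, rightward p q | rightward q p].
(** Off the rim all four edges and squares at a vertex exist, and [inord] in [gfl] stays within its
    range. *)
Definition inner (p : P) := [&& 0 < p.1, p.1 < m, 0 < p.2 & p.2 < m].

(* The unit square to one side of the edge from [p] to [q], named after its
   upper right corner. *)
Definition gfl (p q : P) : P :=
  if upward p q || rightward p q then (inord p.1.+1, inord p.2.+1) else p.

Let pt a b : P := (inord a, inord b).

Lemma adj_sym : symmetric adj.
Proof.
by move=> p q; rewrite /adj; case: (upward p q) (upward q p) (rightward p q) (rightward q p) => [] [] [] [].
Qed.

Lemma adj_irr : irreflexive adj.
Proof. by case=> a b; rewrite /adj /upward /rightward /= -!val_eqE /=; lia. Qed.

Let ptK (p : P) : pt p.1 p.2 = p.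
Proof. by case: p => a b; rewrite /pt !inord_val. Qed.

Let pt1 a b : a <= m -> (pt a b).1 = a :> nat. Proof. by move=> ?; rewrite inordK. Qed.
Let pt2 a b : b <= m -> (pt a b).2 = b :> nat. Proof. by move=> ?; rewrite inordK. Qed.

Let pt_eq (p : P) a b : a <= m -> b <= m -> (p == pt a b) = (p.1 == a :> nat) && (p.2 == b :> nat).
Proof.
move=> am bm; case: p => i j; rewrite /pt xpair_eqE /=.
by rewrite -!val_eqE /= !inordK.
Qed.

Lemma grid_degree (c : rel P) a b : (forall p q, c p q -> adj p q) ->
  0 < a < m -> 0 < b < m ->
  odd #|[set q | c (pt a b) q]| =
    c (pt a b) (pt a.+1 b) (+) c (pt a b) (pt a b.+1)
    (+) c (pt a b) (pt a.-1 b) (+) c (pt a b) (pt a b.-1).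
Proof.
move=> cadj /andP[a0 am] /andP[b0 bm]; set p := pt a b.
have -> : #|[set q | c p q]| = \sum_q c p q.
  by rewrite -sum1dep_card big_mkcond; apply: eq_bigr => q _; case: (c p q).
have d1 : pt a b.+1 != pt a.+1 b.
  by rewrite pt_eq ?pt1 ?pt2 //; lia.
have d2 : (pt a.-1 b != pt a.+1 b) && (pt a.-1 b != pt a b.+1).
  by rewrite !pt_eq ?pt1 ?pt2 //; lia.
have d3 : [&& pt a b.-1 != pt a.+1 b, pt a b.-1 != pt a b.+1 & pt a b.-1 != pt a.-1 b].
  by rewrite !pt_eq ?pt1 ?pt2 //; lia.
rewrite (bigD1 (pt a.+1 b)) // (bigD1 (pt a b.+1)) ?andTb //.
rewrite (bigD1 (pt a.-1 b)); last by rewrite andTb.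
rewrite (bigD1 (pt a b.-1)); last by rewrite andTb -andbA.
rewrite /= big1 ?addn0 ?oddD ?oddb ?addbA //.
move=> q /andP[/andP[/andP[q1 q2] q3] q4]; case E: (c p q) => //; exfalso.
move/cadj: E q1 q2 q3 q4; rewrite !pt_eq; try lia.
by rewrite /adj /upward /rightward /p -!val_eqE /= !inordK; lia.
Qed.

Lemma innerP p : inner p -> exists a b, [/\ p = pt a b, 0 < a < m & 0 < b < m].
Proof. by move=> /and4P[p1 p2 p3 p4]; exists p.1, p.2; rewrite ptK p1 p2 p3. Qed.

Lemma gfl_up a b : 0 < a < m -> 0 < b < m ->
  (gfl (pt a b) (pt a b.+1) = pt a.+1 b.+1) * (gfl (pt a b.+1) (pt a b) = pt a b.+1).
Proof.
move=> ha hb; split; rewrite /gfl /upward /rightward -!val_eqE /= ?inordK ?eqxx //; try lia.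
by rewrite ifN //; lia.
Qed.

Lemma gfl_right a b : 0 < a < m -> 0 < b < m ->
  (gfl (pt a b) (pt a.+1 b) = pt a.+1 b.+1) * (gfl (pt a.+1 b) (pt a b) = pt a.+1 b).
Proof.
move=> ha hb; split; rewrite /gfl /upward /rightward -!val_eqE /= ?inordK ?eqxx ?orbT //; try lia.
by rewrite ifN //; lia.
Qed.

Lemma adj_up a b : a <= m -> b < m -> adj (pt a b) (pt a b.+1).
Proof. by move=> am bm; rewrite /adj /upward -!val_eqE /= ?inordK ?eqxx //; lia. Qed.

Lemma adj_right a b : a < m -> b <= m -> adj (pt a b) (pt a.+1 b).
Proof. by move=> am bm; rewrite /adj /rightward -!val_eqE /= ?inordK ?eqxx ?orbT //; lia. Qed.

Lemma gflE a b : 0 < a < m -> 0 < b < m ->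
  [/\ gfl (pt a b) (pt a.-1 b) = pt a b, gfl (pt a.-1 b) (pt a b) = pt a b.+1,
      gfl (pt a b) (pt a b.-1) = pt a b & gfl (pt a b.-1) (pt a b) = pt a.+1 b].
Proof.
move=> ha hb; split; rewrite /gfl /upward /rightward -!val_eqE /= ?inordK //; try lia.
- by rewrite ifN //; lia.
- by rewrite ifT; [congr pt; lia|lia].
- by rewrite ifN //; lia.
- by rewrite ifT; [congr pt; lia|lia].
Qed.

(** Going around the vertex, each of the four squares enters two of the four differences. *)
Lemma grid_even (S : pred P) p : inner p ->
  ~~ odd #|[set q | adj p q && (S (gfl p q) (+) S (gfl q p))]|.
Proof.
move=> /innerP[a [b [-> ha hb]]].
have /= -> := @grid_degree (fun p q => adj p q && (S (gfl p q) (+) S (gfl q p))) a b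
  (fun u v uv => proj1 (andP uv)) ha hb.
have [l1 l2 l3 l4] := gflE ha hb.
have la : adj (pt a b) (pt a.-1 b).
  by rewrite adj_sym; have := @adj_right a.-1 b; rewrite prednK; [apply; lia|lia].
have lb : adj (pt a b) (pt a b.-1).
  by rewrite adj_sym; have := @adj_up a b.-1; rewrite prednK; [apply; lia|lia].
rewrite la lb adj_right ?adj_up; try lia.
rewrite !gfl_up ?gfl_right // l1 l2 l3 l4 /=.
by do 4 case: (S _).
Qed.

(** A discrete ray argument: [h] is the parity of the vertical edges of [c] to the left of a square
    in its row. Crossing a vertical edge changes it by that edge; for a horizontal edge, evenness at
    the vertices to its left makes the difference of the two rows telescope. *)
Lemma grid_potential (c : rel P) : symmetric c ->
  (forall p q, c p q -> adj p q && inner p) ->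
  (forall p, inner p -> ~~ odd #|[set q | c p q]|) ->
  exists h : P -> bool, forall p q, inner p -> inner q -> adj p q ->
    c p q = h (gfl p q) (+) h (gfl q p).
Proof.
move=> c_sym cin cev.
have cadj p q : c p q -> adj p q by move=> /cin/andP[].
pose cv a b := c (pt a b) (pt a b.+1); pose ch a b := c (pt a b) (pt a.+1 b).
have out a b (q : P) : a <= m -> b <= m -> ~~ ((0 < a < m) && (0 < b < m)) -> c (pt a b) q = false.
  move=> am bm; apply: contraNF => /cin/andP[_]; rewrite /inner /= !inordK //.
  by case/and4P=> -> -> -> ->.
pose h (s : P) := \big[addb/false]_(0 <= a < s.1) cv a (s.2 : nat).-1.
have hE a b : a <= m -> b <= m -> h (pt a b) = \big[addb/false]_(0 <= i < a) cv i b.-1.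
  by move=> am bm; rewrite /h pt1 ?pt2.
have tele b k : 0 < b < m -> k < m ->
    \big[addb/false]_(0 <= i < k.+1) cv i b (+) \big[addb/false]_(0 <= i < k.+1) cv i b.-1
      = ch k b.
  move=> hb; elim: k => [|k IHk] km.
    by rewrite !big_nat1 /cv /ch !out //; lia.
  rewrite !(big_nat_recr k.+1) //= addbACA IHk; last by lia.
  have hk : 0 < k.+1 < m by lia.
  have /cev : inner (pt k.+1 b) by rewrite /inner /= !inordK; lia.
  rewrite (grid_degree cadj hk hb) /= -/(ch _ _) -/(cv _ _).
  rewrite (c_sym _ (pt k b)) (c_sym _ (pt k.+1 b.-1)) -/(ch k b).
  have -> : c (pt k.+1 b.-1) (pt k.+1 b) = cv k.+1 b.-1 by rewrite /cv prednK //; lia.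
  case: (cv k.+1 b) (cv k.+1 b.-1) (ch k b) (ch k.+1 b) => [] [] [] [] //=.
exists h.
have key p q : inner p -> inner q -> upward p q || rightward p q ->
    c p q = h (gfl p q) (+) h (gfl q p).
  move=> /innerP[a [b [-> ha hb]]] qi.
  case/orP => /andP[/eqP q1 /eqP q2].
    have qE : q = pt a b.+1.
      by rewrite -(ptK q) q1 q2 pt1 ?pt2 //; lia.
    rewrite qE !gfl_up // !hE; try lia.
    by rewrite big_nat_recr //= addbC addbA addbb addFb.
  have qE : q = pt a.+1 b by rewrite -(ptK q) q1 q2 pt1 ?pt2 //; lia.
  rewrite qE !gfl_right // !hE; try lia.
  by rewrite tele //; lia.
move=> p q ip iq; rewrite /adj.
have [pq|n1] := boolP (upward p q || rightward p q); first by rewrite key.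
have [qp _|n2] := boolP (upward q p || rightward q p); first by rewrite c_sym key // addbC.
by move: n1 n2; rewrite !negb_or => /andP[/negbTE-> /negbTE->] /andP[/negbTE-> /negbTE->].
Qed.

End Grid.

Lemma odd_big_addb_seq (I : finType) (J : Type) (s : seq J) (D : pred J) (a : J -> pred I) :
  odd #|[set i | \big[addb/false]_(j <- s | D j) a j i]| =
  \big[addb/false]_(j <- s | D j) odd #|[set i | a j i]|.
Proof.
elim: s => [|j s IHs].
  rewrite big_nil; under eq_finset do rewrite big_nil.
  by apply/negbTE; rewrite (_ : [set _ | _] = set0) ?cards0 //; apply/setP => i; rewrite !inE.
rewrite big_cons; under eq_finset do rewrite big_cons.
by case: (D j) => //; rewrite odd_card_addb IHs.
Qed.

(** * Face labellings of minors *)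

Section Join.

Variables (P : finType) (r : rel P).
Hypotheses (r_sym : symmetric r) (r_irr : irreflexive r).

(* The edges of a path, counted modulo 2. *)
Lemma path_join p q : connect r p q -> exists J : rel P,
  [/\ symmetric J, subrel J r & forall u, odd #|[set v | J u v]| = (u == p) (+) (u == q)].
Proof.
case/connectP => s; elim: s p => [|t s IHs] p /=.
  move=> _ ->; exists (fun _ _ => false); split=> // u.
  by rewrite addbb (_ : [set _ | _] = set0) ?cards0 //; apply/setP => i; rewrite !inE.
case/andP => pt ts qE; have [J [Js Jr Jo]] := IHs t ts qE.
pose E u v := ((u, v) == (p, t)) || ((u, v) == (t, p)).
have npt : p != t by apply: contraTneq pt => ->; rewrite r_irr.
exists (fun u v => E u v (+) J u v); split=> [u v|u v|u].
- by rewrite Js /E !xpair_eqE andbC orbC [X in X || _]andbC.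
- case Euv: (E u v) => /=; last exact: Jr.
  by case/orP: Euv => /eqP[-> ->] _; rewrite // r_sym.
rewrite odd_card_addb Jo addbA; congr (_ (+) _).
have -> : [set v | E u v] = if u == p then [set t] else if u == t then [set p] else set0.
  apply/setP => v; rewrite inE /E !xpair_eqE.
  have [->|up] := eqVneq u p; first by rewrite (negbTE npt) orbF !inE.
  by case: (u == t) => /=; rewrite inE.
by have [->|up] := eqVneq u p; [rewrite (negbTE npt) cards1|case: eqP; rewrite ?cards1 ?cards0].
Qed.

End Join.

Section Minor.

Variables (T P F : finType) (g : rel T) (adj : rel P) (inner : pred P) (hfl : P -> P -> F).
Hypotheses (g_sym : symmetric g) (g_irr : irreflexive g).
Hypotheses (adj_sym : symmetric adj) (adj_irr : irreflexive adj).
Hypothesis host_even : forall (S : pred F) p, inner p ->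
  ~~ odd #|[set q | adj p q && (S (hfl p q) (+) S (hfl q p))]|.
Hypothesis host_potential : forall c : rel P, symmetric c ->
  (forall p q, c p q -> adj p q && inner p) ->
  (forall p, inner p -> ~~ odd #|[set q | c p q]|) ->
  exists h : F -> bool, forall p q, inner p -> inner q -> adj p q ->
    c p q = h (hfl p q) (+) h (hfl q p).

Variables (blob : P -> option T) (root : T -> P) (dt : T -> T -> P * P).
Hypothesis blob_inner : forall p x, blob p = Some x -> inner p.
Hypothesis blob_adj : forall p q x, blob p = Some x -> adj p q -> inner q.
Hypothesis blob_root : forall p x, blob p = Some x ->
  connect [rel u v | [&& adj u v, blob u == Some x & blob v == Some x]] p (root x).
Hypothesis dtP : forall x y, g x y ->
  [/\ adj (dt x y).1 (dt x y).2, blob (dt x y).1 = Some x, blob (dt x y).2 = Some y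
    & dt y x = ((dt x y).2, (dt x y).1)].

Let chosen p q := if (blob p, blob q) is (Some x, Some y)
  then g x y && (dt x y == (p, q)) else false.

Let chosenP p q : reflect (exists x y, g x y /\ dt x y = (p, q)) (chosen p q).
Proof.
rewrite /chosen; apply: (iffP idP).
  case: (blob p) => // x; case: (blob q) => // y /andP[xy /eqP d]; by exists x, y.
case=> x [y [xy d]]; have [_ b1 b2 _] := dtP xy; rewrite d /= in b1 b2.
by rewrite b1 b2 xy d eqxx.
Qed.

Let chosen_sym : symmetric chosen.
Proof.
move=> p q; apply/chosenP/chosenP => -[x [y [xy d]]]; exists y, x;
  by have [_ _ _ ->] := dtP xy; rewrite g_sym d.
Qed.

(** Deleting a host edge merges the faces beside it, contracting one does not. Faces are therefore
    merged across the edges that neither lie in a branch set nor were chosen to represent an edge of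
    [g]. *)
Definition cross := [rel f h : F | [exists p, exists q,
  [&& adj p q && (inner p && inner q), ~~ ((blob p == blob q) && (blob p != None)),
      ~~ chosen p q, hfl p q == f & hfl q p == h]]].

Let cross_sym : symmetric cross.
Proof.
suff i f h : cross f h -> cross h f by move=> f h; apply/idP/idP; exact: i.
case/existsP => p /existsP[q /and5P[a b c /eqP d /eqP e]].
apply/existsP; exists q; apply/existsP; exists p.
by rewrite adj_sym (andbC (inner q)) a eq_sym chosen_sym c d e !eqxx /= andbT; move: b; case: eqP => // ->.
Qed.

Let face f := fingraph.root cross f.
Let fl x y := face (hfl (dt x y).1 (dt x y).2).

Let flE x y : g x y -> fl y x = face (hfl (dt x y).2 (dt x y).1).
Proof. by move=> xy; rewrite /fl; have [_ _ _ ->] := dtP xy. Qed.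

Let face_cross p q : adj p q -> inner p -> inner q -> ~~ ((blob p == blob q) && (blob p != None)) ->
  ~~ chosen p q -> face (hfl p q) = face (hfl q p).
Proof.
move=> a ip iq b c; apply/eqP; rewrite root_connect; last exact: sym_connect_sym cross_sym.
by apply: connect1; apply/existsP; exists p; apply/existsP; exists q; rewrite a ip iq b c !eqxx.
Qed.

Let darts_even (r : rel P) : (forall p, ~~ odd #|[set q | r p q]|) ->
  ~~ odd #|[set pq : P * P | r pq.1 pq.2]|.
Proof.
move=> ev; rewrite card_darts odd_sum (_ : [set _ | _] = set0) ?cards0 //.
by apply/setP => p; rewrite !inE (negbTE (ev p)).
Qed.

(** Evenness of the host is summed over the branch set of [x]: darts inside it cancel in pairs,
    unchosen leaving darts have the same merged face on both sides, and the chosen ones are the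
    edges of [g] at [x]. *)
Lemma minor_even f x : ~~ odd #|[set y | g x y && ((fl x y == f) (+) (fl y x == f))]|.
Proof.
pose S h := face h == f; pose bd p q := adj p q && (S (hfl p q) (+) S (hfl q p)).
have bd_sym : symmetric bd by move=> p q; rewrite /bd adj_sym addbC.
have := darts_even (r := fun p q => (blob p == Some x) && bd p q).
have -> : [set pq : P * P | (blob pq.1 == Some x) && bd pq.1 pq.2] =
   [set pq : P * P | [&& bd pq.1 pq.2, blob pq.1 == Some x & blob pq.2 == Some x]] :|:
   dt x @: [set y | g x y && ((fl x y == f) (+) (fl y x == f))].
  apply/setP => -[p q]; rewrite !inE /=; apply/andP/orP => [[/eqP bp pq]|].
    have [bq|bq] := eqVneq (blob q) (Some x); first by left; rewrite pq bp eqxx.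
    right; have [aq sq] := andP pq.
    have /chosenP[u [v [uv d]]] : chosen p q.
      apply: contraLR sq => nch; rewrite /S face_cross ?addbb //.
      - exact: blob_inner bp.
      - exact: blob_adj bp aq.
      - by rewrite bp /= andbT eq_sym.
    have [_ bu bv _] := dtP uv; rewrite d /= bp in bu; case: bu => xu; subst u.
    apply/imsetP; exists v; rewrite // inE uv (flE uv) /fl d /=.
    exact: sq.
  case=> [/and3P[-> -> _] //|/imsetP[y]]; rewrite inE => /andP[xy fE] d.
  have [a bx _ _] := dtP xy; rewrite -d /= in a bx; rewrite bx eqxx /bd a /S.
  by move: fE; rewrite (flE xy) /fl -d.
rewrite cardsU oddB.
rewrite disjoint_setI0 ?cards0 ?addbF ?oddD; last first.
  rewrite -setI_eq0; apply/eqP/setP => -[p q]; rewrite !inE /=.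
  apply/negP => /andP[/and3P[_ _ /eqP bq] /imsetP[y]]; rewrite inE => /andP[xy _] d.
  have [_ _ by_ _] := dtP xy; rewrite -d /= bq in by_; case: by_ => E.
  by move: xy; rewrite E g_irr.
rewrite (negbTE (even_symmetric (r := fun p q => [&& bd p q, blob p == Some x & blob q == Some x]) _ _)).
- rewrite addFb card_in_imset; last first.
    move=> y z; rewrite !inE => /andP[xy _] /andP[xz _] E.
    have [_ _ b1 _] := dtP xy; have [_ _ b2 _] := dtP xz.
    by rewrite E b2 in b1; case: b1.
  apply=> p; have [bp|_] := eqVneq (blob p) (Some x); last first.
    by rewrite (_ : [set _ | _] = set0) ?cards0 //; apply/setP => q; rewrite !inE.
  exact: (host_even S (blob_inner bp)).
- by move=> p q; rewrite bd_sym andbA andbAC -andbA.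
- by move=> p; rewrite /bd adj_irr.
- by apply: leq_trans (subset_leq_card (subsetIl _ _)) (leq_addr _ _).
Qed.

(* An even subgraph of [g] lifts to one of the host: inside each blob, the ends of
   its edges are joined to the root. *)
Lemma minor_potential (c : rel T) : symmetric c -> subrel c g ->
  (forall x, ~~ odd #|[set y | c x y]|) ->
  exists h : F -> bool, forall x y, g x y -> c x y = h (fl x y) (+) h (fl y x).
Proof.
move=> c_sym cg cev.
pose ct p q := if (blob p, blob q) is (Some x, Some y)
  then c x y && (dt x y == (p, q)) else false.
have ct_sym : symmetric ct.
  move=> p q; rewrite /ct; case: (blob p) (blob q) => [x|] [y|] //=.
  rewrite c_sym; case xy: (c y x) => //=; have [_ _ _ ->] := dtP (cg _ _ xy).
  by case: (dt y x) => a b; rewrite !xpair_eqE andbC.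
have ctP p q : ct p q -> exists x y, c x y /\ dt x y = (p, q).
  by rewrite /ct; case: (blob p) (blob q) => [x|] [y|] //= /andP[xy /eqP]; exists x, y.
(* Vertices where the representing edges alone have odd degree; each is joined to the root of its
   branch set. *)
pose D p := odd #|[set q | ct p q]|.
pose br x := [rel u v | [&& adj u v, blob u == Some x & blob v == Some x]].
have br_sym x : symmetric (br x) by move=> u v; rewrite /= adj_sym andbA andbAC -andbA.
have br_irr x : irreflexive (br x) by move=> u; rewrite /= adj_irr.
have [J JP] : exists J : P -> rel P, forall p, if blob p is Some x then
    [/\ symmetric (J p), subrel (J p) (br x) &
      forall u, odd #|[set v | J p u v]| = (u == p) (+) (u == root x)] else True.
  apply: (fin_all_exists (P := fun p (Jp : rel P) => if blob p is Some x then
    [/\ symmetric Jp, subrel Jp (br x) &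
      forall u, odd #|[set v | Jp u v]| = (u == p) (+) (u == root x)] else True)) => p.
  case E: (blob p) => [x|]; last by exists (fun _ _ => false).
  exact: (path_join (br_sym x) (br_irr x) (blob_root E)).
have Dblob p : D p -> exists x, blob p = Some x.
  rewrite /D; case E: (blob p) => [x|]; first by exists x.
  by rewrite (_ : [set _ | _] = set0) ?cards0 //; apply/setP => q; rewrite !inE /ct E.
pose JJ u v := \big[addb/false]_(p | D p) J p u v.
have JJs : symmetric JJ.
  move=> u v; apply: eq_bigr => p /Dblob[x bp]; have := JP p; rewrite bp => -[s _ _].
  exact: s.
have JJr u v : JJ u v -> exists x, br x u v.
  move=> uv; have /existsP[x] : [exists x, br x u v]; last by exists x.
  apply: contraTT uv => /existsPn nbr; rewrite /JJ big1 // => p /Dblob[x bp].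
  have := JP p; rewrite bp => -[_ s _]; apply/negbTE.
  by apply: contra (nbr x) => /s.
pose cc u v := ct u v (+) JJ u v.
have [||p pin|h hP] := host_potential (c := cc).
- by move=> u v; rewrite /cc ct_sym JJs.
- move=> u v; rewrite /cc; case cuv: (ct u v) => /=.
    have [x [y [/cg xy d]]] := ctP _ _ cuv; have [a bx _ _] := dtP xy.
    by rewrite d /= in a bx; rewrite a (blob_inner bx).
  by move=> /JJr[x /and3P[-> /eqP/blob_inner->]].
- rewrite /cc odd_card_addb -/(D p) odd_big_addb_seq.
  rewrite (eq_bigr (fun q => (q == p) (+) (if blob q is Some x then p == root x else false)));
    last first.
    move=> q /Dblob[x bq]; have := JP q; rewrite bq => -[_ _ ->].
    by rewrite eq_sym.
  rewrite big_split /=.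
  have -> : \big[addb/false]_(q | D q) (q == p) = D p.
    rewrite big_mkcond (bigD1 p) //= eqxx big1 ?addbF; first by case: (D p).
    by move=> q /negbTE->; case: (D q).
  rewrite addbA addbb addFb.
  have sumodd (A : pred P) : \big[addb/false]_(q | D q) A q = odd #|[set q | D q & A q]|.
    rewrite -sum1dep_card big_mkcondr /=.
    by elim/big_rec2: _ => [//|q a b _ ->]; rewrite oddD; case: (A q).
  rewrite sumodd; case: (pickP (fun x => (p == root x) && (blob p == Some x))) => [x|none];
    last first.
    rewrite (_ : [set _ | _] = set0) ?cards0 //; apply/setP => q; rewrite !inE.
    apply/negP => /andP[/Dblob[x bq]]; rewrite bq => /eqP pr.
    have := none x; rewrite pr eqxx /= => /eqP; apply.
    have := blob_root bq; case/connectP => s; case/lastP: s => [|s z] /=.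
      by move=> _ ->.
    by rewrite rcons_path last_rcons => /andP[_ /and3P[_ _ /eqP]] + ->.
  (* The joining paths meet the root as often as its branch set has odd vertices, a number with the
     parity of the degree of [x] in [c]. *)
  case/andP => /eqP pr /eqP bp.
  have -> : [set q | D q & if blob q is Some y then p == root y else false] =
      [set q | D q & blob q == Some x].
    apply/setP => q; rewrite !inE; case Dq: (D q) => //=.
    have [y bq] := Dblob _ Dq; rewrite bq pr; apply/eqP/eqP => [rE|[->] //].
    have : blob (root y) = Some y.
      have := blob_root bq; case/connectP => s; case/lastP: s => [|s z] /=.
        by move=> _ ->.
      by rewrite rcons_path last_rcons => /andP[_ /and3P[_ _ /eqP]] + ->.
    by rewrite -rE -pr bp => -[->].
  have -> : [set q | D q & blob q == Some x] =
      [set q | odd #|[set v | (blob q == Some x) && ct q v]|].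
    apply/setP => q; rewrite !inE andbC; case: (_ == _) => //=.
    by rewrite (_ : [set _ | _] = set0) ?cards0 //; apply/setP => v; rewrite !inE.
  rewrite -odd_sum -(card_darts (fun q v => (blob q == Some x) && ct q v)).
  suff -> : [set pq : P * P | (blob pq.1 == Some x) && ct pq.1 pq.2] =
      dt x @: [set y | c x y].
    rewrite card_in_imset // => y z; rewrite !inE => /cg xy /cg xz E.
    have [_ _ b1 _] := dtP xy; have [_ _ b2 _] := dtP xz.
    by rewrite E b2 in b1; case: b1.
  apply/setP => -[a b]; rewrite inE /=; apply/andP/imsetP => [[/eqP ba /ctP[u [v [uv d]]]]|].
    have [_ bu _ _] := dtP (cg _ _ uv); rewrite d /= ba in bu; case: bu => E; subst u.
    by exists v; rewrite ?inE.
  case=> y; rewrite inE => xy d; have [_ b1 b2 _] := dtP (cg _ _ xy).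
  by rewrite -d /= in b1 b2; rewrite /ct b1 b2 xy d !eqxx.
(* The lifted subgraph avoids the deleted edges, so [h] is constant on merged faces. *)
have hcross f k : cross f k -> h f = h k.
  case/existsP => p /existsP[q /and5P[/andP[pq /andP[ip iq]] b nch /eqP<- /eqP<-]].
  have := hP p q ip iq pq; suff -> : cc p q = false by case: (h (hfl p q)); case: (h (hfl q p)).
  rewrite /cc; have -> : ct p q = false.
    apply: contraNF nch => /ctP[x [y [xy d]]]; apply/chosenP; exists x, y; split=> //.
    exact: cg.
  by apply: contraNF b => /JJr[x /and3P[_ /eqP-> /eqP->]]; rewrite eqxx.
have hface f : h (face f) = h f.
  apply/esym; have : connect cross f (face f) by exact: connect_root.
  move: (face f) => k /connectP[s]; elim: s f => [|k' s IHs] f /=; first by move=> _ ->.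
  by case/andP => fk ks kE; rewrite (hcross _ _ fk); exact: IHs.
exists h => x y xy; rewrite (flE xy) /fl !hface.
have [a bx by_ _] := dtP xy.
rewrite -hP // ?(blob_inner bx) ?(blob_inner by_) // /cc.
have -> : JJ (dt x y).1 (dt x y).2 = false.
  apply/negP => /JJr[z /and3P[_]]; rewrite bx by_ => /eqP[<-] /eqP[yx].
  by move: xy; rewrite yx g_irr.
by rewrite addbF /ct bx by_ -surjective_pairing eqxx andbT.
Qed.

Lemma minor_has_faces : has_faces g.
Proof. by exists F, fl; split; [exact: minor_even|exact: minor_potential]. Qed.

End Minor.

Definition inside (P : finType) (r : rel P) (S : {set P}) :=
  [rel u v | [&& r u v, u \in S & v \in S]].

Definition connected_set (P : finType) (r : rel P) (S : {set P}) :=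
  {in S &, forall p q, connect (inside r S) p q}.

Lemma inside_sym (P : finType) (r : rel P) S : symmetric r -> symmetric (inside r S).
Proof. by move=> r_sym u v; rewrite /= r_sym andbA andbAC -andbA. Qed.

(** * Branch sets from strings in the host *)

Section Strings.

Variables (T P F : finType) (g : rel T) (adj : rel P) (inner : pred P) (hfl : P -> P -> F).
Hypotheses (g_sym : symmetric g) (g_irr : irreflexive g).
Hypotheses (adj_sym : symmetric adj) (adj_irr : irreflexive adj).
Hypothesis host_even : forall (S : pred F) p, inner p ->
  ~~ odd #|[set q | adj p q && (S (hfl p q) (+) S (hfl q p))]|.
Hypothesis host_potential : forall c : rel P, symmetric c ->
  (forall p q, c p q -> adj p q && inner p) ->
  (forall p, inner p -> ~~ odd #|[set q | c p q]|) ->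
  exists h : F -> bool, forall p q, inner p -> inner q -> adj p q ->
    c p q = h (hfl p q) (+) h (hfl q p).

Variables (SH : T -> {set P}) (SM : T -> T -> {set P}) (core : pred P).
Let lt (x y : T) := enum_rank x < enum_rank y.
Hypothesis core_inner : forall p, core p -> inner p.
Hypothesis core_adj : forall p q, core p -> adj p q -> inner q.
Hypothesis SH_core : forall x p, p \in SH x -> core p.
Hypothesis SM_core : forall x y p, g x y -> lt x y -> p \in SM x y -> core p.
Hypothesis SH_conn : forall x, connected_set adj (SH x).
Hypothesis SM_conn : forall x y, g x y -> lt x y -> connected_set adj (SM x y).
Hypothesis SH_neq0 : forall x, exists p, p \in SH x.
Hypothesis meetl : forall x y, g x y -> lt x y -> exists p, p \in SH x /\ p \in SM x y.
Hypothesis meetr : forall x y, g x y -> lt x y -> exists p, p \in SH y /\ p \in SM x y.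
Hypothesis disjHH : forall x y p, p \in SH x -> p \in SH y -> x = y.
Hypothesis disjMH : forall x y z p, g x y -> lt x y -> p \in SM x y -> p \in SH z ->
  z = x \/ z = y.
Hypothesis disjMM : forall x y u v p, g x y -> lt x y -> g u v -> lt u v ->
  p \in SM x y -> p \in SM u v -> x = u /\ y = v.

(* The string of an edge [x y] is cut at its first contact with [SH y], and the
   part before it is given to [x]. *)
Let M x y := SM x y :\: SH y.
Let C x y := [set q | [exists p, [&& p \in SH x, p \in SM x y & connect (inside adj (M x y)) p q]]].
Let inB x p := (p \in SH x) || [exists y, [&& g x y, lt x y & p \in C x y]].

Let CM x y q : g x y -> q \in C x y -> q \in M x y.
Proof.
move=> xy; rewrite inE => /existsP[p /and3P[pH pM]].
have pin : p \in M x y.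
  by rewrite inE pM andbT; apply: contraTN xy => /(disjHH pH)->; rewrite g_irr.
case/connectP => s; case/lastP: s => [|s z] /=; first by move=> _ ->.
by rewrite rcons_path last_rcons => /andP[_ /and3P[_ _]] + ->.
Qed.

Let C_closed x y u v : g x y -> u \in C x y -> adj u v -> v \in M x y -> v \in C x y.
Proof.
move=> xy uC uv vM; have uM := CM xy uC; move: uC; rewrite !inE => /existsP[p /and3P[pH pM pu]].
apply/existsP; exists p; rewrite pH pM (connect_trans pu) //; apply: connect1.
by rewrite /= uv uM vM.
Qed.

Let inBC x y p : g x y -> lt x y -> p \in C x y -> inB x p.
Proof. by move=> xy ly pC; apply/orP; right; apply/existsP; exists y; rewrite xy ly. Qed.

Let inB_uniq x z p : inB x p -> inB z p -> x = z.
Proof.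
case/orP => [pH|/existsP[y /and3P[xy ly pC]]] /orP[pH'|/existsP[w /and3P[zw lw pC']]].
- exact: disjHH pH pH'.
- have := CM zw pC'; rewrite inE => /andP[pn pM].
  by have [//|xw] := disjMH zw lw pM pH; rewrite -xw pH in pn.
- have := CM xy pC; rewrite inE => /andP[pn pM].
  by have [//|xw] := disjMH xy ly pM pH'; rewrite -xw pH' in pn.
- have := CM xy pC; have := CM zw pC'; rewrite !inE => /andP[_ pM'] /andP[_ pM].
  by have [] := disjMM xy ly zw lw pM pM'.
Qed.

Let blob p := [pick x | inB x p].

Let blobE p x : (blob p == Some x) = inB x p.
Proof.
rewrite /blob; case: pickP => [z zp|none]; last by rewrite none.
apply/eqP/idP => [[<-] //|xp]; by rewrite (inB_uniq zp xp).
Qed.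

Let root x := xchoose (SH_neq0 x).
Let rootH x : root x \in SH x. Proof. exact: xchooseP. Qed.

Let blob_root p x : blob p = Some x ->
  connect [rel u v | [&& adj u v, blob u == Some x & blob v == Some x]] p (root x).
Proof.
move/eqP; rewrite blobE => px; set br := [rel u v | _].
have H q : q \in SH x -> connect br q (root x).
  move=> qH; apply: connect_sub (SH_conn qH (rootH x)) => u v /and3P[uv uH vH].
  by apply: connect1; rewrite /= !blobE uv /inB uH vH.
case/orP: px => [/H //|/existsP[y /and3P[xy ly]]].
rewrite inE => /existsP[q /and3P[qH qM qp]]; apply: connect_trans (H q qH).
rewrite (sym_connect_sym (e := br)); last by move=> u v; rewrite /= adj_sym andbA andbAC -andbA.
have : q \in C x y by rewrite inE; apply/existsP; exists q; rewrite qH qM connect0.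
case/connectP: qp => s + -> {p qH qM}.
elim: s q => [|u s IHs] q //= /andP[/and3P[qu qM uM] us] qC.
have uC := C_closed xy qC qu uM.
apply: connect_trans (IHs u us uC); apply: connect1.
by rewrite /= qu !blobE !(@inBC x y).
Qed.

(** Along the string from [SH x] towards [SH y], as long as the two branch sets do not touch, the
    walk stays in [C x y]; but [C x y] avoids [SH y]. *)
Let touching x y : g x y -> lt x y ->
  exists p q, [/\ adj p q, blob p == Some x & blob q == Some y].
Proof.
move=> xy ly.
have [/existsP[p /existsP[q /and3P[a b c]]]|none] :=
  boolP [exists p, exists q, [&& adj p q, blob p == Some x & blob q == Some y]].
  by exists p, q.
have [p [pH pM]] := meetl xy ly; have [q [qH qM]] := meetr xy ly.
have pC : p \in C x y by rewrite inE; apply/existsP; exists p; rewrite pH pM connect0.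
suff /(CM xy) : q \in C x y by rewrite inE qH.
case/connectP: (SM_conn xy ly pM qM) => s + -> {pH pM q qH qM}.
elim: s p pC => [|u s IHs] p pC //= /andP[/and3P[pu pM uM] us].
apply: IHs us; apply: (C_closed xy pC pu); rewrite inE uM andbT.
apply: contra none => uH; apply/existsP; exists p; apply/existsP; exists u.
by rewrite pu !blobE (@inBC x y) // /inB uH.
Qed.

Let d0 x y := odflt (root x, root x)
  [pick pq | [&& adj pq.1 pq.2, blob pq.1 == Some x & blob pq.2 == Some y]].
Let swap (p : P * P) := (p.2, p.1).
Let dt x y := if lt x y then d0 x y else swap (d0 y x).

Let d0P x y : g x y -> lt x y ->
  [/\ adj (d0 x y).1 (d0 x y).2, blob (d0 x y).1 = Some x & blob (d0 x y).2 = Some y].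
Proof.
move=> xy ly; rewrite /d0; case: pickP => [pq /and3P[? /eqP ? /eqP ?] //|none].
by have [p [q [a b c]]] := touching xy ly; have := none (p, q); rewrite /= a b c.
Qed.

Lemma strings_has_faces : has_faces g.
Proof.
have Bcore p x : blob p = Some x -> core p.
  move/eqP; rewrite blobE => /orP[/SH_core //|/existsP[y /and3P[xy ly /(CM xy)]]].
  by rewrite inE => /andP[_ /(SM_core xy ly)].
apply: (@minor_has_faces T P F g adj inner hfl g_sym g_irr adj_sym adj_irr host_even
  host_potential blob root dt).
- by move=> p x /Bcore/core_inner.
- by move=> p q x /Bcore; exact: core_adj.
- exact: blob_root.
move=> x y xy; have yx : g y x by rewrite g_sym.
rewrite /dt; case: (ltngtP (enum_rank x) (enum_rank y)) => h.
- have -> : lt x y by []; have -> : lt y x = false by rewrite /lt ltnNge ltnW.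
  by have [] := d0P xy h.
- have -> : lt y x by []; have -> : lt x y = false by rewrite /lt ltnNge ltnW.
  have [a b c] := d0P yx h; rewrite /swap /= adj_sym; split=> //.
  by case: (d0 y x).
- by move: xy; rewrite (enum_rank_inj (val_inj h)) g_irr.
Qed.

End Strings.

(** * From drawings to grid minors *)

From mathcomp Require Import all_classical all_reals all_analysis.
Import Order.TTheory GRing.Theory Num.Theory numFieldNormedType.Exports.

Section Arcs.
Local Open Scope classical_set_scope.
Local Open Scope ring_scope.

Variable R : realType.

Lemma compact_ne0 (K : set (R * R)) (phi : R * R -> R) : compact K -> continuous phi ->
  (forall p, K p -> phi p != 0) -> exists2 d : R, 0 < d & forall p, K p -> d <= `|phi p|.
Proof.
move=> cK cphi n0.
have : compact (phi @` K).
  by apply: continuous_compact => //; exact: continuous_subspaceT.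
move/(compact_closed (@Rhausdorff R)) => cl.
have : nbhs (0 : R) (~` (phi @` K)).
  apply: open_nbhs_nbhs; split; first exact: closed_openC.
  by move=> [p Kp p0]; have := n0 p Kp; rewrite p0 eqxx.
rewrite -nbhs_ballE => -[d d0 sub]; exists d => // p Kp; rewrite leNgt; apply/negP => lt.
by apply: (sub (phi p)); [rewrite /ball /= sub0r normrN|exists p].
Qed.

Lemma dist_continuous (f g : R -> R * R) : continuous f -> continuous g ->
  continuous (fun p : R * R => `|f p.1 - g p.2|).
Proof.
move=> cf cg p; apply: (@cvg_norm _ (R * R)%type); apply: (@cvgB _ (R * R)%type).
- by apply: continuous_comp; [exact: cvg_fst|exact: cf].
- by apply: continuous_comp; [exact: cvg_snd|exact: cg].
Qed.

Lemma arcs_separated (f g : R -> R * R) a b c d : continuous f -> continuous g ->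
  (forall s t, s \in `[a, b] -> t \in `[c, d] -> f s <> g t) ->
  exists2 e : R, 0 < e & forall s t, s \in `[a, b] -> t \in `[c, d] -> e <= `|f s - g t|.
Proof.
move=> cf cg ne.
have [||e e0 eP] := @compact_ne0 (`[a, b]%classic `*` `[c, d]%classic) _ _ (dist_continuous cf cg).
- by apply: compact_setX; exact: segment_compact.
- by move=> [s t] [/= sI tI]; rewrite normr_eq0 subr_eq0; apply/eqP; apply: ne.
by exists e => // s t sI tI; have := eP (s, t) (conj sI tI); rewrite normr_id.
Qed.

(** On the compact set of pairs whose images are at least [e] apart, [s - t] does not vanish, so it
    is bounded away from 0. *)
Lemma arc_unif_continuous (f : R -> R * R) (e : R) : continuous f -> 0 < e ->
  exists2 d : R, 0 < d &
    forall s t, s \in `[0, 1] -> t \in `[0, 1] -> `|s - t| < d -> `|f s - f t| < e.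
Proof.
move=> cf e0; have cd := dist_continuous cf cf.
pose K := (`[0, 1]%classic `*` `[0, 1]%classic) `&` [set p : R * R | e <= `|f p.1 - f p.2|].
have cK : compact K.
  apply: compact_closedI; first by apply: compact_setX; exact: segment_compact.
  have -> : [set p : R * R | e <= `|f p.1 - f p.2|] =
    (fun p : R * R => `|f p.1 - f p.2|) @^-1` [set x | e <= x] by [].
  by apply: closed_comp; [move=> p _; exact: cd|exact: closed_ge].
have [|p [_ /= ep]|d d0 dP] := @compact_ne0 K (fun p => p.1 - p.2) cK.
- by move=> p; apply: cvgB; [exact: cvg_fst|exact: cvg_snd].
- by apply: contraTneq ep => /subr0_eq->; rewrite subrr normr0 -ltNge.
exists d => // s t sI tI; apply: contraTT; rewrite -!leNgt => le.
exact: (dP (s, t)).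
Qed.

Lemma arc_bounded (f : R -> R * R) : continuous f ->
  exists M : R, forall t, t \in `[0, 1] -> `|f t| <= M.
Proof.
move=> cf.
have [M [Mr MP]] : bounded_set (f @` `[0, 1]%classic).
  apply: compact_bounded; apply: continuous_compact (@segment_compact _ _ _).
  exact: continuous_subspaceT.
by exists (M + 1) => t tI; apply: (MP (M + 1)); [rewrite ltrDl|exists t].
Qed.

(** Composition with the retraction onto the unit interval makes the continuity of an arc global. *)
Definition clamp (t : R) : R := Num.max 0 (Num.min t 1).

Lemma clamp_id t : t \in `[0, 1] -> clamp t = t.
Proof. by rewrite in_itv /= /clamp => /andP[t0 t1]; rewrite min_l // max_r. Qed.

Lemma clamp_itv t : clamp t \in `[0, 1].
Proof. by rewrite in_itv /= /clamp le_max lexx /= ge_max ler01 ge_min lexx orbT. Qed.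

Lemma clamp_continuous (f : R -> R * R) : {within `[0, 1], continuous f} ->
  continuous (f \o clamp).
Proof.
move=> /subspace_continuousP cf t.
have cc : {for t, continuous clamp}.
  apply: continuous_max; first exact: cvg_cst.
  by apply: continuous_min; [exact: cvg_id|exact: cvg_cst].
have := cf (clamp t) (clamp_itv t); apply: cvg_trans => U /= WU.
rewrite /= nbhs_simpl /=; have := cc _ WU; rewrite nbhs_simpl /=.
by apply: filterS => s /= h; apply: h; exact: clamp_itv.
Qed.

End Arcs.

Lemma lazy_walk_connected (P : finType) (r : rel P) (w : nat -> P) N a b :
  symmetric r -> (b < N)%N ->
  (forall j, (a <= j < b)%N -> w j = w j.+1 \/ r (w j) (w j.+1)) ->
  connected_set r [set w (val j) | j : 'I_N & (a <= j <= b)%N]%SET.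
Proof.
move=> r_sym bN step; set S := (X in connected_set r X).
have wS j : (a <= j <= b)%N -> w j \in S.
  move=> /andP[aj jb]; apply/imsetP; exists (Ordinal (leq_ltn_trans jb bN)) => //.
  by rewrite inE aj jb.
have base j : (a <= j <= b)%N -> connect (inside r S) (w a) (w j).
  elim: j => [|j IHj] h; first by have -> : a = 0%N by lia.
  have [->|aj] := eqVneq a j.+1; first by [].
  have h' : (a <= j <= b)%N by lia.
  apply: connect_trans (IHj h') _; case: (step j) => [|<- //|rj]; first by lia.
  by apply: connect1; rewrite /= rj !wS.
move=> _ _ /imsetP[i + ->] /imsetP[j + ->]; rewrite !inE => hi hj.
apply: connect_trans (base _ hj); rewrite sym_connect_sym ?base //.
exact: inside_sym.
Qed.

Lemma adj_step1 m (p q : 'I_m.+1 * 'I_m.+1) : p.2 = q.2 :> nat ->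
  (p.1 <= q.1.+1)%N -> (q.1 <= p.1.+1)%N -> p = q \/ adj p q.
Proof.
case: p q => [a b] [c d] /= /val_inj-> ac ca; have [->|n] := eqVneq a c; first by left.
right; have n' : (a : nat) <> c by move/val_inj/eqP; exact/negP.
by rewrite /adj /upward /rightward /= -!val_eqE /=; lia.
Qed.

Lemma adj_step2 m (p q : 'I_m.+1 * 'I_m.+1) : p.1 = q.1 :> nat ->
  (p.2 <= q.2.+1)%N -> (q.2 <= p.2.+1)%N -> p = q \/ adj p q.
Proof.
case: p q => [a b] [c d] /= /val_inj-> ac ca; have [->|n] := eqVneq b d; first by left.
right; have n' : (b : nat) <> d by move/val_inj/eqP; exact/negP.
by rewrite /adj /upward /rightward /= -!val_eqE /=; lia.
Qed.

Lemma half_step j : (uphalf j.+1 = uphalf j /\ j.+1./2 = j./2.+1) \/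
  (j.+1./2 = j./2 /\ uphalf j.+1 = (uphalf j).+1).
Proof. lia. Qed.

Lemma half_le k j : (j <= 6 * k)%N -> (uphalf j <= 3 * k)%N && (j./2 <= 3 * k)%N.
Proof. lia. Qed.

Lemma dist_chain (R : realDomainType) (a b c d e : R) :
  (`|a - b| < e -> `|b - c| < e -> `|d - c| < e -> `|a - d| < e + e + e)%R.
Proof. by rewrite !ltr_norml; lra. Qed.

Lemma connect_sub_rel (P : finType) (r r' : rel P) p q :
  subrel r r' -> connect r p q -> connect r' p q.
Proof. by move=> rr; apply: connect_sub => u v /rr; exact: connect1. Qed.

Lemma uniform_positive (R : realType) (I : finType) (Q : I -> R -> Prop) :
  (forall i d d', Q i d -> d' <= d -> 0 < d' -> Q i d')%R ->
  (forall i, exists2 d : R, 0 < d & Q i d)%R ->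
  exists2 d : R, (0 < d)%R & forall i, Q i d.
Proof.
move=> mono ex.
have H (s : seq I) : exists2 d : R, (0 < d)%R & forall i, i \in s -> Q i d.
  elim: s => [|i s [d d0 dP]]; first by exists 1%R => //; exact: ltr01.
  have [d' d'0 d'P] := ex i; have m0 : (0 < Num.min d d')%R by rewrite lt_min d0.
  exists (Num.min d d') => // j; rewrite inE => /orP[/eqP->|js].
    by apply: mono d'P _ m0; rewrite ge_min lexx orbT.
  by apply: mono (dP j js) _ m0; rewrite ge_min lexx.
by have [d d0 dP] := H (enum I); exists d => // i; apply: dP; rewrite mem_enum.
Qed.

(** * Rounding a drawing to walks in the grid *)

Section Draw.
Local Open Scope ring_scope.

Variables (R : realType) (T : finType) (g : rel T).
Hypotheses (g_sym : symmetric g) (g_irr : irreflexive g).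
Variables (pt : T -> R * R) (be : T -> T -> R -> R * R).
Hypothesis be_cont : forall x y, continuous (be x y).
Hypothesis be0 : forall x y, be x y 0 = pt x.
Hypothesis be_rev : forall x y t, g x y -> be y x t = be x y (1 - t).
(** The third of the arc at its first end, or the middle third; the last third is the first one of
    the reversed arc. *)
Let seg (h : bool) : interval R := if h then `[0, 3^-1] else `[3^-1, 2 / 3].
Hypothesis sepHH : forall x y x' y' s t, x != x' ->
  s \in seg true -> t \in seg true -> be x y s <> be x' y' t.
Hypothesis sepMH : forall x y z w s t, g x y -> z != x -> z != y ->
  s \in seg false -> t \in seg true -> be x y s <> be z w t.
Hypothesis sepMM : forall x y u v s t, g x y -> g u v -> [set x; y]%SET != [set u; v]%SET ->
  s \in seg false -> t \in seg false -> be x y s <> be u v t.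

Let sep (i : (T * T * bool) * (T * T * bool)) := forall s t,
  s \in seg i.1.2 -> t \in seg i.2.2 -> be i.1.1.1 i.1.1.2 s <> be i.2.1.1 i.2.1.2 t.

Let separation : exists2 d : R, 0 < d & forall i, sep i -> forall s t,
  s \in seg i.1.2 -> t \in seg i.2.2 ->
  d <= `|be i.1.1.1 i.1.1.2 s - be i.2.1.1 i.2.1.2 t|.
Proof.
apply: (@uniform_positive R _ (fun i d => sep i -> forall s t, s \in seg i.1.2 ->
  t \in seg i.2.2 -> d <= `|be i.1.1.1 i.1.1.2 s - be i.2.1.1 i.2.1.2 t|)) => [i d d' H dd' _ se s t si ti|i].
  exact: le_trans dd' (H se s t si ti).
have [se|nse] := pselect (sep i); last by exists 1; rewrite ?ltr01.
case: i se => [[[x y] []] [[x' y'] []]] se;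
  by have [d d0 dP] := arcs_separated (be_cont (x := x) (y := y)) (be_cont (x := x') (y := y')) se;
  exists d.
Qed.

Let bounded : exists M : R, forall x y t, t \in `[0, 1] -> `|be x y t| <= M.
Proof.
have [|[x y]|d d0 dP] := @uniform_positive R _ (fun i : T * T => fun d : R =>
    forall t, t \in `[0, 1] -> `|be i.1 i.2 t| <= d^-1).
- move=> i d d' H dd' d'0 t ti; apply: le_trans (H t ti) _.
  by rewrite lef_pV2 // posrE // (lt_le_trans d'0).
- have [M MP] := arc_bounded (be_cont (x := x) (y := y)).
  have M0 : 0 < Num.max M 1 by rewrite lt_max ltr01 orbT.
  exists (Num.max M 1)^-1; first by rewrite invr_gt0.
  by move=> t ti; rewrite invrK le_max MP.
by exists d^-1 => x y; exact: (dP (x, y)).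
Qed.

Let unif (e : R) : 0 < e -> exists2 d : R, 0 < d & forall x y s t,
  s \in `[0, 1] -> t \in `[0, 1] -> `|s - t| < d -> `|be x y s - be x y t| < e.
Proof.
move=> e0.
have [|[x y]|d d0 dP] := @uniform_positive R _ (fun i : T * T => fun d : R =>
    forall s t, s \in `[0, 1] -> t \in `[0, 1] -> `|s - t| < d ->
      `|be i.1 i.2 s - be i.1 i.2 t| < e).
- by move=> i d d' H dd' _ s t si ti st; apply: H => //; exact: lt_le_trans dd'.
- exact: arc_unif_continuous (be_cont (x := x) (y := y)) e0.
by exists d => // x y; exact: (dP (x, y)).
Qed.

Lemma drawing_has_faces : has_faces g.
Proof.
have [dl dl0 dlP] := separation; have [M MP] := bounded.
(* Three errors add up to [dl]: the size of a rounding cell and, for each of two walks, the lag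
   between the times at which its two coordinates are sampled. *)
pose ep := dl / 3; have ep0 : 0 < ep by rewrite divr_gt0.
have [du du0 duP] := unif ep0.
(* Steps of [1 / (3 * k)] put 1/3 and 2/3 among the sample times. Walk indices run to [6 * k], since
   every step is split into two. *)
pose k := (Num.truncn du^-1).+1.
have k0 : 0 < k%:R :> R by rewrite ltr0n.
have kdu : (3 * k%:R)^-1 < du.
  rewrite invf_plt ?posrE ?mulr_gt0 //; apply: (@lt_le_trans _ _ k%:R).
    by rewrite /k; have /andP[] := truncn_itv (ltW (etrans (invr_gt0 du) du0)).
  by rewrite ler_peMl ?ler1n ?ltW.
pose tm i : R := i%:R / (3 * k%:R).
have tm_itv a b i : (a <= i <= b)%N -> tm a <= tm i <= tm b.
  by move=> /andP[ai ib]; rewrite !ler_pM2r ?invr_gt0 ?mulr_gt0 // !ler_nat ai.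
have tm0 : tm 0%N = 0 by rewrite /tm mul0r.
have tmk : tm k = 3^-1 by rewrite /tm invfM mulrCA divff ?mulr1 ?gt_eqF.
have tm2k : tm (2 * k)%N = 2 / 3 by rewrite /tm natrM -mulrA -/(tm k) tmk.
have tm3k : tm (3 * k)%N = 1 by rewrite /tm natrM divff // gt_eqF // mulr_gt0.
have tm01 i : (i <= 3 * k)%N -> tm i \in `[0, 1].
  by move=> ik; rewrite in_itv /= -tm0 -tm3k tm_itv.
have tmS i : `|tm i - tm i.+1| < du.
  have -> : tm i - tm i.+1 = - (3 * k%:R)^-1 by rewrite /tm -natr1; lra.
  by rewrite normrN gtr0_norm // invr_gt0 mulr_gt0.
(* The offset 2, and the offset 5 in [m], keep the walks and all their neighbours off the rim. *)
pose rd (v : R) := (Num.truncn ((v + M) / ep)).+2.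
have rd_eq u v : - M <= u -> - M <= v -> rd u = rd v -> `|u - v| < ep.
  move=> hu hv [E].
  have pu : 0 <= (u + M) / ep by apply: divr_ge0; [rewrite -lerBlDr sub0r|exact: ltW].
  have pv : 0 <= (v + M) / ep by apply: divr_ge0; [rewrite -lerBlDr sub0r|exact: ltW].
  have := truncn_itv pu; have := truncn_itv pv; rewrite E -natr1 => /andP[v1 v2] /andP[u1 u2].
  have : `|(u + M) / ep - (v + M) / ep| < 1 by rewrite ltr_norml; lra.
  by rewrite -mulrBl opprD addrACA subrr addr0 normrM normfV (gtr0_norm ep0) ltr_pdivrMr ?mul1r.
have rd_step u v : - M <= u -> - M <= v -> `|u - v| < ep -> (rd u <= (rd v).+1)%N.
  move=> hu hv uv; rewrite /rd !ltnS.
  have pu : 0 <= (u + M) / ep by apply: divr_ge0; [rewrite -lerBlDr sub0r|exact: ltW].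
  have pv : 0 <= (v + M) / ep by apply: divr_ge0; [rewrite -lerBlDr sub0r|exact: ltW].
  have := truncn_itv pu; have := truncn_itv pv; rewrite -natr1 => /andP[v1 v2] /andP[u1 u2].
  have : (u + M) / ep - (v + M) / ep < 1.
    rewrite -mulrBl opprD addrACA subrr addr0 ltr_pdivrMr ?mul1r //.
    exact: le_lt_trans (ler_norm _) uv.
  move=> h; rewrite -ltnS -(ltr_nat R) -!natr1; lra.
pose m := (Num.truncn ((M + M) / ep)).+4.+1.
have rd_max v : - M <= v -> v <= M -> (1 < rd v)%N && ((rd v).+2 < m)%N.
  move=> hv vM; rewrite /rd /m /= !ltnS; apply: le_truncn.
  by rewrite ler_pM2r ?invr_gt0 // lerD2r.
have bnd x y i : (i <= 3 * k)%N ->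
    [/\ - M <= (be x y (tm i)).1, (be x y (tm i)).1 <= M,
        - M <= (be x y (tm i)).2 & (be x y (tm i)).2 <= M].
  move=> ik; have := MP x y _ (tm01 i ik); rewrite prod_normE ge_max => /andP[].
  by rewrite !ler_norml => /andP[-> ->] /andP[-> ->].
(* Between two samples the walk moves in one coordinate at a time. *)
pose w x y j : 'I_m.+1 * 'I_m.+1 :=
  (inord (rd (be x y (tm (uphalf j))).1), inord (rd (be x y (tm j./2)).2)).
have wval x y j : (j <= 6 * k)%N ->
    ((w x y j).1 = rd (be x y (tm (uphalf j))).1 :> nat) *
    ((w x y j).2 = rd (be x y (tm j./2)).2 :> nat).
  move=> /(@half_le k)/andP[h1 h2]; have [b1 b2 _ _] := bnd x y _ h1; have [_ _ b3 b4] := bnd x y _ h2.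
  have := rd_max _ b1 b2; have := rd_max _ b3 b4; move=> /andP[_ r2] /andP[_ r1].
  have lt3 n : (n.+2 < m)%N -> (n < m.+1)%N by clear; lia.
  by split; rewrite /= inordK //; apply: lt3.
pose core (p : 'I_m.+1 * 'I_m.+1) := [&& 1 < p.1, p.1.+1 < m, 1 < p.2 & p.2.+1 < m]%N.
have wcore x y j : (j <= 6 * k)%N -> core (w x y j).
  move=> jk; rewrite /core !wval //; have /andP[h1 h2] := @half_le k _ jk.
  have [b1 b2 _ _] := bnd x y _ h1; have [_ _ b3 b4] := bnd x y _ h2.
  have := rd_max _ b1 b2; have := rd_max _ b3 b4; move=> /andP[-> r2] /andP[-> r1].
  by rewrite (ltnW r1) (ltnW r2).
have meet x y x' y' j j' : (j <= 6 * k)%N -> (j' <= 6 * k)%N -> w x y j = w x' y' j' ->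
    `|be x y (tm (uphalf j)) - be x' y' (tm (uphalf j'))| < dl.
  move=> jk jk' E.
  have /andP[h1 h2] := @half_le k _ jk; have /andP[h1' h2'] := @half_le k _ jk'.
  have [b1 _ _ _] := bnd x y _ h1; have [_ _ b2 _] := bnd x y _ h2.
  have [b1' _ _ _] := bnd x' y' _ h1'; have [_ _ b2' _] := bnd x' y' _ h2'.
  have E1 : `|(be x y (tm (uphalf j))).1 - (be x' y' (tm (uphalf j'))).1| < ep.
    by apply: rd_eq => //; rewrite -(wval x y j jk).1 E (wval x' y' j' jk').1.
  have E2 : `|(be x y (tm j./2)).2 - (be x' y' (tm j'./2)).2| < ep.
    by apply: rd_eq => //; rewrite -(wval x y j jk).2 E (wval x' y' j' jk').2.
  have N2 u v i : (i <= 6 * k)%N ->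
      `|(be u v (tm (uphalf i))).2 - (be u v (tm i./2)).2| < ep.
    move=> /(@half_le k)/andP[i1 i2].
    have : `|be u v (tm (uphalf i)) - be u v (tm i./2)| < ep.
      apply: duP; [exact: tm01|exact: tm01|].
      rewrite uphalf_half; case: (odd i); last by rewrite add0n subrr normr0.
      by rewrite add1n distrC.
    by rewrite prod_normE gt_max => /andP[].
  have n1 := N2 x y j jk; have n2 := N2 x' y' j' jk'.
  have dlE : dl = ep + ep + ep by rewrite /ep; field.
  rewrite prod_normE gt_max dlE /=; apply/andP; split; last exact: dist_chain n1 E2 n2.
  by apply: lt_trans E1 _; rewrite -addrA ltrDl addr_gt0.
pose W x y a b := [set w x y (val j) | j : 'I_(6 * k).+1 & (a <= j <= b)%N]%SET.
have Wconn x y a b : (b <= 6 * k)%N -> connected_set (@adj m) (W x y a b).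
  move=> bk; apply: lazy_walk_connected; [exact: adj_sym|by rewrite ltnS|].
  move=> j /andP[aj jb]; have jk : (j < 6 * k)%N by exact: leq_trans bk.
  have j1 := wval x y j (ltnW jk); have j2 := wval x y j.+1 jk.
  have /andP[h1 h2] := @half_le k _ (ltnW jk); have /andP[h1' h2'] := @half_le k _ jk.
  have close : `|be x y (tm (uphalf j)) - be x y (tm (uphalf j.+1))| < ep /\
      `|be x y (tm j./2) - be x y (tm j.+1./2)| < ep.
    have sm a' b' : (a' <= 3 * k)%N -> (b' <= 3 * k)%N -> a' = b' \/ b' = a'.+1 ->
        `|be x y (tm a') - be x y (tm b')| < ep.
      move=> ha hb ab; apply: duP; [exact: tm01|exact: tm01|].
      by case: ab => ->; [rewrite subrr normr0|exact: tmS].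
    by case: (half_step j) => -[E1 E2]; split; apply: sm => //; rewrite ?E1 ?E2; auto.
  have [c1 c2] := close; move: c1 c2; rewrite !prod_normE !gt_max /= => /andP[c1 _] /andP[_ c2].
  have [b1 _ _ _] := bnd x y _ h1; have [_ _ b2 _] := bnd x y _ h2.
  have [b1' _ _ _] := bnd x y _ h1'; have [_ _ b2' _] := bnd x y _ h2'.
  have s1 := rd_step _ _ b1 b1' c1; have s2 := rd_step _ _ b2 b2' c2.
  rewrite distrC in c1; rewrite distrC in c2.
  have s1' := rd_step _ _ b1' b1 c1; have s2' := rd_step _ _ b2' b2 c2.
  rewrite -j1.1 -j2.1 in s1 s1'; rewrite -j1.2 -j2.2 in s2 s2'.
  case: (half_step j) => -[E _].
    by apply: adj_step2 => //; rewrite j1.1 j2.1 E.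
  by apply: adj_step1 => //; rewrite j1.2 j2.2 E.
have Wcore x y a b p : (b <= 6 * k)%N -> p \in W x y a b -> core p.
  move=> bk /imsetP[j]; rewrite inE => /andP[_ jb] ->; apply: wcore; exact: leq_trans bk.
have Wseg x y h p : p \in W x y (if h then 0 else 2 * k)%N (if h then 2 * k else 4 * k)%N ->
    exists j, [/\ (j <= 6 * k)%N, p = w x y j & tm (uphalf j) \in seg h].
  case/imsetP => j; rewrite inE => hj ->; exists j; split=> //; first by rewrite -ltnS.
  have a12 : ((if h then 0 else k) <= uphalf j <= (if h then k else 2 * k))%N.
    by case: (h) hj => /andP[h1 h2]; move: h1 h2; clear; lia.
  have := tm_itv _ _ _ a12.
  by rewrite /seg in_itv; case: (h) => /=; rewrite ?tm0 tmk ?tm2k.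
have Wdisj x y h x' y' h' p : sep ((x, y, h), (x', y', h')) ->
    p \in W x y (if h then 0 else 2 * k)%N (if h then 2 * k else 4 * k)%N ->
    p \in W x' y' (if h' then 0 else 2 * k)%N (if h' then 2 * k else 4 * k)%N -> False.
  move=> se /Wseg[j [jk -> tj]] /Wseg[j' [jk' E tj']].
  by have := meet _ _ _ _ _ _ jk jk' E; rewrite ltNge (dlP _ se _ _ tj tj').
have k26 : (2 * k <= 6 * k)%N by lia.
have k46 : (4 * k <= 6 * k)%N by lia.
have Wmem x y a b j : (b <= 6 * k)%N -> (a <= j <= b)%N -> w x y j \in W x y a b.
  move=> bk /andP[aj jb]; apply/imsetP; exists (Ordinal (leq_ltn_trans jb (bk : (b < (6 * k).+1)%N))).
    by rewrite inE aj jb.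
  by [].
pose SH x := (\bigcup_(y : T) W x y 0 (2 * k)%N)%SET.
pose SM x y := W x y (2 * k)%N (4 * k)%N.
have SHP x p : p \in SH x -> exists y, p \in W x y 0 (2 * k)%N.
  by case/bigcupP => y _ py; exists y.
have WSH x y p : p \in W x y 0 (2 * k)%N -> p \in SH x.
  by move=> py; apply/bigcupP; exists y.
(* All walks from [x] start at the rounded position of [x], which makes [SH x] connected. *)
have w0 x y : w x y 0 = w x x 0 by rewrite /w /= tm0 !be0.
apply: (@strings_has_faces T _ _ g (@adj m) (@inner m) (@gfl m) g_sym g_irr (@adj_sym m)
  (@adj_irr m) (@grid_even m) (@grid_potential m) SH SM core).
- by move=> p; rewrite /core /inner; lia.
- by move=> [a b] [c d]; rewrite /core /inner /adj /upward /rightward -!val_eqE /=; lia.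
- by move=> x p /SHP[y]; exact: Wcore.
- by move=> x y p _ _; exact: Wcore.
- move=> x p q /SHP[y py] /SHP[z qz].
  have sub u : subrel (inside (@adj m) (W x u 0 (2 * k)%N)) (inside (@adj m) (SH x)).
    by move=> a b /= /and3P[-> /WSH-> /WSH->].
  have W0 u : w x x 0 \in W x u 0 (2 * k)%N by rewrite -(w0 x u) Wmem.
  apply: (connect_trans (y := w x x 0)).
    exact: connect_sub_rel (sub y) (Wconn x y _ _ k26 _ _ py (W0 y)).
  exact: connect_sub_rel (sub z) (Wconn x z _ _ k26 _ _ (W0 z) qz).
- by move=> x y _ _; exact: Wconn.
- by move=> x; exists (w x x 0); apply: (WSH _ x); exact: Wmem.
- move=> x y _ _; exists (w x y (2 * k)%N); split; last by apply: Wmem => //; lia.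
  by apply: (WSH _ y); apply: Wmem => //; lia.
- move=> x y xy _; exists (w x y (4 * k)%N); split; last by apply: Wmem => //; lia.
  (* At even indices both coordinates are sampled at the same time, here 2/3 of the arc from [x],
     which is 1/3 of the arc from [y]. *)
  have -> : w x y (4 * k)%N = w y x (2 * k)%N.
    have e1 n : uphalf (2 * n) = n by lia.
    have e2 n : (2 * n)./2 = n by lia.
    have -> : (4 * k = 2 * (2 * k))%N by lia.
    by rewrite /w !e1 !e2 tm2k tmk !(be_rev _ xy) (_ : 1 - 3^-1 = 2 / 3) //; lra.
  by apply: (WSH _ x); apply: Wmem => //; lia.
- move=> x y p /SHP[z pz] /SHP[z' pz']; apply/eqP/negPn/negP => xy.
  by apply: (Wdisj x z true y z' true p) pz pz' => s t; exact: sepHH.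
- move=> x y z p xy _ pM /SHP[z' pz]; have [->|zx] := eqVneq z x; first by left.
  have [->|zy] := eqVneq z y; first by right.
  by exfalso; apply: (Wdisj x y false z z' true p) pM pz => s t; exact: sepMH.
- move=> x y u v p xy lxy uv luv pM pM'.
  have [E|n] := eqVneq [set x; y]%SET [set u; v]%SET; last first.
    by exfalso; apply: (Wdisj x y false u v false p) pM pM' => s t; exact: sepMM.
  have xuv : x \in [set u; v]%SET by rewrite -E !inE eqxx.
  have yuv : y \in [set u; v]%SET by rewrite -E !inE eqxx orbT.
  move: xuv yuv; rewrite !inE => /orP[] /eqP xE /orP[] /eqP yE; subst x y => //.
  + by rewrite g_irr in xy.
  + by move: lxy luv; clear; lia.
  + by rewrite g_irr in xy.
Qed.

End Draw.

(** * From planar drawings to face labellings *)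

Section PlanarFaces.
Local Open Scope ring_scope.

Lemma planar_has_faces (R : realType) (T : finType) (e g : rel T) :
  planar e R -> symmetric g -> irreflexive g -> subrel g e -> has_faces g.
Proof.
move=> [pt [gamma [pt_inj arcs arc_pt' arc_arc']]] g_sym g_irr ge.
have arc_pt A x (t : R) : A \in edges e -> t \in `]0, 1[ -> gamma A t <> pt x.
  by move=> Ae t01; apply: arc_pt' => //; exact: mem_set.
have arc_arc A B (s t : R) : A \in edges e -> B \in edges e -> A <> B ->
    s \in `]0, 1[ -> t \in `]0, 1[ -> gamma A s <> gamma B t.
  by move=> Ae Be AB s01 t01; apply: arc_arc' => //; exact: mem_set.
have arc_inj A (s t : R) : A \in edges e -> s \in `[0, 1] -> t \in `[0, 1] ->
    gamma A s = gamma A t -> s = t.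
  by move=> Ae s01 t01; have [_ inj _] := arcs A Ae; apply: inj; exact: mem_set.
have edge x y : g x y -> [set x; y]%SET \in edges e.
  by move=> /ge xy; apply/imsetP; exists (x, y); rewrite ?inE.
have ends x y : g x y ->
    let A := [set x; y]%SET in (gamma A 0 = pt x /\ gamma A 1 = pt y) \/
    (gamma A 0 != pt x /\ gamma A 0 = pt y /\ gamma A 1 = pt x).
  move=> xy A; have [_ _ AE] := arcs A (edge x y xy).
  have nxy : pt x <> pt y by move=> /pt_inj E; move: xy; rewrite E g_irr.
  have inA z : z \in A -> gamma A 0 = pt z \/ gamma A 1 = pt z.
    move=> zA; have : (pt @` [set x | x \in A])%classic (pt z) by exists z.
    by rewrite -AE => -[->|->]; [left|right].
  have [x0|x1] := inA x (set21 _ _).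
    left; split=> //; have [y0|//] := inA y (set22 _ _).
    by case: nxy; rewrite -x0 -y0.
  right; have [y0|y1] := inA y (set22 _ _); last by case: nxy; rewrite -x1 -y1.
  by rewrite y0; split=> //; apply/eqP => /esym.
(* Arcs are run from their first argument, whatever direction [gamma] has; for non-adjacent
   arguments the arc stays at [pt x]. *)
pose be x y : R -> R * R := if g x y then
   (if gamma [set x; y]%SET 0 == pt x then gamma [set x; y]%SET \o @clamp R
    else (gamma [set x; y]%SET \o @clamp R) \o (fun t => 1 - t)) else fun _ => pt x.
have c0 : clamp (0 : R) = 0 by apply: clamp_id; rewrite in_itv /= lexx ler01.
have c1 : clamp (1 : R) = 1 by apply: clamp_id; rewrite in_itv /= lexx ler01.
have be_cont x y : continuous (be x y).
  rewrite /be; case xy: (g x y); last by move=> t; exact: cvg_cst.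
  have [/clamp_continuous cA _ _] := arcs _ (edge x y xy).
  case: ifP => _; first exact: cA.
  move=> t; apply: continuous_comp; last exact: cA.
  by apply: cvgB; [exact: cvg_cst|exact: cvg_id].
have be0 x y : be x y 0 = pt x.
  rewrite /be; case xy: (g x y) => //.
  case: (ends x y xy) => [[E _]|[/negbTE n [_ E]]]; first by rewrite E eqxx /= c0.
  by rewrite n /= subr0 c1.
have be_rev x y t : g x y -> be y x t = be x y (1 - t).
  move=> xy; have nxy : pt x != pt y.
    by apply/eqP => /pt_inj E; move: xy; rewrite E g_irr.
  rewrite /be xy g_sym xy (finset.setUC [set y]%SET).
  case: (ends x y xy) => [[E _]|[/negbTE n [E _]]].
    by rewrite E eqxx (negbTE nxy) /=.
  by rewrite n E eqxx /= subKr.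
have beE x y : g x y -> exists u : R -> R,
    [/\ forall t, be x y t = gamma [set x; y]%SET (u t),
        forall t, t \in `]0, 1[ -> u t \in `]0, 1[ &
        forall s t, s \in `[0, 1] -> t \in `[0, 1] -> be x y s = be x y t -> s = t].
  move=> xy; rewrite /be xy; have inj := arc_inj _ _ _ (edge x y xy).
  have oo (t : R) : t \in `]0, 1[ -> t \in `[0, 1].
    by rewrite !in_itv /= => /andP[/ltW-> /ltW->].
  have rv (t : R) : t \in `[0, 1] -> 1 - t \in `[0, 1].
    by rewrite !in_itv /= => /andP[? ?]; lra.
  case: ifP => _.
    exists (@clamp R); split=> // [t t01|s t s01 t01 /=]; first by rewrite (clamp_id (oo _ t01)).
    by rewrite (clamp_id s01) (clamp_id t01); exact: inj.
  exists (fun t => clamp (1 - t)); split=> // [t t01|s t s01 t01 /=].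
    rewrite clamp_id; first by move: t01; rewrite !in_itv /= => /andP[? ?]; lra.
    exact/rv/oo.
  rewrite !clamp_id ?rv // => /(inj _ _ (rv _ s01) (rv _ t01)); lra.
have cases x y s : s \in `[0, 2 / 3] -> be x y s = pt x \/ g x y /\ s \in `]0, 1[.
  rewrite in_itv /= => /andP[s0 s1]; case xy: (g x y); last by left; rewrite /be xy.
  have [->|sn] := eqVneq s 0; first by left.
  by right; split=> //; rewrite in_itv /=; apply/andP; split; [rewrite lt_def sn|lra].
have off x y z s : g x y -> s \in `]0, 1[ -> be x y s <> pt z.
  move=> xy s01; have [u [uE uI _]] := beE x y xy; rewrite uE.
  exact: arc_pt (edge x y xy) (uI _ s01).
have apart2 x y u v s t : g x y -> g u v -> [set x; y]%SET != [set u; v]%SET ->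
    s \in `]0, 1[ -> t \in `]0, 1[ -> be x y s <> be u v t.
  move=> xy uv ne s01 t01; have [a [aE aI _]] := beE x y xy; have [b [bE bI _]] := beE u v uv.
  by rewrite aE bE; apply: arc_arc (edge x y xy) (edge u v uv) _ (aI _ s01) (bI _ t01); exact/eqP.
have H2 (t : R) : t \in `[0, 3^-1] -> t \in `[0, 2 / 3].
  by rewrite !in_itv /= => /andP[-> ?] /=; lra.
have M1 (t : R) : t \in `[3^-1, 2 / 3] -> t \in `]0, 1[.
  by rewrite !in_itv /= => /andP[? ?]; apply/andP; split; lra.
apply: (@drawing_has_faces R T g g_sym g_irr pt be be_cont be0 be_rev).
- move=> x y x' y' s t xx' s01 t01.
  case: (cases x y s (H2 s s01)) => [->|[xy s1]]; case: (cases x' y' t (H2 t t01)) => [->|[xy' t1]].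
  + by move=> /pt_inj E; rewrite E eqxx in xx'.
  + by move=> /esym; exact: off.
  + exact: off.
  + have [E|ne] := eqVneq [set x; y]%SET [set x'; y']%SET; last exact: apart2.
    (* The same edge run from both ends: equal points would have one parameter at most 1/3 and the
       other at least 2/3. *)
    have xE : x = y'.
      have : x \in [set x'; y']%SET by rewrite -E !inE eqxx.
      by rewrite !inE (negbTE xx') => /eqP.
    have x'E : x' = y.
      have : x' \in [set x; y]%SET by rewrite E !inE eqxx.
      by rewrite !inE eq_sym (negbTE xx') => /eqP.
    subst x' y'; rewrite (be_rev x y t xy); have [u [_ _ inj]] := beE x y xy.
    have i1 : s \in `[0, 1] by move: s01; rewrite !in_itv /= => /andP[-> ?] /=; lra.
    have i2 : 1 - t \in `[0, 1].
      by move: t01; rewrite !in_itv /= => /andP[? ?]; apply/andP; split; lra.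
    move=> eqst; have := inj _ _ i1 i2 eqst; move: s01 t01; rewrite !in_itv /= => /andP[_ ?] /andP[_ ?]; lra.
- move=> x y z w s t xy zx zy s01 t01.
  case: (cases z w t (H2 t t01)) => [->|[zw t1]]; first exact: off xy (M1 s s01).
  apply: apart2 xy zw _ (M1 s s01) t1; apply/eqP => E.
  have : z \in [set x; y]%SET by rewrite E !inE eqxx.
  by rewrite !inE (negbTE zx) (negbTE zy).
- move=> x y u v s t xy uv ne s01 t01; exact: apart2 xy uv ne (M1 s s01) (M1 t t01).
Qed.

End PlanarFaces.

(** * Girth, minimal counterexamples and the bound on [chi2] *)

Lemma girth_ge_cycle (T : finType) (e : rel T) k : girth_ge e k.+1 ->
  forall c, ucycle e c -> (2 < size c -> k < size c)%N.
Proof.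
rewrite /girth_ge /girth; case: pselect => [h|nh] + c cc sc.
  case: ex_minnP => g _ /(_ (size c)) gmin kg; apply: leq_trans kg (gmin _).
  by rewrite /has_cycle sc; apply/existsP; exists (in_tuple c).
by move=> _; case: nh; exists (size c); rewrite /has_cycle sc; apply/existsP; exists (in_tuple c).
Qed.

Lemma colorable_chi2 (T : finType) (e : rel T) : colorable e [set: T]%SET -> (chi2 e <= 6)%N.
Proof.
move=> [phi phiP]; rewrite /chi2; case: ex_minnP => n _; apply; apply/existsP.
exists [ffun x => phi x]; apply/forallP => x; apply/forallP => y; apply/implyP.
rewrite !ffunE => /andP[xy /existsP[n' /existsP[p /andP[xp /eqP py]]]].
apply: phiP; rewrite /sq !inE xy /=.
have := size_tuple p; case: (tval p) xp py => [|a [|b [|c s]]] /=.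
- by move=> _ E; rewrite E eqxx in xy.
- by rewrite andbT => xa <-; rewrite xa.
- move=> /and3P[xa ab _] <- _; apply/orP; right; apply/exists_inP; exists a; rewrite ?inE //.
  by rewrite xa ab.
- by move=> _ _ sz; have := ltn_ord n'; rewrite -sz.
Qed.

Lemma critical_exists (T : finType) (e : rel T) (A : {set T}) :
  ~ colorable e A -> exists B, critical e B.
Proof.
have [n] := ubnP #|A|; elim: n A => // n IHn A An nA.
have [[B [BA nB]]|none] := pselect (exists B : {set T}, B \proper A /\ ~ colorable e B).
  by apply: (IHn B) => //; exact: leq_trans (proper_card BA) An.
by exists A; split=> // B BA; have [//|nB] := pselect (colorable e B); case: none; exists B.
Qed.

Theorem theorem2 (R : realType) (T : finType) (e : rel T)
    (e_sym : symmetric e) (e_irr : irreflexive e)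
    (e_planar : planar e R) (e_subcubic : (max_degree e <= 3)%N)
    (e_girth : girth_ge e 8) :
  (chi2 e <= 6)%N.
Proof.
apply: colorable_chi2; apply: contrapT => /critical_exists[A crit].
have subcubic x : (#|[set y | e x y]%SET| <= 3)%N.
  by apply: leq_trans e_subcubic; apply: (leq_bigmax x).
pose g : rel T := fun x y => [&& x \in A, y \in A & e x y].
have [|||F [fl [ev pot]]] := @planar_has_faces R T e g e_planar.
- by move=> x y; rewrite /g andbCA e_sym.
- by move=> x; rewrite /g e_irr !andbF.
- by move=> x y /and3P[].
exact: (discharge e_sym e_irr (girth_ge_cycle e_girth) subcubic crit ev pot).
Qed.
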